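(* Let $\mathcal M$ be an o-minimal structure and let $$E:\ 1\rightarrow A\xrightarrow{i}\tilde G\xrightarrow{\pi} G\rightarrow 1$$ be an $\mathcal M$-definable central extension of the definable group $G$. Let $\mathbf G$ be an arbitrary expansion of the group $\langle G,\cdot\rangle$ (not necessarily definable in $\mathcal M$) such that: (1) $\mathbf G$ has property $\rho$; (2) for every $n\in\mathbb N$, the set $i(A)\cap[\tilde G,\tilde G]_n$ is finite; (3) there exists $r\in\mathbb N$ with $G=[G,G]_r$. Then $E$ (i.e. the structure $\langle A,\tilde G,G,i,\pi\rangle$) can be defined in the two-sorted structure $\langle \mathbf G, A\rangle$ over $A$ and $G$. More precisely, there is an exact sequence $E':1\rightarrow A\rightarrow \tilde G'\rightarrow G\rightarrow 1$, definable in $\langle\mathbf G,A\rangle$ over an imaginary parameter $\bar c$, such that $E'$ is definably isomorphic, in the structure $\langle A,\tilde G,\mathbf G,i,\pi\rangle$ (with $G$ expanded to $\mathbf G$), to $E$, where the isomorphisms on $A$ and on $G$ are the identity maps. The imaginary parameter $\bar c$ names a map from the set of definably connected components of a $0$-definable set in the group $\langle G,\cdot\rangle$ onto a finite subset of $A$, and this map is $0$-definable in the structure $\langle A,\tilde G,G,i,\pi\rangle$.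
   Context: ''Definable'' means definable with parameters (in $\mathcal M^{eq}$). Standing assumption: every group definable in $\mathcal M$ is definably isomorphic to one whose universe is a subset of some $M^n$; such a group carries a canonical group topology (Pillay's topology), with respect to which every definable subset has finitely many definably connected components. A definable central extension of $G$ consists of definable groups $A,\tilde G$ and definable homomorphisms $i:A\to\tilde G$, $\pi:\tilde G\to G$ forming an exact sequence with $i(A)$ central in $\tilde G$. Two such exact sequences are (definably) isomorphic if there are (definable) group isomorphisms between the corresponding terms commuting with the sequence maps. For a group $H$, $[H,H]_n$ denotes the set of all products of $n$ commutators $xyx^{-1}y^{-1}$ in $H$. An expansion $\mathbf G$ of $G$ has property $\rho$ if for every $\langle G,\cdot\rangle$-definable set $X\subseteq G^n$, every definably connected component of $X$ (with respect to the group topology of $G$) is definable in $\mathbf G$, possibly over new parameters. $\langle\mathbf G,A\rangle$ denotes the two-sorted structure consisting of $G$ with its $\mathbf G$-structure and $A$ with just its group structure. *)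

(* Defs.v *)
From HB Require Import structures.
From mathcomp Require Import all_boot all_order all_algebra.
From mathcomp Require Import all_classical topology.

Set Implicit Arguments.
Unset Strict Implicit.
Unset Printing Implicit Defensive.

Local Open Scope classical_set_scope.
Local Open Scope group_scope.

(** The language is purely relational: operations are given by their graphs and
    constants by singletons, which changes no notion of definability. Tuples are
    indexed by sorted families of variables [V : sorts N -> Type]; the relation [r]
    takes its arguments in the variables [arity r], finite in all the structures
    built below. *)
Record structure := Structure {
  sorts : Type;
  dom : sorts -> Type;
  symbols : Type;
  arity : symbols -> sorts -> Type;
  interp : forall r : symbols, (forall s, arity r s -> dom s) -> Prop }.
Arguments dom N s : clear implicits, rename.
Arguments arity N r s : clear implicits, rename.
Arguments interp {N} r e : rename.

Section FirstOrder.
Variable N : structure.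
Implicit Types V W : sorts N -> Type.

Definition env V := forall s, V s -> dom N s.

Definition ext_vars V (s : sorts N) : sorts N -> Type := fun t => (V t + (s = t))%type.

Inductive formula V : Type :=
| FBot
| FEq (s : sorts N) (x y : V s)
| FRel (r : symbols N) (x : forall s, arity N r s -> V s)
| FImp (phi psi : formula V)
| FEx (s : sorts N) (phi : formula (ext_vars V s)).

Definition ext_env V (e : env V) s (a : dom N s) : env (ext_vars V s) := fun t x =>
  match x with
  | inl v => e t v
  | inr st => match st in _ = t return dom N t with erefl => a end
  end.

Definition join_env V W (e : env V) (e' : env W) :
  env (fun s => (V s + W s)%type) := fun s x =>
  match x with inl v => e s v | inr w => e' s w end.

Fixpoint sat V (phi : formula V) : env V -> Prop :=
  match phi with
  | FBot => fun _ => False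
  | FEq s x y => fun e => e s x = e s y
  | FRel r x => fun e => interp r (fun s z => e s (x s z))
  | FImp phi psi => fun e => sat phi e -> sat psi e
  | FEx s phi => fun e => exists a : dom N s, sat phi (ext_env e a)
  end.

Definition definable0 V (X : set (env V)) :=
  exists phi : formula V, forall e, X e <-> sat phi e.

(** Definable with parameters: all the elements are available as constants. *)
Definition definable V (X : set (env V)) :=
  exists phi : formula (fun s => (V s + dom N s)%type),
    forall e, X e <-> sat phi (join_env e (fun s (a : dom N s) => a)).

Definition definable_over s (c : dom N s) V (X : set (env V)) :=
  exists phi : formula (ext_vars V s), forall e, X e <-> sat phi (ext_env e c).

(** [c] is a canonical parameter (a name) of [X]. *)
Definition names s (c : dom N s) V (X : set (env V)) :=
  exists phi : formula (ext_vars V s), forall c' : dom N s,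
    (forall e, X e <-> sat phi (ext_env e c')) <-> c' = c.

End FirstOrder.

Section Imaginaries.
Variable N : structure.

Record imaginary_sort := ImaginarySort {
  iarity : sorts N -> nat;
  iformula : formula (fun s => ('I_(iarity s) + 'I_(iarity s))%type);
  irel (x y : env (fun s => 'I_(iarity s))) := sat iformula (join_env x y);
  irel_refl : forall x, irel x x;
  irel_sym : forall x y, irel x y -> irel y x;
  irel_trans : forall x y z, irel x y -> irel y z -> irel x z }.

Definition imaginary (Q : imaginary_sort) :=
  {C : set (env (fun s => 'I_(iarity Q s))) | exists x, C = [set y | irel x y]}.

(** [N^eq]; the symbol [inr Q] is the graph of the projection onto [Q]. It is formed
    below only when [N] has finitely many sorts, so that [iarity] is finite. *)
Definition eq_structure : structure := {|
  sorts := sorts N + imaginary_sort;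
  dom := fun t => match t with inl s => dom N s | inr Q => imaginary Q end;
  symbols := symbols N + imaginary_sort;
  arity := fun r t =>
    match r, t return Type with
    | inl r, inl s => arity N r s
    | inl _, inr _ => void
    | inr Q, inl s => 'I_(iarity Q s)
    | inr Q, inr Q' => Q = Q'
    end;
  interp := fun r =>
    match r with
    | inl r => fun e => interp r (fun s => e (inl s))
    | inr Q => fun e => sval (e (inr Q) erefl) (fun s => e (inl s))
    end |}.

Definition home_vars (V : sorts N -> Type) : sorts eq_structure -> Type :=
  fun t => match t with inl s => V s | inr _ => void end.

Definition home_set (V : sorts N -> Type) (X : set (env V)) :
  set (env (home_vars V)) := [set e | X (fun s => e (inl s))].

End Imaginaries.

Record relations (T : Type) := Relations {
  rname : Type;
  rarity : rname -> nat;
  rholds : forall r : rname, ('I_(rarity r) -> T) -> Prop }.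

Definition no_relations (T : Type) : relations T :=
  @Relations T void (fun _ => 0) (fun r => match r with end).

Definition is_mul (G : groupType) (x : 'I_3 -> G) :=
  x (@Ordinal 3 0 isT) * x (@Ordinal 3 1 isT) = x (@Ordinal 3 2 isT).

Definition group_structure (G : groupType) (R : relations G) : structure := {|
  sorts := unit;
  dom := fun _ => G;
  symbols := option (rname R);
  arity := fun r _ => if r is Some r' then 'I_(rarity r') else 'I_3;
  interp := fun r =>
    match r with
    | None => fun e => is_mul (e tt)
    | Some r' => fun e => rholds (e tt)
    end |}.

Definition order_structure d (M : orderType d) (R : relations M) : structure := {|
  sorts := unit;
  dom := fun _ => M;
  symbols := option (rname R);
  arity := fun r _ => if r is Some r' then 'I_(rarity r') else 'I_2;
  interp := fun r =>
    match r with
    | None => fun e => (e tt (@Ordinal 2 0 isT) < e tt (@Ordinal 2 1 isT))%O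
    | Some r' => fun e => rholds (e tt)
    end |}.

(** The two-sorted structure <G, A>, with the relations [R] added on [G]. *)
Variant sort2 := G2 | A2.
Variant rel2 (T : Type) := MulG2 | MulA2 | Extra2 (r : T).
Arguments MulG2 {T}.
Arguments MulA2 {T}.

Definition pair_structure (G A : groupType) (R : relations G) : structure := {|
  sorts := sort2;
  dom := fun s => match s with G2 => G | A2 => A end;
  symbols := rel2 (rname R);
  arity := fun r s =>
    match r, s with
    | MulG2, G2 => 'I_3
    | MulA2, A2 => 'I_3
    | Extra2 r', G2 => 'I_(rarity r')
    | _, _ => void
    end;
  interp := fun r =>
    match r with
    | MulG2 => fun e => is_mul (e G2)
    | MulA2 => fun e => is_mul (e A2)
    | Extra2 r' => fun e => rholds (e G2)
    end |}.

(** The structure <A, Gt, G, i, p>, with the relations [R] added on [G]. *)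
Variant sort3 := A3 | Gt3 | G3.
Variant rel3 (T : Type) := MulA3 | MulGt3 | MulG3 | GraphI | GraphP | Extra3 (r : T).
Arguments MulA3 {T}.
Arguments MulGt3 {T}.
Arguments MulG3 {T}.
Arguments GraphI {T}.
Arguments GraphP {T}.

Definition extension_structure (A Gt G : groupType) (i : A -> Gt) (p : Gt -> G)
    (R : relations G) : structure := {|
  sorts := sort3;
  dom := fun s => match s with A3 => A | Gt3 => Gt | G3 => G end;
  symbols := rel3 (rname R);
  arity := fun r s =>
    match r, s with
    | MulA3, A3 | MulGt3, Gt3 | MulG3, G3 => 'I_3
    | GraphI, A3 | GraphI, Gt3 => unit
    | GraphP, Gt3 | GraphP, G3 => unit
    | Extra3 r', G3 => 'I_(rarity r')
    | _, _ => void
    end;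
  interp := fun r =>
    match r with
    | MulA3 => fun e => is_mul (e A3)
    | MulGt3 => fun e => is_mul (e Gt3)
    | MulG3 => fun e => is_mul (e G3)
    | GraphI => fun e => i (e A3 tt) = e Gt3 tt
    | GraphP => fun e => p (e Gt3 tt) = e G3 tt
    | Extra3 r' => fun e => rholds (e G3)
    end |}.

Definition commutator_products (H : groupType) (n : nat) : set H :=
  [set z | exists x y : 'I_n -> H,
    z = \prod_(j < n) (x j * y j * (x j)^-1 * (y j)^-1)].
Arguments commutator_products H n : clear implicits.

Definition exact_sequence (A Gt G : groupType)
    (i : {multiplicative A -> Gt}) (p : {multiplicative Gt -> G}) :=
  [/\ injective i, range i = [set x | p x = 1] & range p = setT].

Definition central_extension (A Gt G : groupType)
    (i : {multiplicative A -> Gt}) (p : {multiplicative Gt -> G}) :=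
  exact_sequence i p /\ forall a x, i a * x = x * i a.

HB.mixin Record Group_isTopologicalGroup G of Group G & Topological G := {
  mulg_continuous : continuous (fun xy : G * G => xy.1 * xy.2);
  invg_continuous : continuous (fun x : G => x^-1) }.

#[short(type="topologicalGroupType")]
HB.structure Definition TopologicalGroup :=
  {G of Group G & Topological G & Group_isTopologicalGroup G}.

Section OMinimal.
Context {d : Order.disp_t} {M : orderType d}.
Variable R : relations M.

Definition definable_in_M (I : Type) (X : set (I -> M)) :=
  @definable (order_structure R) (fun _ => I) [set e | X (e tt)].

Definition o_minimal :=
  [/\ inhabited M,
      forall x y : M, (x < y)%O -> exists z, (x < z)%O /\ (z < y)%O,
      forall x : M, exists y z, (y < x)%O /\ (x < z)%O
    & forall X : set M, definable_in_M [set x : unit -> M | X (x tt)] ->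
        exists s : seq (interval M), forall x, X x <-> has (fun J => x \in J) s].

Definition definable_power (H : Type) n (c : H -> 'I_n -> M) k
    (X : set ('I_k -> H)) :=
  definable_in_M [set y : 'I_k * 'I_n -> M |
    exists2 x, X x & forall a, y a = c (x a.1) a.2].

Definition definable_graph (H K : Type) n m
    (c : H -> 'I_n -> M) (c' : K -> 'I_m -> M) (D : set H) (f : H -> K) :=
  definable_in_M [set y : 'I_n + 'I_m -> M |
    exists2 h, D h & (forall a, y (inl a) = c h a) /\
                     (forall a, y (inr a) = c' (f h) a)].

(** The topology makes [G] a definable manifold: finitely many definable charts
    [f j] are homeomorphisms from open sets [U j] covering [G] onto open subsets
    of [M^k]. On a definable group there is exactly one group topology with this
    property (Pillay). *)
Definition definable_atlas (G : topologicalType) n (c : G -> 'I_n -> M) :=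
  exists (k m : nat) (U : 'I_m -> set G)
         (f : 'I_m -> G -> {ptws 'I_k -> order_topology M}),
    [/\ forall g, exists j, U j g,
        forall j, open (U j),
        forall j, definable_graph c (fun v : 'I_k -> M => v) (U j) (f j),
        forall j, {in U j &, injective (f j)}
      & forall j (W : set G), W `<=` U j -> (open W <-> open (f j @` W))].

(** A definable group, with its group topology. The universe is an abstract type
    in definable bijection [coord] with a subset of some power of [M]. *)
Record definable_group := DefinableGroup {
  dcarrier :> topologicalGroupType;
  ncoord : nat;
  coord : dcarrier -> 'I_ncoord -> M;
  coord_inj : injective coord;
  definable_universe : definable_power coord [set: 'I_1 -> dcarrier];
  definable_mul : definable_power coord [set x | is_mul x];
  coord_atlas : definable_atlas coord }.

Definition definable_map (H K : definable_group) (f : H -> K) :=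
  definable_graph (@coord H) (@coord K) setT f.

Section Components.
Variables (G : definable_group) (k : nat).
Implicit Types C D X : set {ptws 'I_k -> G}.

Definition definably_connected C :=
  definable_power (@coord G) C /\
  forall D, definable_power (@coord G) D -> D `<=` C ->
    (exists2 O, open O & D = C `&` O) ->
    (exists2 O, open O & C `\` D = C `&` O) ->
    D = set0 \/ D = C.

Definition definable_component X C :=
  [/\ C `<=` X, C !=set0, definably_connected C
    & forall D, definably_connected D -> C `<=` D -> D `<=` X -> D = C].

End Components.

Definition definable_in_group (G : groupType) (S : relations G) k
    (X : set ('I_k -> G)) :=
  @definable (group_structure S) (fun _ => 'I_k) [set e | X (e tt)].

Definition property_rho (G : definable_group) (S : relations G) :=
  forall k (X : set {ptws 'I_k -> G}),
    definable_in_group (no_relations G) X ->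
    forall C, definable_component X C -> definable_in_group S C.

End OMinimal.

Section Interpretation.
Variables (G A : groupType) (S : relations G).
Local Notation N := (pair_structure A S).

Definition pair_vars (I J : Type) : sorts N -> Type :=
  fun s => match s with G2 => I | A2 => J end.

Definition pair_set (I J : Type) (X : (I -> G) -> (J -> A) -> Prop) :
  set (env (pair_vars I J)) :=
  [set e : env (pair_vars I J) | X (e G2) (e A2)].

Variables (Q : imaginary_sort N) (c : imaginary Q).

Definition pair_definable_over I J (X : (I -> G) -> (J -> A) -> Prop) :=
  @definable_over (eq_structure N) (inr Q) c _ (home_set (pair_set X)).

Definition pair_names I J (X : (I -> G) -> (J -> A) -> Prop) :=
  @names (eq_structure N) (inr Q) c _ (home_set (pair_set X)).

(** The sequence [A -> H -> G], with maps [i] and [p], is definable over [c] in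
    [N^eq]: [H] is the quotient of a set [U] of tuples in [G^m x A^n] by a
    [c]-definable equivalence relation, through the class map [cl], and the group
    law and both maps are [c]-definable. *)
Definition sequence_definable_over (H : groupType) (i : A -> H) (p : H -> G)
    m n (U : ('I_m -> G) -> ('I_n -> A) -> Prop)
    (cl : ('I_m -> G) -> ('I_n -> A) -> H) :=
  (forall h, exists x y, U x y /\ cl x y = h) /\
  [/\ pair_definable_over U,
      pair_definable_over (fun (x : 'I_2 * 'I_m -> G) (y : 'I_2 * 'I_n -> A) =>
        let u j := cl (fun a => x (j, a)) (fun b => y (j, b)) in
        (forall j, U (fun a => x (j, a)) (fun b => y (j, b))) /\
        u (@Ordinal 2 0 isT) = u (@Ordinal 2 1 isT)),
      pair_definable_over (fun (x : 'I_3 * 'I_m -> G) (y : 'I_3 * 'I_n -> A) =>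
        let u j := cl (fun a => x (j, a)) (fun b => y (j, b)) in
        (forall j, U (fun a => x (j, a)) (fun b => y (j, b))) /\ is_mul u),
      pair_definable_over (fun (x : 'I_m -> G) (y : 'I_n + unit -> A) =>
        U x (fun b => y (inl b)) /\ i (y (inr tt)) = cl x (fun b => y (inl b)))
    & pair_definable_over (fun (x : 'I_m + unit -> G) (y : 'I_n -> A) =>
        U (fun a => x (inl a)) y /\ p (cl (fun a => x (inl a)) y) = x (inr tt))].

End Interpretation.

Section InExtension.
Variables (A Gt G : groupType) (i : A -> Gt) (p : Gt -> G) (S : relations G).
Local Notation N := (extension_structure i p S).

Definition extension_vars (I J K : Type) : sorts N -> Type :=
  fun s => match s with A3 => I | Gt3 => J | G3 => K end.

Definition extension_set I J K (X : (I -> A) -> (J -> Gt) -> (K -> G) -> Prop) :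
  set (env (extension_vars I J K)) :=
  [set e : env (extension_vars I J K) | X (e A3) (e Gt3) (e G3)].

End InExtension.

(** The relation on [X x A] given by a map [f] on the set of components of [X]. *)
Definition component_map_graph d (M : orderType d) (R : relations M)
    (G : definable_group R) (A : Type) k (X : set {ptws 'I_k -> G})
    (f : set {ptws 'I_k -> G} -> A) (x : 'I_k -> G) (a : A) :=
  exists C, [/\ definable_component X C, C x & f C = a].

(* Main.v *)
(** Since [i A] is central, a commutator in [Gt] depends only on the images in [G] of
    its two entries; so do products of [r] commutators, which gives a map
    [F' : G^(2r) -> Gt] lifting the corresponding word map [F] of [G]. By (3) every
    element of [Gt] has the form [F'(x) i(a)], and the product of two such elements is
    determined by the values of [w(x, y, z) = F'(x) F'(y) F'(z)^-1], which lie in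
    [i A], on the 0-definable set [X] where [F(x) F(y) = F(z)]. By (2) [w] takes
    finitely many values on [X]; being continuous and definable, it is constant on each
    definably connected component of [X], and by [rho] its graph is definable in
    [<G, A>] with parameters, hence over a canonical parameter.

    Continuity of [w] does not need [p] to be open: by o-minimality the commutator map
    [G x G -> Gt] is continuous at some point, and the commutator identities carry
    continuity from there to every point. That [X] has finitely many components, and
    that definable maps have points of continuity, comes from a cell decomposition
    into definably connected sets that are either open or thin, thin meaning that one
    coordinate is a continuous function of the others. *)

Require Import Defs.
From HB Require Import structures.
From mathcomp Require Import all_boot all_order all_algebra.
From mathcomp Require Import all_classical topology.

Set Implicit Arguments.
Unset Strict Implicit.
Unset Printing Implicit Defensive.

Import Order.TTheory.

Local Open Scope classical_set_scope.
Local Open Scope group_scope.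

(** * Systems of definable sets *)

(** A section of [p], even one definable in M, would give a cocycle with no reason to be definable
    from G and A. The words [F'] replace it: G is parametrized redundantly by [G^(2r)], the
    representatives [F'(x)] are canonical, and [w] plays the part of the cocycle, its third argument
    sparing the choice of a word for a product. The formulas defining the components of [X] in the
    expansion of G use parameters that are not canonical; there are finitely many of them, so the
    graph of [w] on [X] has a name among the imaginaries.

    In the o-minimal part, M is a dense order with further relations on which no group law is
    assumed, and the group topology need not be induced by the coordinates. Hence neighbourhoods are
    boxes, connectedness is tested on definable predicates, and results reach groups through charts.
    Open or thin is all that is kept of dimension: a definable set of exceptional points containing
    no box consists of thin pieces, and these project injectively to one coordinate fewer, where
    induction applies. *)

(** Formulas are forgotten: only the closure properties of sets definable with parameters are kept,
    for variables indexed by any type. [Df_sub] renames variables and substitutes parameters at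
    once. *)
Record defsys (M : Type) := DefSys {
  Df :> forall I : Type, ((I -> M) -> Prop) -> Prop;
  Df_bot : forall I, Df (fun _ : I -> M => False);
  Df_eqv : forall I (i j : I), Df (fun e => e i = e j);
  Df_imp : forall I (P Q : (I -> M) -> Prop),
    Df P -> Df Q -> Df (fun e => P e -> Q e);
  Df_ex : forall I (P : (I -> M) -> M -> Prop),
    Df (fun e : option I -> M => P (fun i => e (Some i)) (e None)) ->
    Df (fun e => exists a, P e a);
  Df_sub : forall I J (s : J -> I + M) (P : (J -> M) -> Prop),
    Df P ->
    Df (fun e => P (fun j => match s j with inl i => e i | inr c => c end)) }.

Section DefinableSets.
Variables (M : Type) (D : defsys M).
Implicit Types I J : Type.

Lemma Df_ext I (P Q : (I -> M) -> Prop) :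
  (forall e, P e <-> Q e) -> D I P -> D I Q.
Proof. by move=> PQ; rewrite (_ : P = Q) //; apply: funext => e; apply: propext. Qed.

Lemma Df_ren I J (r : J -> I) (P : (J -> M) -> Prop) :
  D J P -> D I (fun e => P (fun j => e (r j))).
Proof. exact: (@Df_sub _ _ _ _ (fun j => inl (r j))). Qed.

Lemma Df_true I : D I (fun _ => True).
Proof. by apply: (@Df_ext _ (fun _ => False -> False)) => //; apply: Df_imp; apply: Df_bot. Qed.

Lemma Df_const I (p : Prop) : D I (fun _ => p).
Proof.
have [hp|hp] := pselect p.
  by apply: Df_ext (Df_true I).
by apply: Df_ext (Df_bot D I).
Qed.

Lemma Df_not I (P : (I -> M) -> Prop) : D I P -> D I (fun e => ~ P e).
Proof. by move=> DP; apply: Df_imp => //; apply: Df_bot. Qed.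

Lemma Df_and I (P Q : (I -> M) -> Prop) :
  D I P -> D I Q -> D I (fun e => P e /\ Q e).
Proof.
move=> DP DQ; apply: (@Df_ext _ (fun e => ~ (P e -> ~ Q e))).
  by move=> e; split=> [/not_implyP[? /contrapT]|[p q] h] //; exact: h.
by apply: Df_not; apply: Df_imp => //; apply: Df_not.
Qed.

Lemma Df_or I (P Q : (I -> M) -> Prop) :
  D I P -> D I Q -> D I (fun e => P e \/ Q e).
Proof.
move=> DP DQ; apply: (@Df_ext _ (fun e => ~ P e -> Q e)).
  by move=> e; split=> [h|[|]//]; have [?|?] := pselect (P e); [left|right; apply: h].
by apply: Df_imp => //; apply: Df_not.
Qed.

Lemma Df_iff I (P Q : (I -> M) -> Prop) :
  D I P -> D I Q -> D I (fun e => P e <-> Q e).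
Proof. by move=> DP DQ; apply: Df_and; apply: Df_imp. Qed.

Lemma Df_all I (P : (I -> M) -> M -> Prop) :
  D (option I) (fun e => P (fun i => e (Some i)) (e None)) ->
  D I (fun e => forall a, P e a).
Proof.
move=> DP; apply: (@Df_ext _ (fun e => ~ exists a, ~ P e a)).
  move=> e; split=> [h a|h [a]]; last exact.
  by apply: contrapT => nP; apply: h; exists a.
by apply: Df_not; apply: (@Df_ex _ _ _ (fun e a => ~ P e a)); apply: Df_not.
Qed.

(** One variable is quantified at a time: a tuple over ['I_n.+1] is its head with its tail, and an
    arbitrary finite index type is numbered by [enum_rank]. *)
Lemma Df_exv I (J : finType) (P : (I -> M) -> (J -> M) -> Prop) :
  D (I + J)%type (fun e => P (fun i => e (inl i)) (fun j => e (inr j))) ->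
  D I (fun e => exists v : J -> M, P e v).
Proof.
have ord n : forall I (P : (I -> M) -> ('I_n -> M) -> Prop),
    D (I + 'I_n)%type (fun e => P (fun i => e (inl i)) (fun j => e (inr j))) ->
    D I (fun e => exists v : 'I_n -> M, P e v).
  elim: n => [|n IHn] {}I {}P DP.
    have v0 : 'I_0 -> M by case.
    apply: (@Df_ext _ (fun e => P e v0)).
      move=> e; split=> [h|[v]]; first by exists v0.
      by rewrite (_ : v = v0) //; apply: funext; case.
    pose s (x : I + 'I_0) : I + M :=
      match x with inl i => inl i | inr j => inr (v0 j) end.
    apply: Df_ext (Df_sub s DP) => e.
    by rewrite (_ : (fun j : 'I_0 => _) = v0) //; apply: funext; case.
  pose tl (v : 'I_n.+1 -> M) : 'I_n -> M := fun k => v (lift ord0 k).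
  pose cons a (v : 'I_n -> M) : 'I_n.+1 -> M :=
    fun k => if unlift ord0 k is Some j then v j else a.
  have consE (v : 'I_n.+1 -> M) : cons (v ord0) (tl v) = v.
    by apply: funext => k; rewrite /cons /tl; case: unliftP => [j|] ->.
  apply: (@Df_ext _ (fun e => exists a v, P e (cons a v))).
    move=> e; split=> [[a [v Pv]]|[v Pv]]; first by exists (cons a v).
    by exists (v ord0), (tl v); rewrite consE.
  apply: (@Df_ex _ _ _ (fun e a => exists v, P e (cons a v))).
  apply: (IHn _ (fun e v => P (fun i => e (Some i)) (cons (e None) v))).
  pose r (x : I + 'I_n.+1) : option I + 'I_n :=
    match x with
    | inl i => inl (Some i)
    | inr k => if unlift ord0 k is Some j then inr j else inl None
    end.
  apply: Df_ext (Df_ren r DP) => e.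
  rewrite (_ : (fun j => e (r (inr j))) =
    cons (e (inl None)) (fun j => e (inr j))) //.
  by apply: funext => k; rewrite /r /cons; case: unliftP.
move=> DP.
apply: (@Df_ext _ (fun e => exists v : 'I_#|J| -> M, P e (v \o enum_rank))).
  move=> e; split=> [[v Pv]|[v Pv]]; first by exists (v \o enum_rank).
  exists (v \o enum_val); rewrite (_ : _ \o _ = v) //.
  by apply: funext => j /=; rewrite enum_rankK.
apply: ord.
pose r (x : I + J) : I + 'I_#|J| :=
  match x with inl i => inl i | inr j => inr (enum_rank j) end.
exact: Df_ext (Df_ren r DP).
Qed.

Lemma Df_ex2 I (P Q : (I -> M) -> M -> Prop) :
  D (option I) (fun e => P (fun i => e (Some i)) (e None)) ->
  D (option I) (fun e => Q (fun i => e (Some i)) (e None)) ->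
  D I (fun e => exists2 a, P e a & Q e a).
Proof.
move=> DP DQ; apply: (@Df_ext _ (fun e => exists a, P e a /\ Q e a)).
  by move=> e; split=> [[a []]|[a]]; exists a.
by apply: (@Df_ex _ _ _ (fun e a => P e a /\ Q e a)); apply: Df_and.
Qed.

Lemma Df_allv I (J : finType) (P : (I -> M) -> (J -> M) -> Prop) :
  D (I + J)%type (fun e => P (fun i => e (inl i)) (fun j => e (inr j))) ->
  D I (fun e => forall v : J -> M, P e v).
Proof.
move=> DP; apply: (@Df_ext _ (fun e => ~ exists v, ~ P e v)).
  move=> e; split=> [h a|h [a]]; last exact.
  by apply: contrapT => nP; apply: h; exists a.
by apply: Df_not; apply: (@Df_exv _ _ (fun e a => ~ P e a)); apply: Df_not.
Qed.

Lemma Df_allfin I (J : finType) (P : J -> (I -> M) -> Prop) :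
  (forall j, D I (P j)) -> D I (fun e => forall j, P j e).
Proof.
move=> DP; apply: (@Df_ext _ (fun e => forall j, j \in enum J -> P j e)).
  by move=> e; split=> h j *; apply: h; rewrite mem_enum.
elim: (enum J) => [|j s IHs].
  by apply: Df_ext (Df_true _).
apply: Df_ext (Df_and (DP j) IHs) => e; split.
  by case=> ? h k; rewrite inE => /orP[/eqP->//|/h].
by move=> h; split=> [|k ks]; apply: h; rewrite inE ?eqxx ?ks ?orbT.
Qed.

Lemma Df_exfin I (J : finType) (P : J -> (I -> M) -> Prop) :
  (forall j, D I (P j)) -> D I (fun e => exists j, P j e).
Proof.
move=> DP; apply: (@Df_ext _ (fun e => ~ forall j, ~ P j e)).
  by move=> e; split=> [/existsNP[j /contrapT]|[j ? /(_ j)]//]; exists j.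
by apply: Df_not; apply: Df_allfin => j; apply: Df_not.
Qed.

(** A function of the environment counts as a definable term when its graph is definable; the
    additional variable [None] carries the value. *)
Definition Dt I (t : (I -> M) -> M) :=
  D (option I) (fun e => t (fun i => e (Some i)) = e None).

Definition Dtv I J (x : (I -> M) -> J -> M) := forall j, Dt (fun e => x e j).

Lemma Dt_var I (i : I) : Dt (fun e => e i).
Proof. exact: Df_eqv. Qed.

Lemma Dt_const I (c : M) : Dt (fun _ : I -> M => c).
Proof.
pose s (b : bool) : option I + M := if b then inr c else inl None.
exact: (Df_sub s (Df_eqv D true false)).
Qed.

Lemma Df_app I (J : finType) (P : (J -> M) -> Prop) (x : (I -> M) -> J -> M) :
  D J P -> Dtv x -> D I (fun e => P (x e)).
Proof.
move=> DP Dx.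
apply: (@Df_ext _ (fun e => exists v, (forall j, x e j = v j) /\ P v)).
  move=> e; split=> [[v [xv]]|Px]; last by exists (x e).
  by rewrite (_ : x e = v) //; apply: funext.
apply: (@Df_exv _ _ (fun e v => (forall j, x e j = v j) /\ P v)).
apply: Df_and; last exact: (Df_ren inr DP).
apply: Df_allfin => j.
pose r (k : option I) : (I + J)%type := if k is Some i then inl i else inr j.
exact: (Df_ren r (Dx j)).
Qed.

Lemma Df_app1 I (P : M -> Prop) (t : (I -> M) -> M) :
  D unit (fun e => P (e tt)) -> Dt t -> D I (fun e => P (t e)).
Proof. by move=> DP Dtt; apply: (Df_app (x := fun e _ => t e) DP). Qed.

Lemma Df_app2 I (P : M -> M -> Prop) (t u : (I -> M) -> M) :
  D bool (fun e => P (e true) (e false)) -> Dt t -> Dt u ->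
  D I (fun e => P (t e) (u e)).
Proof.
move=> DP Dtt Du.
by apply: (Df_app (x := fun e b => if b then t e else u e) DP); case.
Qed.

Lemma Df_eq I (t u : (I -> M) -> M) : Dt t -> Dt u -> D I (fun e => t e = u e).
Proof. by apply: (@Df_app2 _ (fun a b => a = b)); apply: Df_eqv. Qed.

(** The following predicates express definability in a form that can be applied
    to any terms, so that definability of compound formulas is syntax directed. *)
Definition Df1 J (P : (J -> M) -> Prop) :=
  forall I (x : (I -> M) -> J -> M), Dtv x -> D I (fun e => P (x e)).
Definition Df2 J (P : (J -> M) -> M -> Prop) :=
  forall I (x : (I -> M) -> J -> M) t, Dtv x -> Dt t -> D I (fun e => P (x e) (t e)).
Definition Dfun J (f : (J -> M) -> M) :=
  forall I (x : (I -> M) -> J -> M), Dtv x -> Dt (fun e => f (x e)).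

Lemma Df1P (J : finType) (P : (J -> M) -> Prop) : Df1 P <-> D J P.
Proof.
split=> [h|DP I x]; last exact: Df_app.
by apply: (h _ id) => j; apply: Dt_var.
Qed.

Lemma Df2P (J : finType) (P : (J -> M) -> M -> Prop) :
  D (option J) (fun e => P (fun j => e (Some j)) (e None)) <-> Df2 P.
Proof.
split=> [DP I x t Dx Dtt|h].
  apply: (Df_app (x := fun e k => if k is Some j then x e j else t e) DP).
  by case.
by apply: h; [move=> j|]; apply: Dt_var.
Qed.

Lemma DfunP (J : finType) (f : (J -> M) -> M) :
  Dfun f <-> Df2 (fun x a => f x = a).
Proof.
split=> [h I x t Dx Dtt|h I x Dx].
  by apply: Df_eq => //; apply: h.
apply: h; last exact: Dt_var.
move=> j; pose r (k : option I) : option (option I) :=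
  if k is Some i then Some (Some i) else None.
exact: (Df_ren r (Dx j)).
Qed.

End DefinableSets.

(** * O-minimality in one variable *)

Record ominsys d (M : orderType d) := OminSys {
  osys :> defsys M;
  os_lt : osys bool (fun e => (e true < e false)%O);
  os_pt : M;
  os_dense : forall x y : M, (x < y)%O -> exists z, (x < z)%O /\ (z < y)%O;
  os_noend : forall x : M, exists y z, (y < x)%O /\ (x < z)%O;
  os_itv : forall X : M -> Prop, osys unit (fun e => X (e tt)) ->
    exists s : seq (interval M), forall x, X x <-> has (fun J => x \in J) s }.

Definition fin_pred (T : eqType) (X : T -> Prop) := exists s : seq T, forall x, X x -> x \in s.

(** The one-dimensional content of o-minimality, stated for an arbitrary relation
    so that it can be used both for the order of [M] and for its converse. *)
Record olin (M : eqType) (D : defsys M) (lt : M -> M -> Prop) := OLin {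
  ol_irr : forall x, ~ lt x x;
  ol_trans : forall x y z, lt x y -> lt y z -> lt x z;
  ol_total : forall x y, [\/ lt x y, x = y | lt y x];
  ol_dense : forall x y, lt x y -> exists z, lt x z /\ lt z y;
  ol_up : forall x, exists y, lt x y;
  ol_down : forall x, exists y, lt y x;
  ol_def : D bool (fun e => lt (e true) (e false));
  ol_germR : forall (X : M -> Prop) p, D unit (fun e => X (e tt)) ->
    exists2 q, lt p q & (forall t, lt p t -> lt t q -> X t) \/
                        (forall t, lt p t -> lt t q -> ~ X t);
  ol_germL : forall (X : M -> Prop) p, D unit (fun e => X (e tt)) ->
    exists2 q, lt q p & (forall t, lt q t -> lt t p -> X t) \/
                        (forall t, lt q t -> lt t p -> ~ X t);
  ol_inf : forall (X : M -> Prop), D unit (fun e => X (e tt)) -> ~ fin_pred X ->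
    exists p q, lt p q /\ forall t, lt p t -> lt t q -> X t;
  ol_sup : forall (X : M -> Prop), D unit (fun e => X (e tt)) ->
    (exists x, X x) -> (exists u, forall x, X x -> ~ lt u x) ->
    exists s, (forall x, X x -> ~ lt s x) /\
              (forall u, lt u s -> exists x, X x /\ lt u x);
  ol_finf : forall (X : M -> Prop), D unit (fun e => X (e tt)) ->
    (exists x, X x) -> (exists u, forall x, X x -> ~ lt x u) ->
    exists s, (forall x, X x -> ~ lt x s) /\
              (forall u, lt s u -> exists x, X x /\ lt x u) }.

Lemma Df_rel M (D : defsys M) (lt : M -> M -> Prop) :
  D bool (fun e => lt (e true) (e false)) ->
  forall I (t u : (I -> M) -> M), Dt D t -> Dt D u -> D I (fun e => lt (t e) (u e)).
Proof. by move=> Dlt I t u; apply: (Df_app2 (P := lt)). Qed.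

(** A hook of [dfs], redefined once the order and boxes are available. *)
Ltac dfs_ext := fail.

(** Definability is proved by recursion on the displayed formula: one closure rule per connective,
    then hypotheses of the context for the atoms. *)
Ltac dfs :=
  intros; cbv beta; unfold Dtv; intros; cbv beta;
  lazymatch goal with
  | |- Df _ (fun _ => _ /\ _) => apply: Df_and; dfs
  | |- Df _ (fun _ => _ \/ _) => apply: Df_or; dfs
  | |- Df _ (fun _ => _ <-> _) => apply: Df_iff; dfs
  | |- Df _ (fun _ => _ = _) => apply: Df_eq; dfs
  | |- Df _ (fun _ => exists _, _) =>
      first [apply: Df_ex | apply: Df_exv | apply: Df_exfin]; dfs
  | |- Df _ (fun _ => exists2 _, _ & _) => apply: Df_ex2; dfs
  | |- Df _ (fun _ => ~ _) => apply: Df_not; dfs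
  | |- Df _ (fun _ => forall _, _) =>
      first [apply: Df_imp | apply: Df_all | apply: Df_allv | apply: Df_allfin]; dfs
  | |- Dt _ (fun e => e _) => apply: Dt_var
  | |- Dt _ (fun _ => _) => first [apply: Dt_const | dfs_ext; dfs | dfs_hyp; dfs]
  | |- Dt _ ?t => is_var t; first [assumption | dfs_hyp; dfs]
  | |- Df _ _ => first [apply: Df_const | dfs_ext; dfs | dfs_hyp; dfs]
  | |- _ => idtac
  end
with dfs_hyp :=
  match goal with
  | H : _ |- _ => apply: (H)
  end.

(** The fields of [olin] come in left and right versions which the reversal of the order exchanges.
    Every result derived from [olin] thereby comes with its mirror image. *)
Lemma olin_conv (M : eqType) (D : defsys M) (lt : M -> M -> Prop) :
  olin D lt -> olin D (fun x y => lt y x).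
Proof.
case=> irr tr tot de up down df gR gL inf sp fi; split=> //.
- by move=> x y z xy yz; apply: tr yz xy.
- by move=> x y; case: (tot x y) => ?; [constructor 3|constructor 2|constructor 1].
- by move=> x y /de[z [? ?]]; exists z.
- exact: (Df_ren (fun b => ~~ b) df).
- move=> X p /gL - /(_ p)[q qp h]; exists q => //.
  by case: h => h; [left|right] => t *; apply: h.
- move=> X p /gR - /(_ p)[q qp h]; exists q => //.
  by case: h => h; [left|right] => t *; apply: h.
- by move=> X DX /(inf X DX)[p [q [pq h]]]; exists q, p; split=> // t *; apply: h.
Qed.

Section OrderOlin.
Context {d : Order.disp_t} {M : orderType d} (D : ominsys M).
Local Notation "x <' y" := (x < y)%O (at level 70).

(** [b] selects the side of [p] on which membership in [X] is eventually decided. *)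
Let germ (X : M -> Prop) p (b : bool) :=
  exists2 q, (if b then p <' q else q <' p) &
    (forall t, (if b then p <' t /\ t <' q else q <' t /\ t <' p) -> X t) \/
    (forall t, (if b then p <' t /\ t <' q else q <' t /\ t <' p) -> ~ X t).

Let germ_or X Y p b : germ X p b -> germ Y p b -> germ (fun t => X t \/ Y t) p b.
Proof.
have comb (V : M -> Prop) : ((forall t, V t -> X t) \/ (forall t, V t -> ~ X t)) ->
    ((forall t, V t -> Y t) \/ (forall t, V t -> ~ Y t)) ->
    (forall t, V t -> X t \/ Y t) \/ (forall t, V t -> ~ (X t \/ Y t)).
  move=> [hX _|hX]; first by left=> t /hX; left.
  move=> [hY|hY]; first by left=> t /hY; right.
  by right=> t Vt [xt|yt]; [exact: (hX t)|exact: (hY t)].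
case: b => -[q pq hX] [q' pq' hY].
  exists (Order.min q q'); first by rewrite lt_min pq pq'.
  apply: comb.
    by case: hX => h; [left|right] => t []; rewrite lt_min => ? /andP[? ?]; apply: h.
  by case: hY => h; [left|right] => t []; rewrite lt_min => ? /andP[? ?]; apply: h.
exists (Order.max q q'); first by rewrite gt_max pq pq'.
apply: comb.
  by case: hX => h; [left|right] => t []; rewrite gt_max => /andP[? ?] ?; apply: h.
by case: hY => h; [left|right] => t []; rewrite gt_max => /andP[? ?] ?; apply: h.
Qed.

Let germ_not X p b : germ X p b -> germ (fun t => ~ X t) p b.
Proof.
by case=> q pq [h|h]; exists q => //; [right|left] => t /h ?.
Qed.

Let germ_ext X Y p b : (forall t, X t <-> Y t) -> germ X p b -> germ Y p b.
Proof.
by move=> XY [q pq [h|h]]; exists q => //; [left|right] => t /h /XY.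
Qed.

Let germ_const (P : Prop) p b : germ (fun _ => P) p b.
Proof.
have [y [z [yp pz]]] := os_noend D p.
exists (if b then z else y); first by case: b.
by have [?|?] := pselect P; [left|right].
Qed.

Let germ_lt a p b : germ (fun t => t <' a) p b /\ germ (fun t => a <' t) p b.
Proof.
have [y [z [yp pz]]] := os_noend D p.
case: b; split.
- case: (ltP p a) => pa.
    by exists a => //; left=> t [].
  by exists z => //; right=> t [pt _] ta; move: (lt_trans pt ta); rewrite ltNge pa.
- case: (ltP p a) => pa.
    by exists a => //; right=> t [_ ta] /(lt_trans ta); rewrite ltxx.
  by exists z => //; left=> t [pt _]; apply: le_lt_trans pt.
- case: (ltP a p) => pa.
    by exists a => //; right=> t [ta _] /(lt_trans ta); rewrite ltxx.
  by exists y => //; left=> t [_ tp]; apply: lt_le_trans pa.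
- case: (ltP a p) => pa.
    by exists a => //; left=> t [].
  by exists y => //; right=> t [_ tp] ta; move: (lt_trans ta tp); rewrite ltNge pa.
Qed.

(** The set is a finite union of intervals, an interval is an intersection of two half-lines, and
    being decided on one side of [p] passes to Boolean combinations. *)
Let germ_itv (X : M -> Prop) p b : D unit (fun e => X (e tt)) -> germ X p b.
Proof.
move=> /os_itv[s sX]; apply: (germ_ext (fun t => iff_sym (sX t))) => {sX}.
elim: s => [|J s IHs] /=; first exact: (germ_ext _ (germ_const False p b)).
apply: (@germ_ext (fun t => t \in J \/ has (fun J => t \in J) s)).
  by move=> t; split=> /orP.
apply: germ_or => //; case: J => l r.
(* The intersection is put in De Morgan form, since only unions and complements have been
   treated. *)
apply: (@germ_ext (fun t =>
   ~ (~ (l <= BLeft t)%O \/ ~ (BRight t <= r)%O))).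
  move=> t; rewrite itv_boundlr; split=> [|/andP[-> ->] []//].
  by case: (l <= _)%O => h; case: (_ <= r)%O h => // h; case: h; [right|left|left].
apply: germ_not; apply: germ_or; apply: germ_not.
  case: l => [[] a|[]].
  - apply: (@germ_ext (fun t => ~ t <' a)); last exact: germ_not (germ_lt a p b).1.
    by move=> t; rewrite bnd_simp leNgt; split=> /negP.
  - apply: (@germ_ext (fun t => a <' t)); last exact: (germ_lt a p b).2.
    by move=> t; rewrite bnd_simp.
  - exact: (germ_ext _ (germ_const True p b)).
  - exact: (germ_ext _ (germ_const False p b)).
case: r => [[] a|[]].
- apply: (@germ_ext (fun t => t <' a)); last exact: (germ_lt a p b).1.
  by move=> t; rewrite bnd_simp.
- apply: (@germ_ext (fun t => ~ a <' t)); last exact: germ_not (germ_lt a p b).2.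
  by move=> t; rewrite bnd_simp leNgt; split=> /negP.
- exact: (germ_ext _ (germ_const False p b)).
- exact: (germ_ext _ (germ_const True p b)).
Qed.

Let mem_convex (J : interval M) x y t : x \in J -> y \in J -> x <' t -> t <' y -> t \in J.
Proof.
case: J => l r; rewrite !itv_boundlr => /andP[lx _] /andP[_ yr] xt ty.
apply/andP; split.
  by apply: le_trans lx _; rewrite bnd_simp ltW.
by apply: le_trans yr; rewrite bnd_simp ltW.
Qed.

(** If no open interval lies in the set, then by convexity each interval of its decomposition has at
    most one point, so the set is finite. *)
Let itv_inf (X : M -> Prop) : D unit (fun e => X (e tt)) -> ~ fin_pred X ->
  exists p q, p <' q /\ forall t, p <' t -> t <' q -> X t.
Proof.
move=> /os_itv[s sX] nf; apply: contrapT => noint; apply: nf.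
have {noint} : forall J x y, J \in s -> x \in J -> y \in J -> x = y.
  move=> J; suff h x y : J \in s -> x \in J -> y \in J -> ~ x <' y.
    move=> x y Js xJ yJ; have := h x y Js xJ yJ; have := h y x Js yJ xJ.
    by case: ltgtP.
  move=> Js xJ yJ xy; apply: noint; exists x, y; split=> // t xt ty.
  by apply/sX/hasP; exists J => //; apply: (mem_convex xJ yJ).
move=> one; have {sX} : forall x, X x -> has (fun J => x \in J) s by move=> x /sX.
elim: s X one => [|J s IHs] X one sX; first by exists [::] => x /sX.
have [||s' hs'] := IHs (fun x => has (fun J => x \in J) s).
- by move=> K x y Ks; apply: one; rewrite inE Ks orbT.
- by [].
have [[x xJ]|nJ] := pselect (exists x, x \in J).
  exists (x :: s') => y /sX /orP[yJ|/hs' ys']; rewrite inE ?ys' ?orbT //.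
  by rewrite (one J y x) ?eqxx // inE eqxx.
by exists s' => y /sX /orP[yJ|/hs' //]; case: nJ; exists y.
Qed.

(** Induction on the list of intervals: the supremum of one nonempty bounded interval is its right
    endpoint, by density, and that of a union is the larger of the two. *)
Let itv_sup (X : M -> Prop) : D unit (fun e => X (e tt)) ->
  (exists x, X x) -> (exists u, forall x, X x -> ~ u <' x) ->
  exists s, (forall x, X x -> ~ s <' x) /\ (forall u, u <' s -> exists x, X x /\ u <' x).
Proof.
move=> /os_itv[s sX] [x0 Xx0] [u uX].
have {Xx0 x0} : exists x, has (fun J => x \in J) s by exists x0; apply/sX.
have {uX} : forall x, has (fun J => x \in J) s -> ~ u <' x by move=> x /sX /uX.
suff : forall s : seq (interval M), (forall x, has (fun J => x \in J) s -> ~ u <' x) ->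
    (exists x, has (fun J => x \in J) s) ->
    exists m, (forall x, has (fun J => x \in J) s -> ~ m <' x) /\
      (forall u, u <' m -> exists x, has (fun J => x \in J) s /\ u <' x).
  move=> h us sx; have [m [mU mL]] := h s us sx.
  exists m; split=> [x /sX|v /mL[x [/sX ? ?]]]; [exact: mU|by exists x].
elim=> [|J {X sX}s IHs] us [x0 x0J]; first by [].
have one : (exists x, x \in J) ->
    exists m, (forall x, x \in J -> ~ m <' x) /\
      (forall u, u <' m -> exists x, x \in J /\ u <' x).
  move=> [x xJ] {IHs x0J x0}; case: J us xJ => l [b a|[]] us xJ.
  - exists a; split.
      move=> y; rewrite itv_boundlr => /andP[_]; case: b {us xJ}; rewrite bnd_simp.
        by move=> ya ay; move: (lt_trans ya ay); rewrite ltxx.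
      by rewrite leNgt => /negP.
    move=> v va; case: (ltP v x) => [vx|xv]; first by exists x.
    have [z [vz za]] := os_dense D va; exists z; split=> //.
    move: xJ; rewrite !itv_boundlr => /andP[lx _]; apply/andP; split.
      by apply: le_trans lx _; rewrite bnd_simp ltW // (le_lt_trans xv).
    by case: b {us}; rewrite bnd_simp // ltW.
  - by move: xJ; rewrite itv_boundlr andbF.
  (* A nonempty interval without right endpoint passes every bound, since M has no last element. *)
  - have [_ [z [_ uz]]] := os_noend D (Order.max u x).
    move: uz; rewrite gt_max => /andP[uz xz]; case: (us z) => //.
    apply/orP; left; move: xJ; rewrite !itv_boundlr => /andP[lx _]; apply/andP; split=> //.
    by apply: le_trans lx _; rewrite bnd_simp ltW.
have [sx|ns] := pselect (exists x, has (fun J => x \in J) s); last first.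
  have [|m [mU mL]] := one.
    by case/orP: x0J => [?|sx]; [exists x0|case: ns; exists x0].
  exists m; split.
    by move=> x /orP[/mU//|sx]; case: ns; exists x.
  by move=> v /mL[x [xJ vx]]; exists x; rewrite /= xJ.
have [|m [mU mL]] := IHs _ sx.
  by move=> x xs; apply: us; rewrite /= xs orbT.
have [Jx|nJ] := pselect (exists x, x \in J); last first.
  exists m; split.
    by move=> x /orP[xJ|/mU//]; case: nJ; exists x.
  by move=> v /mL[x [xJ vx]]; exists x; rewrite /= xJ orbT.
have [m' [mU' mL']] := one Jx.
exists (Order.max m m'); split.
  move=> x xJ; rewrite gt_max => /andP[mx m'x].
  by case/orP: xJ => [/mU'|/mU].
move=> v; rewrite lt_max => /orP[/mL|/mL'] [x [xJ vx]]; exists x; rewrite /= xJ ?orbT //.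
Qed.

Lemma olin_lt : olin D (fun x y => x <' y).
Proof.
split.
- by move=> x; rewrite ltxx.
- by move=> x y z; apply: lt_trans.
- by move=> x y; case: (ltgtP x y) => [?|?|->]; [constructor 1|constructor 3|constructor 2].
- exact: os_dense.
- by move=> x; have [y [z [? ?]]] := os_noend D x; exists z.
- by move=> x; have [y [z [? ?]]] := os_noend D x; exists y.
- exact: os_lt.
- move=> X p DX; have [q pq h] := germ_itv p true DX; exists q => //.
  by case: h => h; [left|right] => t *; apply: h.
- move=> X p DX; have [q pq h] := germ_itv p false DX; exists q => //.
  by case: h => h; [left|right] => t *; apply: h.
- exact: itv_inf.
- exact: itv_sup.
- move=> X DX [x Xx] [u uX].
  (* The infimum is the supremum of the set of lower bounds. *)
  have [|||s [sU sL]] := @itv_sup (fun u => forall x, X x -> ~ x <' u).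
  + have Dlt := @Df_rel M D (fun x y => x <' y) (os_lt D).
    have DX1 := fun I t => @Df_app1 M D I X t DX.
    by dfs.
  + by exists u.
  + by exists x => y; apply.
  + exists s; split.
      move=> y Xy /sL[v [vX yv]]; exact: vX yv.
    move=> v sv; apply: contrapT => nx; apply: (sU v) => // y Xy yv.
    by apply: nx; exists y.
Qed.
End OrderOlin.

(** * The monotonicity theorem *)

Section Germs.
Variables (M : eqType) (D : defsys M) (lt : M -> M -> Prop) (o : olin D lt).

(** With [r] the order this speaks of the points just to the right of [t], with the converse order
    of those just to the left. *)
Definition rgerm (r : M -> M -> Prop) (t : M) (P : M -> Prop) :=
  exists2 q, r t q & forall s, r t s -> r s q -> P s.

Lemma pick2L x y t : lt x t -> lt y t -> exists z, [/\ lt x z, lt y z & lt z t].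
Proof.
move=> xt yt; case: (ol_total o x y) => [xy|<-|yx].
- by have [z [yz zt]] := ol_dense o yt; exists z; split=> //; exact: (ol_trans o xy yz).
- by have [z [xz zt]] := ol_dense o xt; exists z; split.
- by have [z [xz zt]] := ol_dense o xt; exists z; split=> //; exact: (ol_trans o yx xz).
Qed.

Lemma pick2R x y t : lt t x -> lt t y -> exists z, [/\ lt z x, lt z y & lt t z].
Proof.
move=> tx ty; case: (ol_total o x y) => [xy|<-|yx].
- by have [z [tz zx]] := ol_dense o tx; exists z; split=> //; exact: (ol_trans o zx xy).
- by have [z [tz zx]] := ol_dense o tx; exists z; split.
- by have [z [tz zy]] := ol_dense o ty; exists z; split=> //; exact: (ol_trans o zy yx).
Qed.

Lemma rgerm_imp t (P Q : M -> Prop) : (forall s, P s -> Q s) -> rgerm lt t P -> rgerm lt t Q.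
Proof. by move=> PQ [q tq h]; exists q => // s ts sq; apply/PQ/h. Qed.

Lemma rgerm_and t P Q : rgerm lt t P -> rgerm lt t Q -> rgerm lt t (fun s => P s /\ Q s).
Proof.
move=> [q tq hP] [q' tq' hQ]; have [z [zq zq' tz]] := pick2R tq tq'.
exists z => // s ts sz; by split; [apply: hP|apply: hQ] => //; apply: (ol_trans o) sz _.
Qed.

Lemma rgerm_lt t x : lt t x -> rgerm lt t (fun s => lt t s /\ lt s x).
Proof. by move=> tx; exists x. Qed.

Lemma rgerm_ex t P : rgerm lt t P -> exists s, P s.
Proof. by case=> q tq h; have [z [tz zq]] := ol_dense o tq; exists z; apply: h. Qed.

Lemma rgerm_dec t (P : M -> Prop) : D unit (fun e => P (e tt)) ->
  rgerm lt t P \/ rgerm lt t (fun s => ~ P s).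
Proof. by move=> /(ol_germR o)-/(_ t)[q tq [h|h]]; [left|right]; exists q. Qed.

End Germs.

Section StrictMinima.
Variables (M : eqType) (D : defsys M) (lt lt2 : M -> M -> Prop).
Variables (o : olin D lt) (o2 : olin D lt2).
Variables (f : M -> M).
Hypothesis Df_f : forall I (t : (I -> M) -> M), Dt D t -> Dt D (fun e => f (t e)).
Local Notation gt := (fun x y => lt y x).
Let oc := olin_conv o.

Let rtr := ol_trans o.
Let Dlt := Df_rel (lt := lt) (ol_def o).
Let Dlt2 := Df_rel (lt := lt2) (ol_def o2).

Lemma rgerm_cmp r t m : olin D r ->
  [\/ rgerm r t (fun s => lt2 (f s) m), rgerm r t (fun s => f s = m)
    | rgerm r t (fun s => lt2 m (f s))].
Proof.
move=> oR.
have [|h|h] := @rgerm_dec _ _ _ oR t (fun s => lt2 (f s) m); first by dfs.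
  by constructor 1.
have [|h'|h'] := @rgerm_dec _ _ _ oR t (fun s => f s = m); first by dfs.
  by constructor 2.
constructor 3; apply: rgerm_imp (rgerm_and oR h h') => s [? ?].
by case: (ol_total o2 (f s) m).
Qed.

(** If every point of an interval is a strict local minimum, then at every point
    [t] close to the right end some value [m] is crossed downwards. The mirror
    image of this is incompatible with it. *)
Lemma strict_minima_crossing a b : lt a b ->
  (forall t, lt a t -> lt t b ->
    rgerm lt t (fun s => lt2 (f t) (f s)) /\ rgerm gt t (fun s => lt2 (f t) (f s))) ->
  exists2 q, lt a q /\ lt q b & forall t, lt q t -> lt t b ->
    exists m, rgerm gt t (fun s => lt2 m (f s)) /\ rgerm lt t (fun s => lt2 (f s) m).
Proof.
move=> ab H.
have noconst c q m : lt a c -> lt c q -> lt q b \/ q = b ->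
    (forall t, lt c t -> lt t q -> f t = m) -> False.
  move=> ac cq qb cst; have [t [ct tq]] := ol_dense o cq.
  have tb : lt t b by case: qb => [qb|<-] //; apply: rtr tq qb.
  have [Ht _] := H t (rtr ac ct) tb.
  have [s [[ts sq] fts]] := rgerm_ex o (rgerm_and o (rgerm_lt tq) Ht).
  by move: fts; rewrite (cst s) ?(cst t) //; [exact: (ol_irr o2)|exact: rtr ts].
(* Close to [b] no value stays strictly below all later ones. If this happened at all points near
   [b], the strict minimum at such an [x] would give a [y] to its left with a larger value, against
   the property of [y]. *)
have [a0 [aa0 a0b] nB] : exists2 a0, lt a a0 /\ lt a0 b & forall x, lt a0 x -> lt x b ->
    exists y, [/\ lt x y, lt y b & ~ lt2 (f x) (f y)].
  have [||] := @rgerm_dec _ _ _ oc b (fun x => forall y, lt x y -> lt y b -> lt2 (f x) (f y)).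
  - by dfs.
  - case=> q qb hB; have [x [ax qx xb]] := pick2L o ab qb.
    have [y [[yx qy] fxy]] := rgerm_ex oc (rgerm_and oc (rgerm_lt (lt := gt) qx) (H x ax xb).2).
    have fyx := hB y (rtr yx xb) qy x yx xb.
    by case: (ol_irr o2 (ol_trans o2 fxy fyx)).
  - case=> q qb hB; have [x [ax qx xb]] := pick2L o ab qb.
    exists x => // z xz zb; have := hB z zb (rtr qx xz).
    by move=> /existsNP[y] /not_implyP[zy] /not_implyP[yb nf]; exists y.
have inI x : lt a0 x -> lt a x by apply: rtr.
(* Values near [b] drop below [f x]. They are not eventually constant. Were they above [f x], let
   [e] be the supremum of the points with value at most [f x]: if [f e] is above [f x], the minimum
   at [e] keeps the points just left of [e] above it too; otherwise [nB] gives a point beyond [e]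
   with value at most [f x]. *)
have near_end x : lt a0 x -> lt x b -> rgerm gt b (fun y => lt2 (f y) (f x)).
  move=> a0x xb; case: (rgerm_cmp b (f x) oc) => //.
    case=> q qb cst; exfalso; have [c [a0c qc cb]] := pick2L o a0b qb.
    apply: (@noconst c b (f x)) => //; [exact: inI|by right|].
    by move=> t ct tb; apply: cst => //; apply: rtr ct.
  case=> q qb hq; exfalso.
  have [|||e [eU eL]] := @ol_sup _ _ _ o
      (fun y => (x = y \/ lt x y) /\ lt y b /\ ~ lt2 (f x) (f y)).
  - by dfs.
  - by exists x; split; [left|split=> //; apply: (ol_irr o2)].
  - exists q => y [xy [yb nf]] qy; apply: nf; exact: hq.
  have xe : x = e \/ lt x e.
    case: (ol_total o x e) => [?|?|ex]; [by right|by left|].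
    by case: (eU x) => //; split; [left|split=> //; apply: (ol_irr o2)].
  have eb : lt e b.
    case: (ol_total o q e) => [qe|<- //|eq]; last exact: rtr qb.
    by have [y [[_ [yb nf]] qy]] := eL q qe; case: nf; apply: hq.
  have a0e : lt a0 e by case: xe => [<-//|]; apply: rtr.
  have [fxe|nfxe] := pselect (lt2 (f x) (f e)).
    have [c ce hc] := (H e (inI e a0e) eb).2.
    have [y [Xy cy]] := eL c ce; have ney := eU y Xy.
    case: Xy => _ [yb nf]; apply: nf.
    case: (ol_total o e y) => [//|<-//|ye].
    apply: ol_trans fxe _; first exact: o2.
    exact: hc.
  have [z [ez zb nfez]] := nB e a0e eb.
  apply: (eU z) => //; split.
    by right; case: xe => [->//|]; move/rtr; apply.
  split=> // fxz; case: (ol_total o2 (f x) (f e)) => [//|xe'|ex'].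
    by apply: nfez; rewrite -xe'.
  by apply: nfez; apply: (ol_trans o2) fxz.
pose Psi t := exists m, rgerm gt t (fun s => lt2 m (f s)) /\ rgerm lt t (fun s => lt2 (f s) m).
have Psi_beyond x : lt a0 x -> lt x b -> exists s, [/\ lt x s, lt s b & Psi s].
  (* The crossing occurs at the infimum [s] of the points from which on all values are below [f x],
     and the value crossed there is [f x]. *)
  move=> a0x xb; have [q qb hq] := near_end x a0x xb.
  have [y0 [xy0 qy0 y0b]] := pick2L o xb qb.
  pose Y y := lt x y /\ lt y b /\ forall z, lt y z -> lt z b -> lt2 (f z) (f x).
  have Y0 : Y y0 by split=> //; split=> // z y0z zb; apply: hq => //; apply: rtr y0z.
  have [|||s [sU sL]] := @ol_finf _ _ _ o Y.
  - by rewrite /Y; dfs.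
  - by exists y0.
  - by exists x => y [xy _] yx; apply: (ol_irr o (rtr xy yx)).
  have sr z : lt s z -> lt z b -> lt2 (f z) (f x).
    by move=> sz zb; have [y [[_ [_ hy]] yz]] := sL z sz; apply: hy.
  have sb : lt s b.
    by case: (ol_total o s y0) => [sy|->//|ys]; [apply: rtr sy y0b|case: (sU y0)].
  have xs : lt x s.
    have [q' xq' hq'] := (H x (inI x a0x) xb).1.
    suff nsx z : lt x z -> lt z b -> lt z q' -> lt s z -> False.
      case: (ol_total o x s) => [//|xs|sx].
        have [z [zb zq' xz]] := pick2R o xb xq'.
        by case: (nsx z); rewrite -?xs.
      have [z [zb zq' xz]] := pick2R o xb xq'.
      by case: (nsx z) => //; apply: rtr xz.
    move=> xz zb zq' sz; apply: (ol_irr o2 (x := f x)).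
    by apply: (ol_trans o2) (hq' z xz zq') (sr z sz zb).
  exists s; split=> //; exists (f x); split; last by exists b.
  have a0s := rtr a0x xs.
  case: (rgerm_cmp s (f x) oc) => // -[c cs hc]; exfalso; last first.
    have [c' [a0c' cc' c's]] := pick2L o a0s cs.
    apply: (@noconst c' s (f x)) => //; [exact: inI|by left|].
    by move=> t c't ts; apply: hc => //; apply: rtr c't.
  (* If the values just left of [s] were below [f x], then [f s] could not be below [f x], as [s] is
     an infimum, and yet it would be smaller than the values just to its left. *)
  have [c' [xc' cc' c's]] := pick2L o xs cs.
  have fxs : ~ lt2 (f s) (f x).
    move=> fsx; apply: (sU c') => //; split=> //; split; first exact: rtr c's sb.
    move=> z c'z zb; case: (ol_total o z s) => [zs|->//|/sr]; last exact.
    by apply: hc => //; apply: rtr c'z.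
  have [z [[zs c'z] fz]] := rgerm_ex oc (rgerm_and oc (rgerm_lt (lt := gt) c's) (H s (inI s a0s) sb).2).
  by apply: fxs; apply: (ol_trans o2) fz _; apply: hc => //; apply: rtr c'z.
have [|[q qb hq]|[q qb hq]] := @rgerm_dec _ _ _ oc b Psi.
- by rewrite /Psi /rgerm; dfs.
- have [c [a0c qc cb]] := pick2L o a0b qb.
  exists c; first by split=> //; apply: inI.
  by move=> t ct tb; apply: hq => //; apply: rtr ct.
- have [c [a0c qc cb]] := pick2L o a0b qb.
  have [s [cs sb Ps]] := Psi_beyond c a0c cb.
  by case: (hq s) => //; apply: rtr cs.
Qed.

End StrictMinima.

Section LocalMonotonicity.
Variables (M : eqType) (D : defsys M) (lt lt2 : M -> M -> Prop).
Variables (o : olin D lt) (o2 : olin D lt2).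
Variables (f : M -> M).
Hypothesis Df_f : forall I (t : (I -> M) -> M), Dt D t -> Dt D (fun e => f (t e)).
Local Notation gt := (fun x y => lt y x).
Let oc := olin_conv o.
Let rtr := ol_trans o.
Let Dlt := Df_rel (lt := lt) (ol_def o).

(** The crossing lemma, used in both directions, gives one point [t] with values above [m] on its
    left and below [m] on its right and, for some [m'], below [m'] on its left and above [m'] on its
    right. The left side yields [m < m'] and the right side [m' < m]. *)
Lemma no_strict_minima a b : lt a b ->
  (forall t, lt a t -> lt t b ->
    rgerm lt t (fun s => lt2 (f t) (f s)) /\ rgerm gt t (fun s => lt2 (f t) (f s))) ->
  False.
Proof.
move=> ab H; have [q [aq qb] hq] := strict_minima_crossing o o2 Df_f ab H.
have [|q' [q'b qq'] hq'] := strict_minima_crossing oc o2 Df_f (a := b) (b := q) qb.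
  by move=> t tb qt; case: (H t (rtr aq qt) tb).
have [t [qt tq']] := ol_dense o qq'.
have [m [hl hr]] := hq t qt (rtr tq' q'b).
have [m' [hr' hl']] := hq' t tq' qt.
have [s [h1 h2]] := rgerm_ex o (rgerm_and o hr hr').
have [s' [h3 h4]] := rgerm_ex oc (rgerm_and oc hl hl').
by apply: (ol_irr o2 (x := m)); apply: (ol_trans o2) (ol_trans o2 h3 h4) (ol_trans o2 h2 h1).
Qed.

(** [R] will be the order, its converse or equality, so that three kinds of monotonicity are treated
    at once. Let [e] be the infimum of the points whose value is not related to [f s]: the left germ
    at [e] and transitivity relate [f s] to [f e], and the right germ carries the relation past
    [e]. *)
Lemma locally_monotone (R : M -> M -> Prop) a b :
  D bool (fun e => R (e true) (e false)) ->
  (forall x y z, R x y -> R y z -> R x z) ->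
  (forall t, lt a t -> lt t b ->
    rgerm lt t (fun s => R (f t) (f s)) /\ rgerm gt t (fun s => R (f s) (f t))) ->
  forall s t, lt a s -> lt s t -> lt t b -> R (f s) (f t).
Proof.
move=> DR Rtr H s t as_ st tb; apply: contrapT => nR.
have DR' := Df_rel (lt := R) DR.
have [|||e [eL eU]] := @ol_finf _ _ _ o (fun u => lt s u /\ lt u b /\ ~ R (f s) (f u)).
- by dfs.
- by exists t.
- by exists s => u [su _] us; apply: (ol_irr o (rtr su us)).
have et : t = e \/ lt e t.
  by case: (ol_total o e t) => [?|?|te]; [right|left|case: (eL t)].
have eb : lt e b by case: et => [<-//|et]; apply: rtr tb.
case: (ol_total o s e) => [se|se|es].
- have [q eq hq] := (H e (rtr as_ se) eb).1.
  have [u [[ue su] Rue]] := rgerm_ex oc (rgerm_and oc (rgerm_lt (lt := gt) se) (H e (rtr as_ se) eb).2).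
  have Rsu : R (f s) (f u).
    by apply: contrapT => nRu; apply: (eL u) => //; split=> //; split=> //; apply: rtr eb.
  have Rse := Rtr _ _ _ Rsu Rue.
  have [v [[sv [vb nRv]] vq]] := eU q eq; apply: (nRv).
  case: (ol_total o v e) => [ve|->//|ev]; last by apply: Rtr Rse (hq v ev vq).
  by case: (eL v).
- have [q sq hq] := (H s as_ (rtr st tb)).1.
  have [|v [[sv [vb nRv]] vq]] := eU q; first by rewrite -se.
  by apply: nRv; apply: hq.
- have [v [[sv _] vs]] := eU s es.
  by apply: (ol_irr o (rtr sv vs)).
Qed.

(** Separate orders for arguments and values let a decreasing function be handled as an increasing
    one into the converse order. *)
Definition cont_at (r r2 : M -> M -> Prop) t := forall c' d', r2 c' (f t) -> r2 (f t) d' ->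
  exists c d, [/\ r c t, r t d & forall s, r c s -> r s d -> r2 c' (f s) /\ r2 (f s) d'].

Lemma avoid_finite (s : seq M) a b : lt a b ->
  (forall t u, lt a t -> lt t u -> lt u b -> f t <> f u) ->
  exists t, [/\ lt a t, lt t b & f t \notin s].
Proof.
elim: s a b => [|y s IHs] a b ab inj.
  by have [t [? ?]] := ol_dense o ab; exists t.
have [[t [at_ tb ft]]|no] := pselect (exists t, [/\ lt a t, lt t b & f t = y]).
  have [|u [tu ub fu]] := IHs t b tb.
    by move=> u v tu uv; apply: inj => //; apply: rtr tu.
  exists u; split=> //; first exact: rtr tu.
  by rewrite inE negb_or fu andbT; apply/eqP => fy; apply: (inj t u) => //; rewrite ft fy.
have [u [au ub fu]] := IHs a b ab inj.
exists u; split=> //; rewrite inE negb_or fu andbT; apply/eqP => fy.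
by apply: no; exists u.
Qed.

(** The image is infinite by injectivity, so by o-minimality it contains an interval. At a preimage
    of a point inside it, nearby values on both sides are attained, and monotonicity traps [f]
    between them. *)
Lemma increasing_cont a b : lt a b ->
  (forall s t, lt a s -> lt s t -> lt t b -> lt2 (f s) (f t)) ->
  exists t, [/\ lt a t, lt t b & cont_at lt lt2 t].
Proof.
move=> ab inc; have irr2 := ol_irr o2.
have [||p [q [pq hpq]]] := @ol_inf _ _ _ o2 (fun y => exists t, (lt a t /\ lt t b) /\ f t = y).
- by dfs.
- case=> s hs; have [|t [at_ tb]] := @avoid_finite s a b ab.
    by move=> t u at_ tu ub ftu; apply: (irr2 (f t)); rewrite {2}ftu; apply: inc.
  by rewrite hs //; exists t.
have incr s t : lt a s -> lt s b -> lt a t -> lt t b -> lt2 (f s) (f t) -> lt s t.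
  move=> as_ sb at_ tb fst; case: (ol_total o s t) => [//|st|ts].
    by case: (irr2 (f s)); rewrite {2}st.
  by case: (irr2 (f s)); apply: (ol_trans o2) fst _; apply: inc.
have [y [py yq]] := ol_dense o2 pq.
have [t [[at_ tb] fty]] := hpq y py yq; exists t; split=> // c' d'.
rewrite fty => c'y yd'.
have [z [pz c'z zy]] := pick2L o2 py c'y.
have [z' [z'q z'd' yz']] := pick2R o2 yq yd'.
have [u [[au ub] fu]] := hpq z pz (ol_trans o2 zy yq).
have [v [[av vb] fv]] := hpq z' (ol_trans o2 py yz') z'q.
exists u, v; split.
- by apply: incr => //; rewrite fu fty.
- by apply: incr => //; rewrite fv fty.
move=> s us sv; split.
  by apply: (ol_trans o2) c'z _; rewrite -fu; apply: inc => //; apply: rtr vb.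
by apply: (ol_trans o2) _ z'd'; rewrite -fv; apply: inc => //; apply: rtr us.
Qed.

End LocalMonotonicity.

Definition loc_mono (M : eqType) (lt R : M -> M -> Prop) (f : M -> M) t :=
  rgerm lt t (fun s => R (f t) (f s)) /\ rgerm (fun x y => lt y x) t (fun s => R (f s) (f t)).

Section Monotonicity.
Context {d : Order.disp_t} {M : orderType d} (D : ominsys M).
Local Notation lt := (fun x y : M => (x < y)%O).
Local Notation gt := (fun x y : M => (y < x)%O).
Variables (f : M -> M).
Hypothesis Df_f : forall I (t : (I -> M) -> M), Dt D t -> Dt D (fun e => f (t e)).

Lemma os_ltE I (t u : (I -> M) -> M) : Dt D t -> Dt D u -> D I (fun e => t e < u e)%O.
Proof. exact: (@Df_rel M D lt (os_lt D)). Qed.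

(** A local form of the monotonicity theorem. The interval is shortened at its right end until the
    comparison of [f t] with the values on either side of [t] has the same answer at every [t].
    Strict minima throughout and strict maxima throughout are excluded by [no_strict_minima], for
    the order of the values and for its converse. *)
Theorem monotonicity a b : (a < b)%O ->
  exists t, [/\ (a < t)%O, (t < b)%O, cont_at f lt lt t &
    [\/ loc_mono lt lt f t, loc_mono lt gt f t | loc_mono lt eq f t]].
Proof.
move=> ab; have o := olin_lt D; have oc := olin_conv o; have Dlt := os_ltE.
have Deq : D bool (fun e => e true = e false) by dfs.
(* A definable property is decided just to the right of [a], hence on a whole initial part of the
   interval. *)
have dec (P : M -> Prop) b' : D unit (fun e => P (e tt)) -> (a < b')%O ->
    exists q, [/\ (a < q)%O, (q <= b')%O & (forall t, (a < t)%O -> (t < q)%O -> P t) \/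
      (forall t, (a < t)%O -> (t < q)%O -> ~ P t)].
  move=> DP ab'; case: (rgerm_dec o a DP) => -[q aq hq].
    exists (Order.min q b'); split; rewrite ?lt_min ?aq ?ge_min ?lexx ?orbT //.
    by left=> t at_; rewrite lt_min => /andP[tq _]; apply: hq.
  exists (Order.min q b'); split; rewrite ?lt_min ?aq ?ge_min ?lexx ?orbT //.
  by right=> t at_; rewrite lt_min => /andP[tq _]; apply: hq.
have const c e m : (a <= c)%O -> (c < e)%O -> (e <= b)%O -> (forall s, (c < s)%O -> (s < e)%O -> f s = m) ->
  exists t, [/\ (a < t)%O, (t < b)%O, cont_at f lt lt t &
    [\/ loc_mono lt lt f t, loc_mono lt gt f t | loc_mono lt eq f t]].
  move=> ac ce eb cst; have [t [ct te]] := os_dense D ce.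
  have ft : f t = m by apply: cst.
  exists t; split; [exact: le_lt_trans ct|exact: lt_le_trans eb| |].
    by move=> c' d'; rewrite ft => ? ?; exists c, e; split=> // s ? ?; rewrite cst.
  constructor 3; split; rewrite ft.
    by exists e => // s ts se; rewrite cst // (lt_trans ct).
  by exists c => // s ts se; rewrite cst // (lt_trans ts).
have [|q1 [aq1 q1b RE]] := dec (fun t => rgerm lt t (fun s => f s = f t)) b _ ab.
  by rewrite /rgerm; dfs.
case: RE => RE.
  have [t [at_ tq1]] := os_dense D aq1; have [c tc hc] := RE t at_ tq1.
  have [e [ec eq1 te]] := pick2R o tc tq1.
  apply: (const t e (f t)); rewrite ?(ltW at_) ?(ltW (lt_le_trans eq1 q1b)) //.
  by move=> s ts se; apply: hc => //; apply: lt_trans ec.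
have [|q2 [aq2 q2q1 LE]] := dec (fun t => rgerm gt t (fun s => f s = f t)) q1 _ aq1.
  by rewrite /rgerm; dfs.
case: LE => LE.
  have [t [at_ tq2]] := os_dense D aq2; have [c tc hc] := LE t at_ tq2.
  have [e [ec eq1 te]] := pick2L o tc at_.
  apply: (const e t (f t)); rewrite ?(ltW eq1) ?(ltW (lt_le_trans tq2 (le_trans q2q1 q1b))) //.
  by move=> s ts se; apply: hc => //; apply: lt_trans ts.
have [|q3 [aq3 q3q2 RU]] := dec (fun t => rgerm lt t (fun s => f t < f s)%O) q2 _ aq2.
  by rewrite /rgerm; dfs.
have [|q4 [aq4 q4q3 LU]] := dec (fun t => rgerm gt t (fun s => f t < f s)%O) q3 _ aq3.
  by rewrite /rgerm; dfs.
have q4b : (q4 <= b)%O by do 3?[apply: le_trans; first eassumption].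
have {}RU : (forall t, (a < t)%O -> (t < q4)%O -> rgerm lt t (fun s => f t < f s)%O) \/
            (forall t, (a < t)%O -> (t < q4)%O -> rgerm lt t (fun s => f s < f t)%O).
  case: RU => RU; [left|right] => t at_ tq4.
    by apply: RU => //; apply: lt_le_trans q4q3.
  case: (rgerm_cmp o Df_f t (f t) o) => // h.
    by case: (RE t) => //; apply: lt_le_trans tq4 (le_trans q4q3 (le_trans q3q2 q2q1)).
  by case: (RU t) => //; apply: lt_le_trans q4q3.
have {}LU : (forall t, (a < t)%O -> (t < q4)%O -> rgerm gt t (fun s => f t < f s)%O) \/
            (forall t, (a < t)%O -> (t < q4)%O -> rgerm gt t (fun s => f s < f t)%O).
  case: LU => LU; [left|right] => t at_ tq4; first exact: LU.
  case: (rgerm_cmp o Df_f t (f t) oc) => // h.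
    by case: (LE t) => //; apply: lt_le_trans tq4 (le_trans q4q3 q3q2).
  by case: (LU t).
(* In order: strict minima, increasing, decreasing, strict maxima. *)
case: RU LU => RU [LU|LU].
- by case: (@no_strict_minima _ _ _ _ o o f Df_f a q4) => // t *; split; [apply: RU|apply: LU].
- have mon t : (a < t)%O -> (t < q4)%O -> loc_mono lt lt f t by split; [apply: RU|apply: LU].
  have inc := @locally_monotone _ _ _ o f Df_f lt a q4 (os_lt D) (ol_trans o) mon.
  have [t [at_ tq4 ct]] := @increasing_cont _ _ _ _ o o f Df_f a q4 aq4 inc.
  by exists t; split=> //; [apply: lt_le_trans q4b|constructor 1; apply: mon].
- have mon t : (a < t)%O -> (t < q4)%O -> loc_mono lt gt f t by split; [apply: RU|apply: LU].
  have inc := @locally_monotone _ _ _ o f Df_f gt a q4 (ol_def oc) (ol_trans oc) mon.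
  have [t [at_ tq4 ct]] := @increasing_cont _ _ _ _ o oc f Df_f a q4 aq4 inc.
  exists t; split=> //; [exact: lt_le_trans q4b| |by constructor 2; apply: mon].
  move=> c' d' c'f fd'; have [c [e [? ? h]]] := ct d' c' fd' c'f.
  by exists c, e; split=> // s cs se; have [] := h s cs se.
- by case: (@no_strict_minima _ _ _ _ o oc f Df_f a q4) => // t *; split; [apply: RU|apply: LU].
Qed.

End Monotonicity.

(** * Boxes and generic continuity *)

Definition tl T n (x : 'I_n.+1 -> T) : 'I_n -> T := fun j => x (lift ord0 j).
Definition cons T n (t : T) (y : 'I_n -> T) : 'I_n.+1 -> T :=
  fun k => if unlift ord0 k is Some j then y j else t.

Lemma cons_tl T n (x : 'I_n.+1 -> T) : cons (x ord0) (tl x) = x.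
Proof. by apply: funext => k; rewrite /cons /tl; case: unliftP => [j|] ->. Qed.

Lemma tl_cons T n (t : T) (y : 'I_n -> T) : tl (cons t y) = y.
Proof. by apply: funext => k; rewrite /cons /tl liftK. Qed.

Lemma cons0 T n (t : T) (y : 'I_n -> T) : cons t y ord0 = t.
Proof. by rewrite /cons unlift_none. Qed.

Section Boxes.
Context {d : Order.disp_t} {M : orderType d}.
Implicit Types J : Type.

Definition box J (a b x : J -> M) := forall j, (a j < x j)%O /\ (x j < b j)%O.

(** Neighbourhoods are spelled out by boxes to stay first order; [nbhs_ptws_near] compares them with
    the product of order topologies. *)
Definition near J (x : J -> M) (P : (J -> M) -> Prop) :=
  exists a b, box a b x /\ forall y, box a b y -> P y.

Definition subbox J (a' b' a b : J -> M) :=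
  forall j, [/\ (a j <= a' j)%O, (a' j < b' j)%O & (b' j <= b j)%O].

Definition contn J (f : (J -> M) -> M) x :=
  forall a b, (a < f x)%O -> (f x < b)%O -> near x (fun y => (a < f y)%O /\ (f y < b)%O).

Lemma box_cons n (a b : 'I_n.+1 -> M) t y :
  box a b (cons t y) <-> ((a ord0 < t)%O /\ (t < b ord0)%O) /\ box (tl a) (tl b) y.
Proof.
split=> [h|[h1 h2] k].
  split; first by have := h ord0; rewrite cons0.
  by move=> j; have := h (lift ord0 j); rewrite /cons liftK.
by rewrite /cons; case: unliftP => [j|] ->; [apply: h2|].
Qed.

Lemma subbox_refl J (a b : J -> M) : (forall j, (a j < b j)%O) -> subbox a b a b.
Proof. by move=> ab j; rewrite !lexx ab. Qed.

Lemma subbox_trans J (a b a' b' a2 b2 : J -> M) :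
  subbox a b a' b' -> subbox a' b' a2 b2 -> subbox a b a2 b2.
Proof.
move=> h h' j; have [h1 ? h2] := h j; have [h3 _ h4] := h' j.
by split=> //; [apply: le_trans h3 h1|apply: le_trans h2 h4].
Qed.

Lemma subbox_box J (a b a' b' x : J -> M) : subbox a b a' b' -> box a b x -> box a' b' x.
Proof.
move=> h hx j; have [h1 _ h2] := h j; have [h3 h4] := hx j.
by split; [apply: le_lt_trans h1 h3|apply: lt_le_trans h4 h2].
Qed.

Lemma subbox_cons n (a b : 'I_n.+1 -> M) u v y z :
  (a ord0 <= u)%O -> (u < v)%O -> (v <= b ord0)%O -> subbox y z (tl a) (tl b) ->
  subbox (cons u y) (cons v z) a b.
Proof.
move=> au uv vb h k; rewrite /cons; case: unliftP => [j|] -> //.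
exact: (h j).
Qed.

Lemma near_imp J (x : J -> M) (P Q : (J -> M) -> Prop) :
  (forall y, P y -> Q y) -> near x P -> near x Q.
Proof. by move=> PQ [a [b [abx h]]]; exists a, b; split=> // y /h /PQ. Qed.

Lemma near_pt J (x : J -> M) P : near x P -> P x.
Proof. by case=> a [b [abx]]; apply. Qed.

Lemma near_box J (a b x : J -> M) : box a b x -> near x (box a b).
Proof. by exists a, b. Qed.

Lemma near_and J (x : J -> M) P Q : near x P -> near x Q -> near x (fun y => P y /\ Q y).
Proof.
case=> a [b [abx h]] [a' [b' [abx' h']]].
exists (fun j => Order.max (a j) (a' j)), (fun j => Order.min (b j) (b' j)); split.
  by move=> j; rewrite gt_max lt_min; have [-> ->] := abx j; have [-> ->] := abx' j.
move=> y hy; split; [apply: h|apply: h'] => j; have := hy j;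
by rewrite gt_max lt_min => -[/andP[? ?] /andP[? ?]].
Qed.

Lemma near_cons n (x : 'I_n.+1 -> M) u v P Q :
  (u < x ord0)%O -> (x ord0 < v)%O -> near (tl x) P ->
  (forall t y, (u < t)%O -> (t < v)%O -> P y -> Q (cons t y)) -> near x Q.
Proof.
move=> ux xv [a [b [abx hP]]] PQ; exists (cons u a), (cons v b); split.
  by rewrite -(cons_tl x) box_cons !cons0 !tl_cons.
move=> y; rewrite -(cons_tl y) box_cons !cons0 !tl_cons => -[[uy yv] aby].
by apply: PQ => //; apply: hP.
Qed.

Lemma near_cons_inv n t (y : 'I_n -> M) Q : near (cons t y) Q ->
  exists u v, [/\ (u < t)%O, (t < v)%O &
    near y (fun z => forall s, (u < s)%O -> (s < v)%O -> Q (cons s z))].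
Proof.
case=> a [b [/box_cons[[at_ tb] aby] h]]; exists (a ord0), (b ord0); split=> //.
exists (tl a), (tl b); split=> // z abz s us sv; apply: h; exact/box_cons.
Qed.

End Boxes.

Section DefinableBoxes.
Context {d : Order.disp_t} {M : orderType d} (D : ominsys M).

Lemma Dt_cons n I t (y : (I -> M) -> 'I_n -> M) k :
  Dt D t -> (forall j, Dt D (fun e => y e j)) -> Dt D (fun e => cons (t e) (y e) k).
Proof. by rewrite /cons; case: unliftP. Qed.

Lemma Dt_tl n I (y : (I -> M) -> 'I_n.+1 -> M) k :
  (forall j, Dt D (fun e => y e j)) -> Dt D (fun e => tl (y e) k).
Proof. exact. Qed.

Lemma Df_le I (t u : (I -> M) -> M) : Dt D t -> Dt D u -> D I (fun e => t e <= u e)%O.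
Proof.
move=> Dt1 Du; apply: (@Df_ext _ _ _ (fun e => ~ (u e < t e)%O)).
  by move=> e; rewrite leNgt; split=> /negP.
by apply: Df_not; apply: os_ltE.
Qed.

(** No choice among several values is made: [F] is a partial function, and [os_pt] serves as its
    value outside its domain. *)
Lemma definable_choice (J : finType) (F : (J -> M) -> M -> Prop) : Df2 D F ->
  (forall x u v, F x u -> F x v -> u = v) ->
  exists2 f, Dfun D f & forall x v, F x v -> f x = v.
Proof.
move=> DF funF.
have /choice[f hf] : forall x, exists v, F x v \/ ((~ exists v, F x v) /\ v = os_pt D).
  move=> x; have [[v Fv]|n] := pselect (exists v, F x v); first by exists v; left.
  by exists (os_pt D); right.
exists f; last first.
  by move=> x v Fv; case: (hf x) => [Fx|[[]]]; [apply: funF Fv|exists v].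
apply/DfunP/Df2P; apply: (@Df_ext _ _ _ (fun e => F (fun j => e (Some j)) (e None) \/
   ((~ exists v, F (fun j => e (Some j)) v) /\ e None = os_pt D))).
  move=> e; set x := (fun j => e (Some j)); case: (hf x) => [Fx|[nF ->]].
    split; first by case=> [Fe|[nF _]]; [exact: (funF x _ _ Fx Fe)|case: nF; exists (f x)].
    by move=> <-; left.
  by split=> [[Fe|[_ ->] //]|<-]; [case: nF; exists (e None)|right].
have DF' := DF : forall I x t, _ -> _ -> _.
by dfs.
Qed.

End DefinableBoxes.

Ltac dfs_ext ::= first
  [ apply: os_ltE | apply: Df_le | apply: Dt_cons | apply: Dt_tl
  | progress rewrite /near /box /contn /cont_at /loc_mono /rgerm ].

Section Generic.
Context {d : Order.disp_t} {M : orderType d} (D : ominsys M).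
Local Notation lt := (fun x y : M => (x < y)%O).
Local Notation gt := (fun x y : M => (y < x)%O).

(** A definable counterpart of the Baire property: no definable set is both dense and codense in a
    box. *)
Definition baire n := forall (a b : 'I_n -> M) P, (forall j, a j < b j)%O -> Df1 D P ->
  exists a' b', subbox a' b' a b /\
    ((forall x, box a' b' x -> P x) \/ (forall x, box a' b' x -> ~ P x)).

Definition gencont n := forall (a b : 'I_n -> M) f, (forall j, a j < b j)%O -> Dfun D f ->
  exists a' b', subbox a' b' a b /\ forall x, box a' b' x -> contn f x.

Lemma box_ex n (a b : 'I_n -> M) : (forall j, a j < b j)%O -> exists x, box a b x.
Proof.
move=> ab; have /choice[x hx] : forall j, exists t, (a j < t)%O /\ (t < b j)%O.
  by move=> j; apply: os_dense.
by exists x.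
Qed.

(** Passing to the complement if necessary, [P] holds just after [a ord0] on every line over a
    subbox of the base. The end of this initial stretch is a definable function of the base point,
    continuous somewhere by [gencont n], hence locally bounded below by some [e] beyond [a ord0]:
    this gives a box inside [P]. *)
Lemma baireS n : baire n -> gencont n -> baire n.+1.
Proof.
move=> Bn Cn a b P ab DP; have o := olin_lt D.
have tlab j : (tl a j < tl b j)%O by apply: ab.
wlog [a' [b' [sab hP]]] : P DP / exists a' b', subbox a' b' (tl a) (tl b) /\
    forall y, box a' b' y -> rgerm lt (a ord0) (fun t => P (cons t y)).
  move=> wl; have [|a' [b' [sab [hP|hP]]]] :=
    Bn (tl a) (tl b) (fun y => rgerm lt (a ord0) (fun t => P (cons t y))) tlab.
  - by apply/Df1P; rewrite /rgerm; dfs.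
  - by apply: wl => //; exists a', b'.
  have [||a1 [b1 [sab1 h1]]] := wl (fun x => ~ P x).
  - by move=> I x Dx; apply: Df_not; apply: DP.
  - exists a', b'; split=> // y /hP nP.
    have DPy : D unit (fun e => P (cons (e tt) y)) by dfs.
    by case: (@rgerm_dec _ _ _ o (a ord0) (fun t => P (cons t y)) DPy).
  exists a1, b1; split=> //; case: h1 => h1; [right|left] => // x bx.
  by apply: contrapT => nPx; case: (h1 x bx).
(* [v] is the supremum of the ends [q] of initial stretches inside [P], described by its lower cut.
   Truncation at [b ord0] makes it exist. *)
pose F y v := (forall u, (u < v <-> exists q, [/\ a ord0 < q, q <= b ord0, u < q &
  forall t, a ord0 < t -> t < q -> P (cons t y)])%O).
have DF : Df2 D F.
  apply/Df2P; rewrite /F.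
  apply: (@Df_ext _ D _ (fun e => forall u, (u < e None <-> exists q, a ord0 < q /\ q <= b ord0 /\ u < q /\
    forall t, a ord0 < t -> t < q -> P (cons t (fun j => e (Some j))))%O)); last by dfs.
  move=> e; split=> h u; rewrite h; split.
  - by case=> q [? [? [? ?]]]; exists q.
  - by case=> q [? ? ? ?]; exists q.
  - by case=> q [? ? ? ?]; exists q.
  - by case=> q [? [? [? ?]]]; exists q.
have [|f Df_f fF] := definable_choice DF.
  move=> y v v' h h'; case: (ltgtP v v') => // vv'.
    by move: vv'; rewrite h' -h ltxx.
  by move: vv'; rewrite h -h' ltxx.
have fE y : box a' b' y -> F y (f y).
  move=> /hP[q aq hq].
  pose Q p := (a ord0 < p /\ p <= b ord0 /\ forall t, a ord0 < t -> t < p -> P (cons t y))%O.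
  have [|||v [vU vL]] := @ol_sup _ _ _ o Q.
  - by rewrite /Q; dfs.
  - exists (Order.min q (b ord0)); split; first by rewrite lt_min aq ab.
    split; first by rewrite ge_min lexx orbT.
    by move=> t at_; rewrite lt_min => /andP[? _]; apply: hq.
  - by exists (b ord0) => x [_ [xb _]] bx; move: (lt_le_trans bx xb); rewrite ltxx.
  suff Fv : F y v by rewrite (fF y v Fv).
  move=> u; split.
    by move=> /vL[p [[ap [pb hp]] up]]; exists p.
  case=> p [ap pb up hp]; apply: lt_le_trans up _; rewrite leNgt; apply/negP.
  by apply: vU.
have [|a2 [b2 [sab2 hc]]] := Cn a' b' f _ Df_f.
  by move=> j; have [] := sab j.
have [|y by2] := @box_ex n a2 b2; first by move=> j; have [] := sab2 j.
have Fy := fE y (subbox_box sab2 by2).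
have afy : (a ord0 < f y)%O.
  have [q aq hq] := hP y (subbox_box sab2 by2).
  apply/Fy; exists (Order.min q (b ord0)); rewrite ?lt_min ?aq ?ab ?ge_min ?lexx ?orbT //.
  by split=> // t at_; rewrite lt_min => /andP[? _]; apply: hq.
have [e [ae ef]] := os_dense D afy.
have [_ [g [_ fg]]] := os_noend D (f y).
have [a3 [b3 [by3 h3]]] := near_and (hc y by2 e g ef fg) (near_box by2).
have eb : (e <= b ord0)%O by have /Fy[q [_ qb eq _]] := ef; apply: ltW (lt_le_trans eq qb).
pose a4 j := Order.max (a2 j) (a3 j); pose b4 j := Order.min (b2 j) (b3 j).
have s42 : subbox a4 b4 a2 b2.
  move=> j; rewrite /a4 /b4 le_max lexx ge_min lexx; split=> //.
  have [h1 h2] := by2 j; have [h3' h4] := by3 j.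
  by rewrite gt_max !lt_min (lt_trans h1 h2) (lt_trans h1 h4) (lt_trans h3' h2) (lt_trans h3' h4).
exists (cons (a ord0) a4), (cons e b4); split.
  apply: subbox_cons => //; exact: subbox_trans s42 (subbox_trans sab2 sab).
left=> x; rewrite -(cons_tl x) box_cons !cons0 !tl_cons => -[[ax xe] bx].
have b3x : box a3 b3 (tl x).
  move=> j; have := bx j; rewrite /a4 /b4 gt_max lt_min.
  by case=> /andP[_ ?] /andP[_ ?].
have [[efx _] _] := h3 _ b3x.
have bx' := subbox_box sab2 (subbox_box s42 bx).
by have /(fE _ bx')[q [_ _ eq hq]] := efx; apply: hq => //; apply: lt_trans eq.
Qed.

(** On a subbox the function is continuous and monotone of one fixed kind along the first
    coordinate, by [monotonicity] and [baire], and continuous along the others, by [gencont n]. Two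
    values of the first coordinate then frame the point: at both of them the function stays in the
    prescribed interval over nearby base points, and monotonicity confines what lies in between. *)
Lemma gencontS n : baire n.+1 -> gencont n -> gencont n.+1.
Proof.
move=> Bn Cn a b f ab Df_f; have o := olin_lt D; have oc := olin_conv o.
pose E R (x : 'I_n.+1 -> M) := loc_mono lt R (fun t => f (cons t (tl x))) (x ord0) /\
   cont_at (fun t => f (cons t (tl x))) lt lt (x ord0).
have DE (R : M -> M -> Prop) : D bool (fun e => R (e true) (e false)) -> Df1 D (E R).
  move=> /(@Df_rel _ _ R) DR; apply/Df1P; rewrite /E /loc_mono /rgerm /cont_at.
  apply: Df_and; first by dfs.
  apply: (@Df_ext _ D _ (fun e => forall c' d',
    (c' < f (cons (e ord0) (tl e)) -> f (cons (e ord0) (tl e)) < d' ->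
    exists c d'', c < e ord0 /\ e ord0 < d'' /\ (forall s, c < s -> s < d'' ->
      c' < f (cons s (tl e)) /\ f (cons s (tl e)) < d'))%O)); last by dfs.
  move=> e; split=> h c' d' h1 h2; have [c [d'' h3]] := h c' d' h1 h2; exists c, d''.
    by case: h3 => ? [].
  by case: h3.
have Dgt := ol_def oc; have Deq : D bool (fun e => e true = e false) by dfs.
(* [R] is the order, its converse or equality. The third clause is what they share: a value that [R]
   places between two points of an interval lies in that interval. *)
have [R [Rtr DR Rbet [a1 [b1 [sab1 hR]]]]] : exists R : M -> M -> Prop, [/\
    forall u v w, R u v -> R v w -> R u w,
    D bool (fun e => R (e true) (e false)),
    forall a b u v w, (a < u)%O /\ (u < b)%O -> (a < w)%O /\ (w < b)%O -> R u v -> R v w ->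
      (a < v)%O /\ (v < b)%O &
    exists a1 b1, subbox a1 b1 a b /\ forall x, box a1 b1 x -> E R x].
  have [a1 [b1 [sab1 [h1|h1]]]] := Bn a b _ ab (DE lt (os_lt D)).
    exists lt; split=> //; [exact: (ol_trans o)|exact: os_lt| |by exists a1, b1].
    move=> a' b' u v w [au ub] [aw wb] uv vw; split; [exact: lt_trans uv|exact: lt_trans wb].
  have ab1 j : (a1 j < b1 j)%O by have [] := sab1 j.
  have [a2 [b2 [sab2 [h2|h2]]]] := Bn a1 b1 _ ab1 (DE gt Dgt).
    exists gt; split=> //.
    - exact: (ol_trans oc).
    - move=> a' b' u v w [au ub] [aw wb] uv vw; split; [exact: lt_trans vw|exact: lt_trans ub].
    - by exists a2, b2; split=> //; apply: subbox_trans sab1.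
  have ab2 j : (a2 j < b2 j)%O by have [] := sab2 j.
  have [a3 [b3 [sab3 [h3|h3]]]] := Bn a2 b2 _ ab2 (DE eq Deq).
    exists eq; split=> //.
    - by move=> u v w -> ->.
    - by move=> a' b' u v w ? ? <-.
    - by exists a3, b3; split=> //; apply: subbox_trans (subbox_trans sab2 sab1).
  have ab3 j : (a3 j < b3 j)%O by have [] := sab3 j.
  have [y by3] := box_ex (fun j => ab3 (lift ord0 j)).
  have Df_g : forall I (t : (I -> M) -> M), Dt D t -> Dt D (fun e => f (cons (t e) y)).
    by dfs.
  have [t [at_ tb ct mt]] := @monotonicity _ _ D (fun t => f (cons t y)) Df_g _ _ (ab3 ord0).
  have bt : box a3 b3 (cons t y) by apply/box_cons.
  exfalso; case: mt => mt.
  - apply: (h1 (cons t y)); first exact: (subbox_box sab2 (subbox_box sab3 bt)).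
    by rewrite /E cons0 tl_cons.
  - apply: (h2 (cons t y)); first exact: (subbox_box sab3 bt).
    by rewrite /E cons0 tl_cons.
  - by apply: (h3 (cons t y)) => //; rewrite /E cons0 tl_cons.
have ab1 j : (a1 j < b1 j)%O by have [] := sab1 j.
pose W (x : 'I_n.+1 -> M) := contn (fun y => f (cons (x ord0) y)) (tl x).
have DW : Df1 D W by apply/Df1P; rewrite /W /contn; dfs.
have [a2 [b2 [sab2 hW]]] : exists a2 b2, subbox a2 b2 a1 b1 /\ forall x, box a2 b2 x -> W x.
  have [a2 [b2 [sab2 [h2|h2]]]] := Bn a1 b1 _ ab1 DW; first by exists a2, b2.
  have ab2 j : (a2 j < b2 j)%O by have [] := sab2 j.
  have [t [at_ tb]] := os_dense D (ab2 ord0).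
  have [|a3 [b3 [sab3 h3]]] := Cn _ _ (fun y => f (cons t y)) (fun j => ab2 (lift ord0 j)).
    by move=> I x Dx; dfs.
  have [|y by3] := @box_ex n a3 b3; first by move=> j; have [] := sab3 j.
  case: (h2 (cons t y)); last by rewrite /W cons0 tl_cons; apply: h3.
  by apply/box_cons; split=> //; apply: subbox_box by3.
exists a2, b2; split; first exact: subbox_trans sab1.
move=> x bx u v ufx fxv.
have mon y s t : box (tl a2) (tl b2) y -> (a2 ord0 < s)%O -> (s < t)%O -> (t < b2 ord0)%O ->
    R (f (cons s y)) (f (cons t y)).
  move=> hy; have Df_g : forall I (t : (I -> M) -> M), Dt D t -> Dt D (fun e => f (cons (t e) y)).
    by dfs.
  apply: (@locally_monotone _ _ _ o (fun t => f (cons t y)) Df_g R _ _ DR Rtr) => r ar rb.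
  have [|h _] := hR (cons r y); first by apply: (subbox_box sab2); apply/box_cons.
  by move: h; rewrite cons0 tl_cons.
have [_ cx] := hR x (subbox_box sab2 bx).
have [||c [e [cx0 x0e hce]]] := cx u v; rewrite ?cons_tl //.
have [ax xb] := bx ord0.
have [s1 [as1 cs1 s1x]] := pick2L o ax cx0.
have [s2 [s2b s2e xs2]] := pick2R o xb x0e.
have btx : box (tl a2) (tl b2) (tl x) by move=> j; apply: bx.
have hWs s : (a2 ord0 < s)%O -> (s < b2 ord0)%O -> (c < s)%O -> (s < e)%O ->
    near (tl x) (fun y => (u < f (cons s y))%O /\ (f (cons s y) < v)%O).
  move=> as_ sb cs se; have := hW (cons s (tl x)); rewrite /W cons0 tl_cons.
  by have [us sv] := hce s cs se; apply=> //; apply/box_cons.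
have n1 := hWs s1 as1 (lt_trans s1x xb) cs1 (lt_trans s1x x0e).
have n2 := hWs s2 (lt_trans ax xs2) s2b (lt_trans cx0 xs2) s2e.
apply: (near_cons s1x xs2 (near_and (near_box btx) (near_and n1 n2))).
move=> t y s1t ts2 [by2 [h1 h2]].
apply: (Rbet u v _ _ _ h1 h2); apply: mon => //; first exact: lt_trans ts2 s2b.
exact: lt_trans s1t.
Qed.

Theorem baire_gencont n : baire n /\ gencont n.
Proof.
elim: n => [|n [Bn Cn]]; last by have B := baireS Bn Cn; split=> //; apply: gencontS.
have all_eq (x y : 'I_0 -> M) : x = y by apply: funext; case.
split=> a b P ab DP; exists a, b; (split; first exact: subbox_refl).
  by have [h|h] := pselect (P a); [left|right] => x _; rewrite (all_eq x a).
move=> x bx u v ux xv; exists a, b; split=> // y _.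
by rewrite (all_eq y x).
Qed.

End Generic.

(** * Cell decomposition *)

Inductive fu (T : Type) (Pc : (T -> Prop) -> Prop) : (T -> Prop) -> Prop :=
| fu0 : fu Pc (fun _ => False)
| fu1 C : Pc C -> fu Pc C
| fuU X Y : fu Pc X -> fu Pc Y -> fu Pc (fun x => X x \/ Y x).

Section FiniteUnions.
Variables (T : Type).
Implicit Types (Pc Qc : (T -> Prop) -> Prop) (X Y C : T -> Prop).

Lemma fu_ext Pc X Y : (forall x, X x <-> Y x) -> fu Pc X -> fu Pc Y.
Proof. by move=> XY; rewrite (_ : X = Y) //; apply: funext => x; apply: propext. Qed.

Lemma fu_bind Pc Qc X : fu Pc X -> (forall C, Pc C -> fu Qc C) -> fu Qc X.
Proof. by move=> fX PQ; elim: fX => [|C /PQ //|{}X Y _ ? _ ?]; [apply: fu0|apply: fuU]. Qed.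

Lemma fu_mono Pc Qc X : (forall C, Pc C -> Qc C) -> fu Pc X -> fu Qc X.
Proof. by move=> PQ fX; apply: fu_bind fX _ => C /PQ; apply: fu1. Qed.

Lemma fu_sub Pc X : fu Pc X -> fu (fun C => Pc C /\ forall x, C x -> X x) X.
Proof.
elim=> [|C PC|{}X Y _ fX _ fY]; [exact: fu0|exact: fu1|].
apply: fuU.
  by apply: fu_mono fX => C [PC CX]; split=> // x /CX; left.
by apply: fu_mono fY => C [PC CX]; split=> // x /CX; right.
Qed.

Lemma fu_split Pc X (Q : T -> Prop) :
  fu Pc (fun x => X x /\ Q x) -> fu Pc (fun x => X x /\ ~ Q x) -> fu Pc X.
Proof.
move=> h1 h2; apply: (fu_ext _ (fuU h1 h2)) => x; split=> [[[]|[]]//|Xx].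
by have [?|?] := pselect (Q x); [left|right].
Qed.

End FiniteUnions.

Lemma fu_preim (T T' : Type) (g : T' -> T) (B : T' -> Prop) Pc
    (Qc : (T' -> Prop) -> Prop) (X : T -> Prop) :
  fu Pc X -> (forall C, Pc C -> Qc (fun x => B x /\ C (g x))) ->
  fu Qc (fun x => B x /\ X (g x)).
Proof.
move=> fX PQ; elim: fX => [|C /PQ|{}X Y _ fX _ fY].
- by apply: (fu_ext _ (fu0 _)) => x; split=> // -[].
- exact: fu1.
- apply: (fu_ext _ (fuU fX fY)) => x.
  by split=> [[[? ?]|[? ?]]|[? [?|?]]]; [split=> //; left|split=> //; right|left|right].
Qed.

Section Pieces.
Context {d : Order.disp_t} {M : orderType d} (D : ominsys M).

(** Relatively clopen subsets are replaced by locally constant predicates, which spares a topology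
    on M. *)
Definition conn J (C : (J -> M) -> Prop) := forall P, Df1 D P ->
  (forall x, C x -> near x (fun y => C y -> (P y <-> P x))) ->
  forall x y, C x -> C y -> (P x <-> P y).

(** Taking [y] with the same other coordinates as [x] shows that these determine coordinate [j] on
    [C]; the continuity expressed is relative to [C]. *)
Definition thin n (C : ('I_n -> M) -> Prop) := exists j, forall x, C x ->
  forall a b, (a < x j)%O -> (x j < b)%O -> exists c e, box c e x /\
  forall y, C y -> (forall k, k <> j -> (c k < y k)%O /\ (y k < e k)%O) ->
    (a < y j)%O /\ (y j < b)%O.

Definition piece n (C : ('I_n -> M) -> Prop) :=
  [/\ Df1 D C, conn C & (forall x, C x -> near x C) \/ thin C].

Lemma piece_ext n (C C' : ('I_n -> M) -> Prop) :
  (forall x, C x <-> C' x) -> piece C -> piece C'.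
Proof. by move=> CC'; rewrite (_ : C = C') //; apply: funext => x; apply: propext. Qed.

Definition cont_on J (C : (J -> M) -> Prop) (f : (J -> M) -> M) :=
  forall x, C x -> forall a b, (a < f x)%O -> (f x < b)%O ->
    near x (fun y => C y -> (a < f y)%O /\ (f y < b)%O).

Definition decomposable n := forall X : ('I_n -> M) -> Prop, Df1 D X -> fu (@piece n) X.

Definition cont_decomposable n := forall (X : ('I_n -> M) -> Prop) f, Df1 D X -> Dfun D f ->
  fu (fun C => piece C /\ cont_on C f) X.

Lemma near_true J (x : J -> M) : near x (fun _ => True).
Proof.
have /choice[c hc] : forall j, exists y : M * M, (y.1 < x j)%O /\ (x j < y.2)%O.
  by move=> j; have [y [z ?]] := os_noend D (x j); exists (y, z).
by exists (fun j => (c j).1), (fun j => (c j).2).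
Qed.

Lemma near_all J (x : J -> M) (P : (J -> M) -> Prop) : (forall y, P y) -> near x P.
Proof. by move=> hP; apply: near_imp (near_true x). Qed.

Lemma thin_sub n (C C' : ('I_n -> M) -> Prop) : (forall x, C' x -> C x) -> thin C -> thin C'.
Proof.
move=> sub [j h]; exists j => x /sub Cx a b ax xb.
by have [c [e [cex hce]]] := h x Cx a b ax xb; exists c, e; split=> // y /sub; apply: hce.
Qed.

(** A thin set is homeomorphic to its image under the projection that forgets the
    dependent coordinate. *)
Record chart m (C : ('I_m.+1 -> M) -> Prop) (p : ('I_m.+1 -> M) -> 'I_m -> M)
    (s : ('I_m -> M) -> 'I_m.+1 -> M) := Chart {
  chartK : forall x, C x -> s (p x) = x;
  chart_p : forall x P, near (p x) P -> near x (fun y => P (p y));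
  chart_s : forall x P, C x -> near x P ->
    near (p x) (fun y => (C (s y) /\ p (s y) = y) -> P (s y));
  chart_Dp : forall I x, Dtv D x -> Dtv D (fun e : I -> M => p (x e));
  chart_Ds : forall I y, Dtv D y -> Dtv D (fun e : I -> M => s (y e)) }.

(** Coordinate [j] is a function of the others on [C], so [definable_choice] recovers it; the
    condition in [thin] is the continuity of the resulting section [s]. *)
Lemma thin_chart m (C : ('I_m.+1 -> M) -> Prop) : Df1 D C -> thin C ->
  exists p s, chart C p s.
Proof.
move=> DC [j hj].
pose p (x : 'I_m.+1 -> M) : 'I_m -> M := fun k => x (lift j k).
have uniq x y : C x -> C y -> p x = p y -> x = y.
  move=> Cx Cy pxy.
  have le x' y' : C x' -> C y' -> p x' = p y' -> ~ (x' j < y' j)%O.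
    move=> Cx' Cy' pxy' lxy.
    have [z [_ [zx _]]] := os_noend D (x' j).
    have [c [e [cex h]]] := hj x' Cx' z (y' j) zx lxy.
    have [|_] := h y' Cy'; last by rewrite ltxx.
    move=> k /eqP; rewrite eq_sym => /unlift_some[l kE _].
    have -> : y' k = x' k by rewrite kE; exact: (esym (congr1 (fun g => g l) pxy')).
    exact: cex.
  apply: funext => k; case: (unliftP j k) => [l|] -> ; first exact: (congr1 (fun g => g l) pxy).
  by have := le x y Cx Cy pxy; have := le y x Cy Cx (esym pxy); case: ltgtP.
have Dp : forall I x, Dtv D x -> Dtv D (fun e : I -> M => p (x e)).
  by move=> I x Dx k; apply: Dx.
pose F y v := exists x, (C x /\ forall k, p x k = y k) /\ x j = v.
have DF : Df2 D F.
  apply/Df2P; rewrite /F /p; dfs.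
have [|g Dg gF] := definable_choice DF.
  move=> y u v [x [[Cx px] <-]] [x' [[Cx' px'] <-]].
  by rewrite (uniq x x') //; apply: funext => k; rewrite px px'.
pose s y : 'I_m.+1 -> M := fun k => if unlift j k is Some l then y l else g y.
have sK x : C x -> s (p x) = x.
  move=> Cx; apply: funext => k; rewrite /s; case: unliftP => [l|] -> //.
  by apply: gF; exists x.
exists p, s; split=> //.
- move=> x P [a [b [abx h]]].
  have [a' [b' [abx' _]]] := near_true x.
  pose ext (u : 'I_m -> M) (v : 'I_m.+1 -> M) k := if unlift j k is Some l then u l else v k.
  exists (ext a a'), (ext b b'); split.
    by move=> k; rewrite /ext; case: unliftP => [l|] ->; [apply: abx|apply: abx'].
  move=> y hy; apply: h => l; have := hy (lift j l).
  by rewrite /ext liftK.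
- move=> x P Cx [a [b [abx h]]].
  have [c [e [cex hce]]] := hj x Cx _ _ (abx j).1 (abx j).2.
  have n1 : near (p x) (box (p a) (p b)).
    by apply: near_box => l; apply: abx.
  have n2 : near (p x) (box (p c) (p e)).
    by apply: near_box => l; apply: cex.
  apply: near_imp (near_and n1 n2) => y [aby cey] [Cs ps]; apply: h => k.
  have sk l : s y (lift j l) = y l by rewrite /s liftK.
  case: (unliftP j k) => [l|] ->; first by rewrite sk; apply: aby.
  apply: hce => // i /eqP; rewrite eq_sym => /unlift_some[l -> _]; rewrite sk; exact: cey.
- by move=> I y Dy k; rewrite /s; case: unliftP => [l|] _; [apply: Dy|apply: Dg].
Qed.

(** Where [f] is continuous any decomposition will do. The set of discontinuities contains no box,
    by generic continuity, so its nonempty pieces are thin, and a chart carries the problem to one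
    dimension less. *)
Lemma cont_decomposition n : decomposable n ->
  (forall m, n = m.+1 -> cont_decomposable m) -> cont_decomposable n.
Proof.
move=> Pn IH X f DX Df_f.
have DZ : Df1 D (contn f) by apply/Df1P; rewrite /contn; dfs.
apply: (fu_split (Q := contn f)).
  have DXZ : Df1 D (fun x => X x /\ contn f x) by apply/Df1P; apply: Df_and; apply/Df1P.
  apply: fu_mono (fu_sub (Pn _ DXZ)) => C [pC sub]; split=> // x /sub[_ cx] a b ax xb.
  by apply: near_imp (cx a b ax xb).
have DXZ : Df1 D (fun x => X x /\ ~ contn f x).
  by apply/Df1P; apply: Df_and; [|apply: Df_not]; apply/Df1P.
apply: fu_bind (fu_sub (Pn _ DXZ)) _ => C [pC sub].
case: (pC) => DC cC [oC|tC].
  apply: fu1; split=> // x Cx; exfalso.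
  have [a [b [abx h]]] := oC x Cx.
  have [|a' [b' [sab hc]]] := (baire_gencont D n).2 a b f _ Df_f.
    by move=> j; have [ax xb] := abx j; apply: lt_trans xb.
  have [|y by_] := @box_ex _ _ D n a' b'; first by move=> j; have [] := sab j.
  by have [] := sub y (h y (subbox_box sab by_)); have := hc y by_.
case: n Pn IH X f DX Df_f DZ DXZ C pC sub DC cC tC => [|m] Pn IH X f DX Df_f DZ DXZ C pC sub DC cC tC.
  (* [thin] names a coordinate, so it fails in dimension 0. *)
  by case: tC; case.
have [p [s cps]] := thin_chart DC tC.
have [sK np ns Dp Ds] := cps.
pose C' y := C (s y) /\ p (s y) = y.
have Df_f' : Dfun D (fun y => f (s y)) by move=> I y Dy; apply: Df_f; apply: Ds.
have DC' : Df1 D C'.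
  apply/Df1P; apply: (@Df_ext _ D _ (fun e => C (s e) /\ forall k, p (s e) k = e k)).
    move=> e; rewrite /C'; split=> -[h1 h2]; split=> //; last by move=> k; rewrite h2.
    exact: funext.
  apply: Df_and; first by apply: DC; apply: Ds => k; apply: Dt_var.
  apply: Df_allfin => k; apply: Df_eq; last exact: Dt_var.
  by apply: Dp; apply: Ds => l; apply: Dt_var.
have CC' x : C x -> C' (p x) by move=> Cx; rewrite /C' sK.
have fu' := fu_sub (IH m erefl C' _ DC' Df_f').
apply: (@fu_ext _ _ (fun x => C x /\ C' (p x))).
  by move=> x; split=> [[]//|Cx]; split=> //; apply: CC'.
apply: (fu_preim fu') => B [[[DB cB _] contB] BC'].
split; last first.
  move=> x [Cx Bx] a b; rewrite -{1 2}(sK x Cx) => ax xb.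
  have /np := contB (p x) Bx a b ax xb.
  by apply: near_imp => y hy [Cy By]; move: (hy By); rewrite sK.
split.
- by move=> I x Dx; apply: Df_and; [apply: DC|apply: DB; apply: Dp].
- move=> P DP loc x y [Cx Bx] [Cy By].
  rewrite -(sK x Cx) -(sK y Cy); apply: (cB (fun y => P (s y))) => //.
    by move=> I z Dz; apply: DP; apply: Ds.
  move=> z Bz; have [Csz psz] := BC' z Bz.
  have := loc (s z); rewrite psz => /(_ (conj Csz Bz))/(ns _ _ Csz); rewrite psz.
  apply: near_imp => w hw Bw; have [Csw psw] := BC' w Bw.
  by apply: hw => //; rewrite psw.
- by right; apply: thin_sub tC => x [].
Qed.

End Pieces.

Section IntervalConnectedness.
Variables (M : eqType) (D : defsys M) (lt : M -> M -> Prop) (o : olin D lt).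

(** Local constancy fails at the infimum of the points of the interval where [Q] has lost its value
    at [t]. *)
Lemma interval_connected (Q : M -> Prop) t t' : D unit (fun e => Q (e tt)) -> lt t t' ->
  (forall s, ~ lt s t -> ~ lt t' s -> exists a b, [/\ lt a s, lt s b &
    forall u, lt a u -> lt u b -> ~ lt u t -> ~ lt t' u -> (Q u <-> Q s)]) ->
  (Q t <-> Q t').
Proof.
have Dlt := Df_rel (lt := lt) (ol_def o).
move=> DQ tt' loc.
have DQ1 := fun I s => @Df_app1 M D I Q s DQ.
(* One implication is enough: the other is the same one for the negation of [Q]. *)
suff h (Q' : M -> Prop) : D unit (fun e => Q' (e tt)) ->
    (forall u s, (Q u <-> Q s) -> (Q' u <-> Q' s)) -> Q' t -> Q' t'.
  split; first by apply: h.
  move=> Qt'; apply: contrapT => nQt; apply: (h (fun u => ~ Q u)) => //.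
    exact: Df_not.
  by move=> u s us; split=> n /us.
move=> DQ' QQ' Qt; apply: contrapT => nQt'.
have DQ1' := fun I s => @Df_app1 M D I Q' s DQ'.
have [|||e [eL eU]] := @ol_finf _ _ _ o (fun u => ~ lt u t /\ ~ lt t' u /\ ~ Q' u).
- by dfs.
- by exists t'; split; [move=> /(ol_trans o tt'); apply: (ol_irr o)|split=> //; apply: (ol_irr o)].
- by exists t => u [].
have te : ~ lt e t.
  by move=> /eU[u [[nut _] ut]].
have et' : ~ lt t' e.
  by apply: eL; split; [move=> /(ol_trans o tt'); apply: (ol_irr o)|split=> //; apply: (ol_irr o)].
have [a [b [ae eb hab]]] := loc e te et'.
have [u [[nut [nt'u nQu]] ub]] := eU b eb.
have eu : ~ lt u e by apply: eL.
have au : lt a u by case: (ol_total o e u) => [?|<-//|//]; apply: (ol_trans o) ae _.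
have QE v : lt a v -> lt v b -> ~ lt v t -> ~ lt t' v -> (Q' v <-> Q' e).
  by move=> *; apply: QQ'; apply: hab.
have nQe : ~ Q' e by move=> Qe; apply: nQu; apply/QE.
case: (ol_total o t e) => [lte|tE|//]; last by apply: nQe; rewrite -tE.
have [v [av tv ve]] := pick2L o ae lte.
apply: (eL v) => //; split; first by move=> /(ol_trans o tv); apply: (ol_irr o).
have nt'v : ~ lt t' v by move=> t'v; apply: et'; apply: (ol_trans o) t'v ve.
split=> // /QE h; apply: nQe; apply: h => //; first exact: (ol_trans o) ve eb.
by move=> /(ol_trans o tv); apply: (ol_irr o).
Qed.

Lemma fin_pred_max (X : M -> Prop) : fin_pred X -> (exists t, X t) ->
  exists m, X m /\ forall s, X s -> ~ lt m s.
Proof.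
case=> s; elim: s X => [|x s IHs] X sX [t Xt]; first by have := sX t Xt.
have [[u [Xu us]]|no] := pselect (exists u, X u /\ u \in s); last first.
  exists t; split=> // v Xv; have := sX v Xv; rewrite inE => /orP[/eqP->|vs].
    have := sX t Xt; rewrite inE => /orP[/eqP->|ts]; first exact: (ol_irr o).
    by case: no; exists t.
  by case: no; exists v.
have [||m [[Xm ms] mU]] := IHs (fun v => X v /\ v \in s).
- by move=> v [].
- by exists u.
have [[Xx mx]|nx] := pselect (X x /\ lt m x).
  exists x; split=> // v Xv; have := sX v Xv; rewrite inE => /orP[/eqP->|vs].
    exact: (ol_irr o).
  by move=> xv; apply: (mU v) => //; apply: (ol_trans o) mx xv.
exists m; split=> // v Xv mv; have := sX v Xv; rewrite inE => /orP[/eqP vx|vs].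
  by apply: nx; rewrite -vx.
exact: (mU v).
Qed.

End IntervalConnectedness.

(** * Graphs and bands over a base *)

Section GraphsAndBands.
Context {d : Order.disp_t} {M : orderType d} (D : ominsys M).
Local Notation lt := (fun x y : M => (x < y)%O).
Local Notation gt := (fun x y : M => (y < x)%O).

Lemma cont_on_cons n (B : ('I_n -> M) -> Prop) f x P : cont_on B f -> B x ->
  near (cons (f x) x) P -> near x (fun y => B y -> P (cons (f y) y)).
Proof.
move=> cf Bx /near_cons_inv[u [v [ux xv hn]]].
apply: near_imp (near_and hn (cf x Bx u v ux xv)) => y [h1 h2] By.
by have [? ?] := h2 By; apply: h1.
Qed.

(** Connectedness transfers along the continuous map from [y] to [cons (f y) y]. The graph is thin
    in its first coordinate, whether the base is open or thin. *)
Lemma graph_piece n (B : ('I_n -> M) -> Prop) f : piece D B -> cont_on B f -> Dfun D f ->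
  piece D (fun x => B (tl x) /\ x ord0 = f (tl x)).
Proof.
case=> DB cB _ cf Df_f; have consE (x : 'I_n.+1 -> M) : x ord0 = f (tl x) -> x = cons (f (tl x)) (tl x).
  by move=> <-; rewrite cons_tl.
split.
- by apply/Df1P; dfs.
- move=> P DP loc x y [Bx xE] [By yE]; rewrite (consE x xE) (consE y yE).
  apply: (cB (fun z => P (cons (f z) z))) => //.
    by apply/Df1P; dfs.
  move=> z Bz; have := loc (cons (f z) z); rewrite cons0 tl_cons => /(_ (conj Bz erefl)).
  move=> /(cont_on_cons cf Bz); apply: near_imp => w hw Bw.
  by apply: hw => //; rewrite cons0 tl_cons.
right; exists ord0 => x [Bx xE] a b; rewrite xE => ax xb.
have [c [e [cex h]]] := cf (tl x) Bx a b ax xb.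
have [_ [z [_ fz]]] := os_noend D (f (tl x)).
exists (cons a c), (cons z e); split.
  by rewrite -(cons_tl x) xE box_cons !cons0 !tl_cons.
move=> y [By ->] hy; apply: h => // k.
have := hy (lift ord0 k); rewrite /cons liftK; apply.
by move=> /eqP; rewrite eq_sym (negPf (neq_lift _ _)).
Qed.

(** The points of the fibres form a definable function, whose domain is cut into pieces on which it
    is continuous. *)
Lemma fu_graph n (X : ('I_n.+1 -> M) -> Prop) : cont_decomposable D n -> Df1 D X ->
  (forall t t' y, X (cons t y) -> X (cons t' y) -> t = t') -> fu (@piece _ _ D n.+1) X.
Proof.
move=> Cn DX uX.
have [||f Df_f hf] := definable_choice (D := D) (F := fun y t => X (cons t y)).
- by apply/Df2P; dfs.
- by move=> y t t'; apply: uX.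
have DB : Df1 D (fun y => exists t, X (cons t y)) by apply/Df1P; dfs.
have fu' := fu_sub (Cn _ f DB Df_f).
apply: (@fu_ext _ _ (fun x => x ord0 = f (tl x) /\ exists t, X (cons t (tl x)))).
  move=> x; split=> [[xE [t Xt]]|Xx].
    by rewrite -(cons_tl x) xE (hf _ _ Xt).
  by split; [rewrite (hf _ (x ord0)) // cons_tl|exists (x ord0); rewrite cons_tl].
apply: (fu_preim fu') => B [[pB cB] _].
by apply: (piece_ext _ (graph_piece pB cB Df_f)) => x; split=> -[].
Qed.

(** Semicontinuity of the [r]-lower end of the fibres, phrased without the end itself so that fibres
    unbounded on that side are covered. *)
Definition below (r : M -> M -> Prop) n (X : ('I_n.+1 -> M) -> Prop) (B : ('I_n -> M) -> Prop) :=
  forall y t, B y -> X (cons t y) -> exists2 c, r c t &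
    near y (fun z => B z -> exists2 t1, X (cons t1 z) & r t1 c).

(** Where the fibres are bounded on the [r]-lower side, their infimum is a definable function, and
    pieces on which it is continuous are suitable. Where they are unbounded, any point [r]-below [t]
    serves. *)
Lemma fu_below r n (X : ('I_n.+1 -> M) -> Prop) (B : ('I_n -> M) -> Prop) :
  r = lt \/ r = gt -> olin D r ->
  cont_decomposable D n -> Df1 D X -> Df1 D B ->
  (forall y, B y -> exists t, X (cons t y)) ->
  (forall y t, X (cons t y) -> exists2 t', X (cons t' y) & r t' t) ->
  fu (fun C => piece D C /\ below r X C) B.
Proof.
move=> r_lt o Cn DX DB BX open.
have Dr := Df_rel (lt := r) (ol_def o).
pose bdd y := exists p, forall t, X (cons t y) -> ~ r t p.
have Dbdd : Df1 D bdd by apply/Df1P; rewrite /bdd; dfs.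
pose F y v := (forall t, X (cons t y) -> ~ r t v) /\
  (forall u, r v u -> exists t, X (cons t y) /\ r t u).
have DF : Df2 D F by apply/Df2P; rewrite /F; dfs.
have [|f Df_f hf] := definable_choice DF.
  move=> y u v [u1 u2] [v1 v2]; case: (ol_total o u v) => [uv|//|vu].
    by have [t [Xt tv]] := u2 v uv; case: (v1 t).
  by have [t [Xt tu]] := v2 u vu; case: (u1 t).
apply: (fu_split (Q := bdd)).
  have DBb : Df1 D (fun y => B y /\ bdd y).
    by move=> I x Dx; apply: Df_and; [apply: DB|apply: Dbdd].
  apply: fu_mono (fu_sub (Cn _ f DBb Df_f)) => C [[pC cC] sub]; split=> //.
  have fF y : C y -> F y (f y).
    move=> /sub[/BX[t Xt] [p hp]].
    have [|||v [v1 v2]] := @ol_finf _ _ _ o (fun t => X (cons t y)).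
    + by dfs.
    + by exists t.
    + by exists p.
    by rewrite (hf y v).
  move=> y t Cy Xt; have [f1 f2] := fF y Cy.
  have fyt : r (f y) t.
    have [t' Xt' t't] := open y t Xt.
    case: (ol_total o (f y) t') => [ft|->//|/(f1 _ Xt')//].
    exact: (ol_trans o ft).
  have [c [fc ct]] := ol_dense o fyt; exists c => //.
  have nr : near y (fun z => C z -> r (f z) c).
    have [g1 [g2 [g1f fg2]]] := os_noend D (f y).
    case: r_lt fc => -> fc.
      by apply: near_imp (cC y Cy g1 c g1f fc) => z hz /hz[].
    by apply: near_imp (cC y Cy c g2 fc fg2) => z hz /hz[].
  apply: near_imp nr => z hz Cz; have [_ h2] := fF z Cz.
  by have [t1 [Xt1 t1c]] := h2 c (hz Cz); exists t1.
have DBb : Df1 D (fun y => B y /\ ~ bdd y).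
  by move=> I x Dx; apply: Df_and; [apply: DB|apply: Df_not; apply: Dbdd].
apply: fu_mono (fu_sub (Cn _ f DBb Df_f)) => C [[pC cC] sub]; split=> //.
move=> y t Cy Xt; have [c ct] := ol_down o t; exists c => //.
apply: (near_all D) => z /sub[_ nb]; apply: contrapT => h; apply: nb; exists c => u Xu uc.
by apply: h; exists u.
Qed.

(** The fibres are intervals with semicontinuous ends, so each point has, relative to the base, a
    product neighbourhood inside the band ([op]). A locally constant predicate is constant along
    fibres, hence descends to the base, where connectedness of [B] applies. *)
Lemma band_piece n (X : ('I_n.+1 -> M) -> Prop) (B : ('I_n -> M) -> Prop) :
  Df1 D X -> piece D B -> below lt X B -> below gt X B ->
  (forall y, B y -> exists t, X (cons t y)) ->
  (forall y t t' s, X (cons t y) -> X (cons t' y) -> (t < s)%O -> (s < t')%O -> X (cons s y)) ->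
  piece D (fun x => B (tl x) /\ X x).
Proof.
move=> DX [DB cB oB] lX uX BX cvx; have o := olin_lt D.
have op y t : B y -> X (cons t y) -> exists c e, [/\ (c < t)%O, (t < e)%O &
    near y (fun z => B z -> forall s, (c < s)%O -> (s < e)%O -> X (cons s z))].
  move=> By Xt; have [c ct hc] := lX y t By Xt; have [e te he] := uX y t By Xt.
  exists c, e; split=> //; apply: near_imp (near_and hc he) => z [h1 h2] Bz s cs se.
  have [t1 X1 t1c] := h1 Bz; have [t2 X2 t2e] := h2 Bz.
  by apply: (cvx z t1 t2) => //; [apply: lt_trans cs|apply: lt_trans t2e].
have DX' y : forall I t, Dt D t -> D I (fun e => X (cons (t e) y)) by dfs.
split.
- by move=> I x Dx; apply: Df_and; [apply: DB => j; apply: Dx|apply: DX].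
- move=> P DP loc.
  have fib y t t' : B y -> X (cons t y) -> X (cons t' y) -> (P (cons t y) <-> P (cons t' y)).
    move=> By.
    wlog tt' : t t' / (t < t')%O.
      move=> wl Xt Xt'; case: (ltgtP t t') => [h|h|->] //; first exact: wl.
      by apply: iff_sym; apply: wl.
    move=> Xt Xt'; apply: (@interval_connected _ _ _ o (fun t => P (cons t y)) t t') => //.
      by dfs.
    move=> s st t's.
    have Xs : X (cons s y).
      case: (ltgtP t s) st => [ts|//|<-//] _; case: (ltgtP s t') t's => [st'|//|->//] _.
      exact: (cvx y t t').
    have [|u [v [us sv /near_pt h]]] := near_cons_inv (loc (cons s y) _).
      by rewrite tl_cons.
    exists u, v; split=> // w uw wv wt t'w; apply: h => //; rewrite tl_cons; split=> //.
    case: (ltgtP t w) wt => [tw|//|<-//] _; case: (ltgtP w t') t'w => [wt'|//|->//] _.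
    exact: (cvx y t t').
  move=> x y [Bx Xx] [By Xy].
  have key := cB (fun z => exists t, X (cons t z) /\ P (cons t z)).
  have PE z : B (tl z) -> X z -> P z <-> exists t, X (cons t (tl z)) /\ P (cons t (tl z)).
    move=> Bz Xz; split=> [Pz|[t [Xt Pt]]].
      by exists (z ord0); rewrite cons_tl.
    by rewrite -(cons_tl z); apply/(fib _ t) => //; rewrite cons_tl.
  rewrite PE // (PE y) //; apply: key => //; first by apply/Df1P; dfs.
  move=> z Bz; have [t Xt] := BX z Bz; have [c [e [ct te hn]]] := op z t Bz Xt.
  have [|u [v [ut tv hl]]] := near_cons_inv (loc (cons t z) _); first by rewrite tl_cons.
  apply: near_imp (near_and hn hl) => w [h1 h2] Bw.
  have Xw : X (cons t w) by apply: h1.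
  have := h2 t ut tv; rewrite tl_cons => /(_ (conj Bw Xw)).
  have := PE (cons t w); rewrite tl_cons => <- //.
  by have := PE (cons t z); rewrite tl_cons => <- //.
case: oB => [oB|[j hj]]; [left|right].
  move=> x [Bx Xx]; have [|c [e [cx xe hn]]] := op (tl x) (x ord0) Bx; first by rewrite cons_tl.
  apply: (near_cons cx xe (near_and (oB _ Bx) hn)) => t y ct te [By hy].
  by rewrite tl_cons; split=> //; apply: hy.
exists (lift ord0 j) => x [Bx Xx] a b ax xb.
have [c [e [cex h]]] := hj (tl x) Bx a b ax xb.
have [c0 [e0 [cx0 xe0]]] := os_noend D (x ord0).
exists (cons c0 c), (cons e0 e); split.
  by rewrite -(cons_tl x) box_cons !cons0 !tl_cons.
move=> y [By _] hy; apply: (h (tl y)) => // k kj.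
have := hy (lift ord0 k); rewrite /cons liftK; apply.
by move=> /lift_inj.
Qed.

Lemma fu_band n (X : ('I_n.+1 -> M) -> Prop) : cont_decomposable D n -> Df1 D X ->
  (forall y t, X (cons t y) -> exists c e, [/\ (c < t)%O, (t < e)%O &
     forall s, (c < s)%O -> (s < e)%O -> X (cons s y)]) ->
  (forall y t t' s, X (cons t y) -> X (cons t' y) -> (t < s)%O -> (s < t')%O -> X (cons s y)) ->
  fu (@piece _ _ D n.+1) X.
Proof.
move=> Cn DX oX cvx; have o := olin_lt D.
pose B y := exists t, X (cons t y).
have DB : Df1 D B by apply/Df1P; rewrite /B; dfs.
apply: (@fu_ext _ _ (fun x => X x /\ B (tl x))).
  by move=> x; split=> [[]//|Xx]; split=> //; exists (x ord0); rewrite cons_tl.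
have fu1 : fu (fun C => piece D C /\ below lt X C) B.
  apply: fu_below => //; first by left.
  move=> y t /oX[c [e [ct te h]]]; have [s [cs st]] := os_dense D ct.
  by exists s => //; apply: h => //; apply: lt_trans te.
(* The pieces found for the lower ends are cut again for the upper ends. *)
have fu2 : fu (fun C => [/\ piece D C, below lt X C, below gt X C & forall y, C y -> B y]) B.
  apply: fu_bind (fu_sub fu1) _ => C [[pC bC] sub].
  have : fu (fun C => piece D C /\ below gt X C) C.
    apply: fu_below => //; [by right|exact: olin_conv|by case: pC|].
    move=> y t /oX[c [e [ct te h]]]; have [s [ts se]] := os_dense D te.
    by exists s => //; apply: h => //; apply: lt_trans ts.
  move=> /fu_sub; apply: fu_mono => C' [[pC' bC'] sub']; split=> //.
    move=> y t C'y Xt; have [c ct hc] := bC y t (sub' _ C'y) Xt; exists c => //.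
    by apply: near_imp hc => z hz /sub'.
  by move=> y /sub' /sub.
apply: (fu_preim fu2) => C [pC lC uC sub].
by apply: (piece_ext _ (band_piece DX pC lC uC sub cvx)) => x; split=> -[].
Qed.

End GraphsAndBands.

(** At most [m] elements, stated by an enumeration that may repeat or overshoot. As it quantifies
    over a tuple, the condition is first order. *)
Definition cle (T : Type) m (A : T -> Prop) :=
  exists v : 'I_m -> T, forall t, A t -> exists i, v i = t.

Section Cardinality.
Variable T : eqType.
Implicit Types A B : T -> Prop.

Lemma cle_sub m A B : (forall t, A t -> B t) -> cle m B -> cle m A.
Proof. by move=> AB [v hv]; exists v => t /AB /hv. Qed.

Lemma cle0 A t : cle 0 A -> ~ A t.
Proof. by case=> v hv /hv[[]]. Qed.

Lemma cle_del m A B s : (forall t, A t -> B t) -> B s -> ~ A s -> cle m.+1 B -> cle m A.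
Proof.
move=> AB Bs nAs [v hv]; have [i0 vi0] := hv s Bs.
exists (fun k => v (lift i0 k)) => t At; have [i vi] := hv t (AB t At).
have [k|/eqP] := unliftP i0 i; first by move=> iE; exists k; rewrite -iE.
by move=> /eqP iE; case: nAs; rewrite -vi0 -iE vi.
Qed.

Lemma cle_add m A B s : (forall t, B t -> A t \/ t = s) -> cle m A -> cle m.+1 B.
Proof.
move=> BA [v hv]; exists (cons s v) => t /BA[/hv[i vi]|->].
  by exists (lift ord0 i); rewrite /cons liftK.
by exists ord0; rewrite cons0.
Qed.

Lemma cle_fin A : fin_pred A -> exists m, cle m A.
Proof.
case=> s; elim: s A => [|x s IHs] A hA.
  have v0 : 'I_0 -> T by case.
  by exists 0, v0 => t /hA.
have [|m hm] := IHs (fun t => A t /\ t \in s); first by move=> t [].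
exists m.+1; apply: (@cle_add _ _ _ x) hm => t At.
by have := hA t At; rewrite inE => /orP[/eqP ->|ts]; [right|left].
Qed.

Lemma cle_le m k A : inhabited T -> m <= k -> cle m A -> cle k A.
Proof.
case=> x0 mk cA; rewrite -(subnK mk); elim: (k - m) => [//|l IHl].
by rewrite addSn; apply: (@cle_add _ _ _ x0) IHl; left.
Qed.

End Cardinality.

(** * Decomposition from dimension n to n + 1 *)

Section Cells.
Context {d : Order.disp_t} {M : orderType d} (D : ominsys M).
Local Notation lt := (fun x y : M => (x < y)%O).
Local Notation gt := (fun x y : M => (y < x)%O).

Definition uniformly_finite n := forall Y : ('I_n -> M) -> M -> Prop, Df2 D Y ->
  (forall x, fin_pred (Y x)) -> exists N, forall x, cle N (Y x).

Section Layers.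
Variables (n : nat) (X : ('I_n.+1 -> M) -> Prop).
Hypotheses (Cn : cont_decomposable D n) (DX : Df1 D X).

Definition boundary y t := forall c e, (c < t)%O -> (t < e)%O ->
  (exists s, ((c < s)%O /\ (s < e)%O) /\ X (cons s y)) /\
  (exists s, ((c < s)%O /\ (s < e)%O) /\ ~ X (cons s y)).

Lemma not_boundary y t : ~ boundary y t -> exists c e, [/\ (c < t)%O, (t < e)%O &
  forall s, (c < s)%O -> (s < e)%O -> (X (cons s y) <-> X (cons t y))].
Proof.
move=> /existsNP[c /existsNP[e /not_implyP[ct /not_implyP[te h]]]]; exists c, e; split=> // s cs se.
by split=> h1; apply: contrapT => h2; apply: h; split; [exists s|exists t|exists t|exists s].
Qed.

(** An infinite boundary would contain an interval, but just after its left end membership in the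
    fibre is decided. *)
Lemma boundary_fin y : fin_pred (boundary y).
Proof.
have o := olin_lt D; apply: contrapT.
move=> /(ol_inf o) [|p [q [pq h]]]; first by rewrite /boundary; dfs.
have DXy : D unit (fun e => X (cons (e tt) y)) by dfs.
have := @rgerm_dec _ _ _ o p (fun t => X (cons t y)) DXy.
case=> -[r pr hr]; have [t [tr tq pt]] := pick2R o pr pq; have [h1 h2] := h t pt tq p r pt tr.
  by have [s [[ps sr]]] := h2; apply; apply: hr.
by have [s [[ps sr]]] := h1; apply: hr.
Qed.

Lemma Df_boundary : Df2 D boundary.
Proof. by apply/Df2P; rewrite /boundary; dfs. Qed.

(** Within a fibre, [Q] depends only on which boundary points lie strictly below, and between two
    points of [Q] only the upper one can be a boundary point. So the boundary points of a layer form
    a graph, and its other points a band. *)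
Lemma fu_layer (Q : ('I_n.+1 -> M) -> Prop) : Df1 D Q ->
  (forall y t t' s, Q (cons t y) -> Q (cons t' y) -> (t <= s)%O -> (s < t')%O ->
    boundary y s -> False) ->
  (forall y t s, (forall u, boundary y u -> (u < t)%O <-> (u < s)%O) ->
    Q (cons t y) -> Q (cons s y)) ->
  fu (@piece _ _ D n.+1) (fun x => X x /\ Q x).
Proof.
move=> DQ Qkey Qext; have Dbd := Df_boundary; have o := olin_lt D.
have DXQ (P : ('I_n.+1 -> M) -> Prop) : Df1 D P -> Df1 D (fun x => (X x /\ Q x) /\ P x).
  move=> DP I x Dx; apply: Df_and; last exact: DP.
  by apply: Df_and; [apply: DX|apply: DQ].
have Dbd1 : Df1 D (fun x => boundary (tl x) (x ord0)) by move=> I x Dx; apply: Dbd => // j; apply: Dx.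
apply: (fu_split (Q := fun x => boundary (tl x) (x ord0))).
  apply: fu_graph => //; first exact: DXQ.
  move=> t t' y [[_ Qt]]; rewrite !tl_cons !cons0 => bt [[_ Qt'] bt'].
  case: (ltgtP t t') => // tt'.
    by case: (Qkey y t t' t).
  by case: (Qkey y t' t t').
apply: fu_band => //.
- by apply: DXQ => I x Dx; apply: Df_not; apply: Dbd1.
- move=> y t [[Xt Qt]]; rewrite tl_cons cons0 => nbt.
  have [c [e [ct te h]]] := not_boundary nbt; exists c, e; split=> // s cs se.
  have nb u : (c < u)%O -> (u < e)%O -> ~ boundary y u.
    move=> cu ue /(_ c e cu ue)[_ [v [[cv ve] nXv]]].
    by apply: nXv; apply/h.
  rewrite tl_cons cons0; split; last exact: nb.
  split; first exact/h.
  apply: Qext Qt => u bu; split=> h1; rewrite ltNge; apply/negP => h2.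
    by apply: (nb u) => //; [apply: lt_le_trans h2|apply: lt_trans te].
  by apply: (nb u) => //; [apply: lt_le_trans h2|apply: lt_trans se].
move=> y t t' s [[Xt Qt]]; rewrite !tl_cons !cons0 => nbt [[Xt' Qt'] nbt'] ts st'.
have nb u : (t <= u)%O -> (u <= t')%O -> ~ boundary y u.
  move=> tu; rewrite le_eqVlt => /orP[/eqP->//|ut'] bu.
  exact: (Qkey y t t' u).
have Xs : X (cons s y).
  apply/(@interval_connected _ _ _ o (fun t => X (cons t y)) t s _ ts) => //; first by dfs.
  move=> u /negP; rewrite -leNgt => tu /negP; rewrite -leNgt => us.
  have [|c [e [cu ue h]]] := @not_boundary y u.
    by apply: nb => //; apply: le_trans us (ltW st').
  by exists c, e; split=> // v cv ve _ _; apply: h.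
split; last by apply: nb; apply: ltW.
split=> //; apply: Qext Qt => u bu; split=> h1; first exact: lt_trans ts.
rewrite ltNge; apply/negP => h2.
by apply: (nb u) => //; apply: ltW; apply: lt_trans st'.
Qed.

(** Layers are indexed by the number of boundary points strictly below a point; exactly [i.+1] of
    them is the difference of two consecutive conditions [cle]. *)
Lemma fu_few_boundary i : fu (@piece _ _ D n.+1)
  (fun x => X x /\ cle i (fun s => boundary (tl x) s /\ (s < x ord0)%O)).
Proof.
have Dbd := Df_boundary.
have Dcle i' : Df1 D (fun x : 'I_n.+1 -> M => cle i' (fun s => boundary (tl x) s /\ (s < x ord0)%O)).
  by apply/Df1P; rewrite /cle; dfs.
have ext i' y t s : (forall u, boundary y u -> (u < t)%O <-> (u < s)%O) ->
    cle i' (fun u => boundary (tl (cons t y)) u /\ (u < cons t y ord0)%O) ->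
    cle i' (fun u => boundary (tl (cons s y)) u /\ (u < cons s y ord0)%O).
  move=> h; rewrite !tl_cons !cons0; apply: cle_sub => u [bu us]; split=> //; exact/h.
elim: i => [|i IHi].
  apply: fu_layer => //; last by move=> y t s; apply: ext.
  by move=> y t t' s _; rewrite tl_cons cons0 => /(@cle0 _ _ s) h _ st' bs; apply: h.
apply: (fu_split (Q := fun x => cle i (fun s => boundary (tl x) s /\ (s < x ord0)%O))).
  apply: (fu_ext _ IHi) => x; split=> [[Xx h]|[[Xx _] h]] //; split=> //; split=> //.
  by apply: (cle_le _ (leqnSn i)) h; constructor; exact: os_pt D.
apply: (@fu_ext _ _ (fun x => X x /\ (cle i.+1 (fun s => boundary (tl x) s /\ (s < x ord0)%O) /\
   ~ cle i (fun s => boundary (tl x) s /\ (s < x ord0)%O)))).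
  by move=> x; split=> [[? [? ?]]|[[? ?] ?]].
apply: fu_layer.
- by move=> I x Dx; apply: Df_and; [|apply: Df_not]; apply: Dcle.
- move=> y t t' s; rewrite !tl_cons !cons0 => -[_ nt] [ht' _] ts st' bs; apply: nt.
  apply: (cle_del (s := s)) ht' => //; last by case=> _; rewrite ltNge ts.
  by move=> u [bu ut]; split=> //; apply: lt_trans ut (le_lt_trans ts st').
- move=> y t s h [h1 h2]; split; first exact: ext h1.
  by move=> h3; apply: h2; apply: ext h3 => u bu; apply: iff_sym; apply: h.
Qed.

End Layers.

(** Uniform finiteness bounds the number of layers. *)
Lemma decomposableS n : cont_decomposable D n -> uniformly_finite n -> decomposable D n.+1.
Proof.
move=> Cn Un X DX.
have [N hN] := Un _ (Df_boundary DX) (boundary_fin DX).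
apply: (fu_ext _ (fu_few_boundary Cn DX N)) => x; split=> [[]//|Xx]; split=> //.
by apply: cle_sub (hN (tl x)) => s [].
Qed.

End Cells.

(** * Locally constant cardinality of finite fibres *)

Section UniformFiniteness.
Context {d : Order.disp_t} {M : orderType d} (D : ominsys M).
Local Notation lt := (fun x y : M => (x < y)%O).
Local Notation gt := (fun x y : M => (y < x)%O).
Variables (n : nat) (Y : ('I_n -> M) -> M -> Prop).
Hypotheses (DY : Df2 D Y) (finY : forall x, fin_pred (Y x)).
Let bg := baire_gencont D n.

Let sub_lt (a b a' b' : 'I_n -> M) : subbox a' b' a b -> forall j, (a' j < b' j)%O.
Proof. by move=> h j; have [] := h j. Qed.

Lemma box_open (a b x : 'I_n -> M) P : box a b x -> near x P ->
  exists a' b', subbox a' b' a b /\ forall y, box a' b' y -> P y.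
Proof.
move=> abx [c [e [cex hP]]].
exists (fun j => Order.max (a j) (c j)), (fun j => Order.min (b j) (e j)); split.
  move=> j; have [ax xb] := abx j; have [cx xe] := cex j.
  rewrite le_max lexx ge_min lexx; split=> //.
  by rewrite gt_max !lt_min (lt_trans ax xb) (lt_trans ax xe) (lt_trans cx xb) (lt_trans cx xe).
move=> y hy; apply: hP => j; have := hy j; rewrite gt_max lt_min.
by case=> /andP[_ ?] /andP[_ ?].
Qed.

Lemma near_contn r (g : ('I_n -> M) -> M) y c : r = lt \/ r = gt -> contn g y ->
  (r (g y) c -> near y (fun z => r (g z) c)) /\ (r c (g y) -> near y (fun z => r c (g z))).
Proof.
move=> hr cg; have [u [v [ug gv]]] := os_noend D (g y).
by case: hr => ->; split=> h;
  [have := cg u c ug h|have := cg c v h gv|have := cg c v h gv|have := cg u c ug h];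
  apply: near_imp => z [].
Qed.

Lemma generic_max r (A : ('I_n -> M) -> M -> Prop) (a b : 'I_n -> M) :
  olin D r -> Df2 D A -> (forall y, fin_pred (A y)) -> (forall j, (a j < b j)%O) ->
  (forall y, box a b y -> exists t, A y t) ->
  exists g a' b', subbox a' b' a b /\ forall y, box a' b' y ->
    [/\ contn g y, A y (g y) & forall s, A y s -> ~ r (g y) s].
Proof.
move=> o DA finA ab exA; have Dr := Df_rel (lt := r) (ol_def o).
have [||g Dg hg] := @definable_choice _ _ D _ (fun y t => A y t /\ forall s, A y s -> ~ r t s).
- by apply/Df2P; dfs.
- move=> y u v [Au hu] [Av hv]; case: (ol_total o u v) => // h.
    by case: (hu v).
  by case: (hv u).
have [a' [b' [sab cg]]] := bg.2 a b g ab Dg.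
exists g, a', b'; split=> // y hy.
have [m [Am hm]] := fin_pred_max o (finA y) (exA y (subbox_box sab hy)).
by rewrite (hg y m) //; split=> //; apply: cg.
Qed.

(** The [r]-largest element of a fibre is generically continuous; [m0] is added to the fibres to
    make them nonempty. *)
Lemma generic_bound r (a b : 'I_n -> M) : r = lt \/ r = gt -> olin D r ->
  (forall j, (a j < b j)%O) ->
  exists a' b', subbox a' b' a b /\ forall y, box a' b' y ->
    exists c, near y (fun z => forall s, Y z s -> r s c).
Proof.
move=> hr o ab; pose m0 := os_pt D.
have [|||g [a' [b' [sab h]]]] := @generic_max r (fun y t => t = m0 \/ Y y t) a b o _ _ ab.
- by apply/Df2P; dfs.
- move=> y; have [s hs] := finY y; exists (m0 :: s) => t [->|/hs ts]; rewrite inE ?eqxx //.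
  by rewrite ts orbT.
- by move=> y _; exists m0; left.
exists a', b'; split=> // y hy; have [cg _ _] := h y hy.
have [c gc] := ol_up o (g y); exists c.
apply: near_imp (near_and (near_box hy) ((near_contn c hr cg).1 gc)) => z [bz gz] s Ys.
have [_ _ hm] := h z bz; case: (ol_total o s c) => // [sc|cs].
  by case: (hm s); [right|rewrite sc].
by case: (hm s); [right|apply: (ol_trans o) gz cs].
Qed.

(** The part of the fibre [r]-below [f y], enlarged by a point [p] so as not to be empty, has
    generically a continuous [r]-largest element. A point between it and [f y] separates the two
    functions locally. *)
Lemma generic_gap r (a b : 'I_n -> M) f : r = lt \/ r = gt -> olin D r ->
  (forall j, (a j < b j)%O) -> Dfun D f ->
  exists a' b', subbox a' b' a b /\ forall y, box a' b' y ->
    exists c, r c (f y) /\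
      near y (fun z => r c (f z) /\ forall s, Y z s -> r c s -> ~ r s (f z)).
Proof.
move=> hr o ab Df_f; have Dr := Df_rel (lt := r) (ol_def o).
have [a1 [b1 [sab1 cf]]] := bg.2 a b f ab Df_f.
have [y1 by1] := box_ex D (sub_lt sab1).
have [p pf] := ol_down o (f y1).
have [a2 [b2 [sab2 hp]]] := box_open by1 ((near_contn p hr (cf y1 by1)).2 pf).
have [|||g [a3 [b3 [sab3 h]]]] :=
  @generic_max r (fun y t => (t = p \/ Y y t) /\ r t (f y)) a2 b2 o _ _ (sub_lt sab2).
- by apply/Df2P; dfs.
- move=> y; have [s hs] := finY y; exists (p :: s) => t [[->|/hs ts] _]; rewrite inE ?eqxx //.
  by rewrite ts orbT.
- by move=> y hy; exists p; split; [left|apply: hp].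
exists a3, b3; split; first exact: subbox_trans sab3 (subbox_trans sab2 sab1).
move=> y hy; have [cg [_ gf] _] := h y hy; have [c [gc cfy]] := ol_dense o gf.
exists c; split=> //; have cfy' := cf y (subbox_box sab2 (subbox_box sab3 hy)).
have n1 := (near_contn c hr cg).1 gc; have n2 := (near_contn c hr cfy').2 cfy.
apply: near_imp (near_and (near_box hy) (near_and n1 n2)) => z [bz [gz fz]]; split=> // s Ys cs sf.
have [_ _ hm] := h z bz; apply: (hm s); first by split; [right|].
exact: (ol_trans o) gz cs.
Qed.

Definition locally_single y a b := near y (fun z =>
  (exists s, ((a < s)%O /\ (s < b)%O) /\ Y z s) /\
  forall s s', ((a < s)%O /\ (s < b)%O) /\ Y z s -> ((a < s')%O /\ (s' < b)%O) /\ Y z s' -> s = s').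

Definition locally_none y a b := near y (fun z => forall s, (a < s)%O -> (s < b)%O -> ~ Y z s).

(** Near [(y, t)] the relation is the graph of a function continuous at [y] with value [t], or it is
    empty. The first case is written as existence and uniqueness in one interval together with
    existence in every interval around [t]. *)
Definition normal y t :=
  (Y y t /\ (exists a b, ((a < t)%O /\ (t < b)%O) /\ locally_single y a b) /\
   forall a b, (a < t)%O -> (t < b)%O -> near y (fun z => exists s, ((a < s)%O /\ (s < b)%O) /\ Y z s)) \/
  (~ Y y t /\ exists a b, ((a < t)%O /\ (t < b)%O) /\ locally_none y a b).

(** The uniform bounds near [y] keep points of nearby fibres from escaping to the ends of M, about
    which [normal] says nothing. *)
Definition good y := (exists p q, near y (fun z => forall s, Y z s -> (p < s)%O /\ (s < q)%O)) /\
  forall t, normal y t.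

Lemma Df_normal : Df2 D normal.
Proof.
by apply/Df2P; rewrite /normal /locally_single /locally_none; dfs.
Qed.

Lemma Df_good : Df1 D good.
Proof. by have Dn := Df_normal; apply/Df1P; rewrite /good; dfs. Qed.

(** In the graph case, a point [u] other than [t] in the isolating interval is separated by some [m]
    from the single element of the nearby fibres, so it is of the empty kind. *)
Lemma normal_open y t : normal y t -> exists a b, [/\ (a < t)%O, (t < b)%O &
  forall u, (a < u)%O -> (u < b)%O -> normal y u].
Proof.
case=> [[Yt [[a [b [[at_ tb] hs]]] hl]]|[nYt [a [b [[at_ tb] hn]]]]]; exists a, b; split=> // u au ub.
  case: (ltgtP u t) => [ut|tu|->]; last by left; split=> //; split=> //; exists a, b.
    right; split.
      move=> Yu; have [_ /(_ u t)] := near_pt hs; rewrite au ub at_ tb => /(_ (conj (conj erefl erefl) Yu)).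
      by move=> /(_ (conj (conj erefl erefl) Yt)) E; move: ut; rewrite E ltxx.
    have [m [um mt]] := os_dense D ut.
    exists a, m; split=> //; apply: near_imp (near_and hs (hl m b mt tb)) => z [[_ uz] [s [[ms sb] Ys]]] w aw wm Yw.
    have E : w = s.
      apply: uz; split=> //; split=> //; first exact: lt_trans wm (lt_trans mt tb).
      exact: lt_trans (lt_trans aw wm) ms.
    by move: (lt_trans wm ms); rewrite E ltxx.
  right; split.
    move=> Yu; have [_ /(_ u t)] := near_pt hs; rewrite au ub at_ tb => /(_ (conj (conj erefl erefl) Yu)).
    by move=> /(_ (conj (conj erefl erefl) Yt)) E; move: tu; rewrite E ltxx.
  have [m [tm mu]] := os_dense D tu.
  exists m, b; split=> //; apply: near_imp (near_and hs (hl a m at_ tm)) => z [[_ uz] [s [[as_ sm] Ys]]] w mw wb Yw.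
  have E : w = s.
    apply: uz; split=> //; split=> //; first exact: lt_trans at_ (lt_trans tm mw).
    exact: lt_trans sm (lt_trans mu ub).
  by move: (lt_trans sm mw); rewrite E ltxx.
right; split; last by exists a, b.
exact: (near_pt hn).
Qed.

(** Otherwise the least abnormal point of the fibre is a definable function [f]. Generically it is
    continuous, separated on both sides from the other elements of [Y], and always or never in [Y];
    in both cases [(y, f y)] is normal after all. *)
Lemma good_dense (a b : 'I_n -> M) : (forall j, (a j < b j)%O) -> exists2 y, box a b y & good y.
Proof.
move=> ab; have o := olin_lt D; have oc := olin_conv o.
have [a1 [b1 [sab1 hq]]] := generic_bound (or_introl erefl) o ab.
have [a2 [b2 [sab2 hp]]] := generic_bound (or_intror erefl) oc (sub_lt sab1).
have bdd y : box a2 b2 y -> exists p q, near y (fun z => forall s, Y z s -> (p < s)%O /\ (s < q)%O).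
  move=> by_; have [q nq] := hq y (subbox_box sab2 by_); have [p np] := hp y by_.
  exists p, q; apply: near_imp (near_and np nq) => z [h1 h2] s Ys.
  by split; [apply: h1|apply: h2].
apply: contrapT => nogood.
have ex_abn y : box a2 b2 y -> exists t, ~ normal y t.
  move=> by_; apply/existsNP => hn; apply: nogood; exists y; last by split; [apply: bdd|].
  exact: subbox_box sab1 (subbox_box sab2 by_).
have Dn := Df_normal.
have [||f Df_f hf] := @definable_choice _ _ D _ (fun y t => ~ normal y t /\ forall s, ~ normal y s -> ~ (s < t)%O).
- by apply/Df2P; dfs.
- move=> y u v [nu hu] [nv hv]; case: (ltgtP u v) => // h.
    by case: (hv u).
  by case: (hu v).
(* The infimum of the abnormal points exists because every point below the uniform bound [p] is
   normal, and it is abnormal because normality is an open condition. *)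
have fE y : box a2 b2 y -> ~ normal y (f y) /\ forall s, ~ normal y s -> ~ (s < f y)%O.
  move=> by_; have [p [q npq]] := bdd y by_.
  have [|||v [v1 v2]] := @ol_finf _ _ _ o (fun t => ~ normal y t); first by dfs.
  - exact: ex_abn.
  - exists p => t nt tp; apply: nt; have [u [_ [ut _]]] := os_noend D t; right; split.
      by move=> /(near_pt npq)[pt _]; move: (lt_trans tp pt); rewrite ltxx.
    exists u, p; split=> //; apply: near_imp npq => z hz s us sp /hz[ps _].
    by move: (lt_trans sp ps); rewrite ltxx.
  have nv : ~ normal y v.
    move=> /normal_open[c [e [cv ve h]]]; have [u [nu ue]] := v2 e ve.
    apply: (nu); apply: h ue; case: (ltgtP c u) => // [uc|cu].
      by case: (v1 u nu); apply: lt_trans cv.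
    by case: (v1 u nu); rewrite -cu.
  by rewrite (hf y v).
have [a3 [b3 [sab3 gapL]]] := generic_gap (or_introl erefl) o (sub_lt sab2) Df_f.
have [a4 [b4 [sab4 gapR]]] := generic_gap (or_intror erefl) oc (sub_lt sab3) Df_f.
have [a5 [b5 [sab5 cf]]] := bg.2 a4 b4 f (sub_lt sab4) Df_f.
have [|a6 [b6 [sab6 hY]]] := bg.1 a5 b5 (fun y => Y y (f y)) (sub_lt sab5).
  by apply/Df1P; dfs.
have [y by6] := box_ex D (sub_lt sab6).
have by5 := subbox_box sab6 by6; have by4 := subbox_box sab5 by5.
have by3 := subbox_box sab4 by4; have by2 := subbox_box sab3 by3.
have [c [cf1 nL]] := gapL y by3; have [e [fe1 nR]] := gapR y by4.
have sep z s : (c < f z)%O /\ (forall s, Y z s -> (c < s)%O -> ~ (s < f z)%O) ->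
    (f z < e)%O /\ (forall s, Y z s -> (s < e)%O -> ~ (f z < s)%O) ->
    (c < s)%O -> (s < e)%O -> Y z s -> s = f z.
  move=> [_ h1] [_ h2] cs se Ys; case: (ltgtP s (f z)) => // h.
    by case: (h1 s Ys cs).
  by case: (h2 s Ys se).
apply: (fE y by2).1; case: hY => hY; [left|right].
  split; first exact: hY.
  split; last first.
    move=> u v uf fv; apply: near_imp (near_and (near_box by6) (cf y by5 u v uf fv)) => z [bz fz].
    by exists (f z); split=> //; apply: hY.
  exists c, e; split=> //; apply: near_imp (near_and (near_box by6) (near_and nL nR)) => z [bz [hL hR]].
  split; first by exists (f z); split; [split; [case: hL|case: hR]|apply: hY].
  by move=> s s' [[cs se] Ys] [[cs' se'] Ys']; rewrite (sep z s) // (sep z s').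
split; first exact: hY.
exists c, e; split=> //; apply: near_imp (near_and (near_box by6) (near_and nL nR)) => z [bz [hL hR]].
by move=> s cs se Ys; apply: (hY z bz); rewrite -(sep z s).
Qed.

Lemma cle_ext m (A B : M -> Prop) : (forall t, A t <-> B t) -> cle m A <-> cle m B.
Proof. by move=> AB; split; apply: cle_sub => t /AB. Qed.

Lemma cleS m (A B : M -> Prop) s : (forall t, B t <-> A t \/ t = s) -> ~ A s ->
  (cle m.+1 B <-> cle m A).
Proof.
move=> BA nAs; split.
  by apply: (@cle_del _ _ _ _ s) => // [t At|]; apply/BA; [left|right].
by apply: (@cle_add _ _ _ _ s) => t /BA.
Qed.

(** Sweep [u] from left to right, comparing the number of points below [u] in the
    fibres over [y] and over nearby points. *)
Lemma good_locally_constant y m : good y -> near y (fun z => cle m (Y z) <-> cle m (Y y)).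
Proof.
have o := olin_lt D.
case=> -[p [q0 npq0]] nrm.
have [_ [q [_]]] := os_noend D (Order.max p q0); rewrite gt_max => /andP[pq q0q].
have npq : near y (fun z => forall s, Y z s -> (p < s)%O /\ (s < q)%O).
  by apply: near_imp npq0 => z hz s /hz[ps sq]; split=> //; apply: lt_trans q0q.
(* All counts up to [m] are compared together, since passing a point of [Y] relates the count [j.+1]
   to the count [j]. *)
pose K u := forall j : 'I_m.+1,
  near y (fun z => cle j (fun s => Y z s /\ (s < u)%O) <-> cle j (fun s => Y y s /\ (s < u)%O)).
have Kp : K p.
  move=> j; apply: near_imp (npq) => z hz; apply: cle_ext => s.
  split=> -[Ys sp].
    by have [ps _] := hz s Ys; move: (lt_trans sp ps); rewrite ltxx.
  by have [ps _] := near_pt npq _ Ys; move: (lt_trans sp ps); rewrite ltxx.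
suff Kall u : ~ Y y u -> (p <= u)%O -> (u <= q)%O -> K u.
  have Kq := Kall q _ (ltW pq) (lexx q) ord_max.
  apply: near_imp (near_and npq (Kq _)) => [z [hz]|]; last first.
    by move=> Yq; have [_] := near_pt npq _ Yq; rewrite ltxx.
  rewrite (@cle_ext _ (fun s => Y z s /\ (s < q)%O) (Y z)); last by move=> s; split=> [[]//|Ys]; split=> //; have [] := hz s Ys.
  rewrite (@cle_ext _ (fun s => Y y s /\ (s < q)%O) (Y y)) // => s; split=> [[]//|Ys]; split=> //.
  by have [] := near_pt npq _ Ys.
move=> nYu pu uq; apply: contrapT => nKu.
have [|||e [e1 e2]] := @ol_finf _ _ _ o (fun u => ~ Y y u /\ (p <= u)%O /\ (u <= q)%O /\ ~ K u).
- by rewrite /K /cle; dfs.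
- by exists u.
- by exists p => v [_ [pv _]]; rewrite ltNge pv.
have pe : (p <= e)%O.
  by rewrite leNgt; apply/negP => /e2[v [[_ [pv _]] vp]]; move: vp; rewrite ltNge pv.
have eq_ : (e <= q)%O.
  by rewrite leNgt; apply/negP => qe; apply: (e1 u) => //; apply: le_lt_trans qe.
have Kbelow v : ~ Y y v -> (p <= v)%O -> (v < e)%O -> K v.
  move=> nYv pv ve; apply: contrapT => nKv; apply: (e1 v) => //; split=> //; split=> //.
  by split=> //; apply: ltW (lt_le_trans ve eq_).
(* Around [e], the fibre over [y] and the nearby fibres all gain exactly one element between [w] and
   [v], or none of them gains any. *)
case: (nrm e) => [[Ye [[a [b [[ae eb] hs]]] hl]]|[nYe [a [b [[ae eb] hn]]]]].
  have lt_pe : (p < e)%O by have [] := near_pt npq _ Ye.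
  have [v [[nYv [pv [vq nKv]]] vb]] := e2 b eb.
  have ev : (e < v)%O.
    case: (ltgtP e v) => // [ve|ev]; last by case: nYv; rewrite -ev.
    by case: (e1 v).
  have [w [aw pw we]] := pick2L o ae lt_pe.
  have single z s s' : ((exists s, ((a < s)%O /\ (s < b)%O) /\ Y z s) /\
     forall s s', ((a < s)%O /\ (s < b)%O) /\ Y z s -> ((a < s')%O /\ (s' < b)%O) /\ Y z s' -> s = s') ->
    Y z s -> Y z s' -> (w <= s)%O -> (s < v)%O -> (w <= s')%O -> (s' < v)%O -> s = s'.
    move=> [_ h] Ys Ys' ws sv ws' s'v; apply: h; split=> //; split;
      by [apply: lt_le_trans aw _|apply: lt_trans vb].
  have add z s : ((exists s, ((a < s)%O /\ (s < b)%O) /\ Y z s) /\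
     forall s s', ((a < s)%O /\ (s < b)%O) /\ Y z s -> ((a < s')%O /\ (s' < b)%O) /\ Y z s' -> s = s') ->
    Y z s -> (w < s)%O -> (s < v)%O ->
    forall t, (Y z t /\ (t < v)%O) <-> (Y z t /\ (t < w)%O) \/ t = s.
    move=> hz Ys ws sv t; split=> [[Yt tv]|[[Yt tw]|->]] //.
      case: (ltP t w) => tw; [by left|right].
      exact: (single z t s hz Yt Ys tw tv (ltW ws) sv).
    by split=> //; apply: lt_trans tw (lt_trans we ev).
  have nYw : ~ Y y w.
    move=> Yw; have E := single y w e (near_pt hs) Yw Ye (lexx w) (lt_trans we ev) (ltW we) ev.
    by move: we; rewrite E ltxx.
  apply: nKv => -[[|j] hj] /=.
    apply: near_imp (hl w v we ev) => z [s [[ws sv] Ys]]; split=> h; exfalso.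
      by apply: (cle0 (t := s) h).
    by apply: (cle0 (t := e) h).
  have Kw := Kbelow w nYw (ltW pw) we (Ordinal (ltnW hj)).
  apply: near_imp (near_and Kw (near_and hs (hl w v we ev))) => z [hK [hz [s [[ws sv] Ys]]]].
  rewrite (cleS _ (add z s hz Ys ws sv)); last by case=> _ sw; move: (lt_trans ws sw); rewrite ltxx.
  rewrite (cleS _ (add y e (near_pt hs) Ye we ev)) //.
  by case=> _ ew; move: (lt_trans we ew); rewrite ltxx.
have [v [[nYv [pv [vq nKv]]] vb]] := e2 b eb.
have ev : (e <= v)%O by rewrite leNgt; apply/negP; apply: e1.
have [w [aw wv Kw]] : exists w, [/\ (a < w)%O, (w <= v)%O & K w].
  move: pe; rewrite le_eqVlt => /orP[/eqP pe|pe]; first by exists p; rewrite {1 2}pe.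
  have [w [aw pw we]] := pick2L o ae pe; exists w; split=> //; first exact: ltW (lt_le_trans we ev).
  apply: Kbelow => //; last exact: ltW.
  by apply: (near_pt hn) => //; apply: lt_trans eb.
apply: nKv => j; apply: near_imp (near_and (Kw j) hn) => z [hK hz].
have same z' : (forall s, (a < s)%O -> (s < b)%O -> ~ Y z' s) -> forall t,
    (Y z' t /\ (t < v)%O) <-> (Y z' t /\ (t < w)%O).
  move=> h t; split=> -[Yt tv]; split=> //; last exact: lt_le_trans wv.
  rewrite ltNge; apply/negP => wt; apply: (h t) => //; first exact: lt_le_trans wt.
  exact: lt_trans vb.
by rewrite (cle_ext _ (same z hz)) (cle_ext _ (same y (near_pt hn))).
Qed.

End UniformFiniteness.

(** * The simultaneous induction *)

Section CellDecomposition.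
Context {d : Order.disp_t} {M : orderType d} (D : ominsys M).

Lemma fu_bound (T : Type) (Y : T -> M -> Prop) Pc X : fu Pc X ->
  (forall C, Pc C -> exists N, forall x, C x -> cle N (Y x)) ->
  exists N, forall x, X x -> cle N (Y x).
Proof.
move=> fX hP; have iM : inhabited M by constructor; exact: os_pt D.
elim: fX => [|C /hP //|{}X X' _ [N hN] _ [N' hN']]; first by exists 0.
exists (maxn N N') => x [/hN|/hN']; apply: cle_le => //; [exact: leq_maxl|exact: leq_maxr].
Qed.

(** On a piece of good points the count is locally constant, hence constant. A nonempty piece of the
    other points contains no box by [good_dense], so it is thin, and a chart reduces it to the
    previous dimension. *)
Lemma uniform_finiteness n : decomposable D n ->
  (forall m, n = m.+1 -> uniformly_finite D m) -> uniformly_finite D n.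
Proof.
move=> Pn IH Y DY finY.
have Dg := Df_good DY.
have [|N hN] := fu_bound (Y := Y) (fu_sub (Pn _ Dg)).
  move=> C [[DC cC _] sub]; have [[x0 Cx0]|nC] := pselect (exists x, C x); last first.
    by exists 0 => x Cx; case: nC; exists x.
  have [m hm] := cle_fin (finY x0); exists m => x Cx.
  apply/(cC (fun x => cle m (Y x)) _ _ x x0 Cx Cx0) => //; first by apply/Df1P; rewrite /cle; dfs.
  move=> z Cz; have := good_locally_constant DY m (sub z Cz).
  by apply: near_imp.
have [||N' hN'] := fu_bound (Y := Y) (fu_sub (Pn (fun x => ~ good Y x) _)).
- by move=> I x Dx; apply: Df_not; apply: Dg.
- move=> C [[DC cC oC] sub]; case: oC => [oC|tC].
    exists 0 => x Cx; exfalso; have [a [b [abx h]]] := oC x Cx.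
    have [|y by_ gy] := @good_dense _ _ D n Y DY finY a b.
      by move=> j; have [ax xb] := abx j; apply: lt_trans xb.
    exact: (sub y (h y by_)).
  case: n Pn IH Y DY finY Dg N hN C DC cC sub tC => [|m] Pn IH Y DY finY Dg N hN C DC cC sub tC.
    by case: tC; case.
  have [p [s [sK np ns Dp Ds]]] := thin_chart DC tC.
  have [||N' hN'] := IH m erefl (fun y t => Y (s y) t).
  + by move=> I x t Dx Dt; apply: DY => //; apply: Ds.
  + by move=> y; apply: finY.
  by exists N' => x Cx; have := hN' (p x); rewrite sK.
exists (maxn N N') => x; have [gx|ngx] := pselect (good Y x).
  by apply: cle_le (hN x gx); [constructor; exact: os_pt D|exact: leq_maxl].
by apply: cle_le (hN' x ngx); [constructor; exact: os_pt D|exact: leq_maxr].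
Qed.

(** Three statements go up together: decomposition in dimension [n.+1] uses the continuous form and
    uniform finiteness in dimension [n], and both of these use decomposition in their own
    dimension. *)
Theorem cell_decomposition n : decomposable D n.
Proof.
suff [] : [/\ decomposable D n, cont_decomposable D n & uniformly_finite D n] by [].
elim: n => [|n [_ Cn Un]].
  have P0 : decomposable D 0.
    move=> X DX; have all_eq (x y : 'I_0 -> M) : x = y by apply: funext; case.
    apply: fu1; split=> //; first by move=> P _ _ x y _ _; rewrite (all_eq x y).
    by left=> x Xx; apply: (near_all D) => y; rewrite (all_eq y x).
  have C0 := cont_decomposition P0 (fun m => fun e : 0 = m.+1 => match e with end).
  by split=> //; apply: uniform_finiteness.
have PS := decomposableS Cn Un.
by split=> //; [apply: cont_decomposition => // m [<-]|apply: uniform_finiteness => // m [<-]].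
Qed.

End CellDecomposition.

(** * First-order definability *)

Section Renaming.
Variable N : structure.
Implicit Types V W : sorts N -> Type.

Definition ext_ren V W (r : forall s, V s -> W s) t s (x : ext_vars V t s) : ext_vars W t s :=
  match x with inl v => inl (r s v) | inr h => inr h end.

Fixpoint frename V (phi : formula V) : forall W, (forall s, V s -> W s) -> formula W :=
  match phi with
  | FBot => fun W _ => FBot W
  | FEq s x y => fun W r => FEq (r s x) (r s y)
  | FRel R x => fun W r => FRel (fun s z => r s (x s z))
  | FImp phi psi => fun W r => FImp (frename phi r) (frename psi r)
  | FEx s phi => fun W r => FEx (frename phi (@ext_ren V W r s))
  end.

Lemma env_ext V (e e' : env V) : (forall s x, e s x = e' s x) -> e = e'.
Proof.
move=> h; apply: functional_extensionality_dep => s; apply: functional_extensionality_dep => x.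
exact: h.
Qed.

Lemma sat_frename V (phi : formula V) W (r : forall s, V s -> W s) (e : env W) :
  sat (frename phi r) e <-> sat phi (fun s x => e s (r s x)).
Proof.
elim: phi W r e => {V} [V|V s x y|V R x|V phi IH1 psi IH2|V s phi IH] W r e //=.
  by split=> h /IH1 /h /IH2.
have E a : (fun t x => ext_env e a (ext_ren r x)) = ext_env (fun t x => e t (r t x)) a :> env _.
  by apply: env_ext => t; case.
by split=> -[a]; [move=> /IH; rewrite E|move=> h]; exists a => //; apply/IH; rewrite E.
Qed.

(** The many-sorted counterpart of [defsys]. Its instances are definability without parameters, over
    one imaginary, and with all parameters, so that closure arguments are made once for the three
    notions. *)
Record defclass := DefClass {
  Dc :> forall V, (env V -> Prop) -> Prop;
  dc_bot : forall V, Dc (fun _ : env V => False);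
  dc_eqv : forall V s (x y : V s), Dc (fun e : env V => e s x = e s y);
  dc_rel : forall V r (x : forall s, arity N r s -> V s),
    Dc (fun e : env V => interp r (fun s z => e s (x s z)));
  dc_imp : forall V (P Q : env V -> Prop), Dc P -> Dc Q -> Dc (fun e => P e -> Q e);
  dc_ex : forall V s (P : env V -> dom N s -> Prop),
    Dc (fun e : env (ext_vars V s) => P (fun t x => e t (inl x)) (e s (inr erefl))) ->
    Dc (fun e => exists a, P e a);
  dc_ren : forall V W (r : forall s, W s -> V s) (P : env W -> Prop),
    Dc P -> Dc (fun e => P (fun s x => e s (r s x))) }.

Definition definable_by W (w : env W) V (P : env V -> Prop) :=
  exists phi : formula (fun s => (V s + W s)%type), forall e, P e <-> sat phi (join_env e w).

Lemma join_env_ren V V' W (w : env W) (r : forall s, V' s -> V s) (e : env V) :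
  (fun s x => join_env e w (match x with inl v => inl (r s v) | inr u => inr u end)) =
  join_env (fun s v => e s (r s v)) w :> env (fun s => (V' s + W s)%type).
Proof. by apply: env_ext => s; case. Qed.

Lemma definable_by_ex W (w : env W) V s (P : env V -> dom N s -> Prop) :
  definable_by w (fun e : env (ext_vars V s) => P (fun t x => e t (inl x)) (e s (inr erefl))) ->
  definable_by w (fun e => exists a, P e a).
Proof.
case=> phi hphi.
pose r t (x : ext_vars V s t + W t) : ext_vars (fun s => (V s + W s)%type) s t :=
  match x with inl (inl v) => inl (inl v) | inl (inr h) => inr h | inr u => inl (inr u) end.
exists (FEx (frename phi r)) => e /=.
have E a : (fun t x => ext_env (join_env e w) a (r t x)) = join_env (ext_env e a) w :> env _.
  by apply: env_ext => t; case=> [[]|].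
by split=> -[a h]; exists a; [apply/sat_frename; rewrite E; apply/hphi|
  move: h => /sat_frename; rewrite E => /hphi].
Qed.

Lemma definable_by_ren W (w : env W) V V' (r : forall s, V' s -> V s) (P : env V' -> Prop) :
  definable_by w P -> definable_by w (fun e : env V => P (fun s x => e s (r s x))).
Proof.
case=> phi hphi.
exists (frename phi (fun s x => match x with inl v => inl (r s v) | inr u => inr u end)) => e.
by rewrite sat_frename join_env_ren; apply: hphi.
Qed.

Definition definable_class W (w : env W) : defclass.
Proof.
apply: (@DefClass (definable_by w)) => V.
- by exists (FBot (fun s => (V s + W s)%type)).
- by move=> s x y; exists (@FEq _ (fun s => (V s + W s)%type) s (inl x) (inl y)).
- by move=> r x; exists (@FRel _ (fun s => (V s + W s)%type) r (fun s z => inl (x s z))).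
- move=> P Q [phi hphi] [psi hpsi]; exists (FImp phi psi) => e /=.
  by split=> [h /hphi /h /hpsi|h /hphi /h /hpsi].
- exact: definable_by_ex.
- move=> W' r P; exact: definable_by_ren.
Defined.

End Renaming.

Section DefinabilityClass.
Variables (N : structure) (C : defclass N).
Implicit Types V W : sorts N -> Type.

Lemma dc_ext V (P Q : env V -> Prop) : (forall e, P e <-> Q e) -> C V P -> C V Q.
Proof. by move=> PQ; rewrite (_ : P = Q) //; apply: funext => e; apply: propext. Qed.

Lemma dc_not V (P : env V -> Prop) : C V P -> C V (fun e => ~ P e).
Proof. by move=> CP; apply: dc_imp => //; apply: dc_bot. Qed.

Lemma dc_true V : C V (fun _ => True).
Proof. by apply: (@dc_ext _ (fun _ => False -> False)) => //; apply: dc_imp; apply: dc_bot. Qed.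

Lemma dc_and V (P Q : env V -> Prop) : C V P -> C V Q -> C V (fun e => P e /\ Q e).
Proof.
move=> CP CQ; apply: (@dc_ext _ (fun e => ~ (P e -> ~ Q e))).
  by move=> e; split=> [/not_implyP[p /contrapT q]|[p q] h] //; exact: h.
by apply: dc_not; apply: dc_imp => //; apply: dc_not.
Qed.

Lemma dc_or V (P Q : env V -> Prop) : C V P -> C V Q -> C V (fun e => P e \/ Q e).
Proof.
move=> CP CQ; apply: (@dc_ext _ (fun e => ~ P e -> Q e)).
  by move=> e; split=> [h|[|]//]; have [?|?] := pselect (P e); [left|right; apply: h].
by apply: dc_imp => //; apply: dc_not.
Qed.

End DefinabilityClass.

(** * O-minimal structures as systems of definable sets *)

Section OrderStructure.
Context {d : Order.disp_t} {M : orderType d} (R : relations M).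

Definition order_defsys : defsys M.
Proof.
pose C := @definable_class (order_structure R) (dom (order_structure R)) (fun _ (a : M) => a).
apply: (@DefSys M (fun I => @definable_in_M _ _ R I)).
- by move=> I; apply: (dc_bot C).
- by move=> I i j; apply: (@dc_eqv _ C (fun _ => I) tt).
- by move=> I P Q; apply: (dc_imp (d := C)).
- move=> I P DP; apply: (@dc_ex _ C (fun _ => I) tt (fun e a => P (e tt) a)).
  pose r (t : unit) (x : option I) : ext_vars (N := order_structure R) (fun _ => I) tt t :=
    match x with Some i => inl i | None => inr (match t with tt => erefl end) end.
  exact: (@dc_ren _ C _ (fun _ => option I) r (fun e => P (fun i => e tt (Some i)) (e tt None)) DP).
- move=> I J s P [phi hphi].
  pose r (t : unit) (x : J + M) : I + M :=
    match x with inl j => s j | inr c => inr c end.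
  exists (@frename (order_structure R) _ phi (fun _ => (I + M)%type) r) => e.
  pose e0 : env (N := order_structure R) (fun _ => J) :=
    fun _ j => match s j with inl i => e tt i | inr c => c end.
  pose e1 : env (N := order_structure R) (fun _ => (J + M)%type) := join_env e0 (fun _ (a : M) => a).
  pose e2 : env (N := order_structure R) (fun _ => (J + M)%type) :=
    fun t x => join_env (e : env (N := order_structure R) (fun _ => I)) (fun _ (a : M) => a) (r t x).
  have E : e1 = e2.
    by apply: env_ext => -[] [j|c] //=; rewrite /e1 /e2 /= /e0; case: (s j).
  apply: (iff_trans (hphi e0)); apply: (iff_trans _ (iff_sym (sat_frename _ _ _))).
  by change (sat phi e1 <-> sat phi e2); rewrite E.
Defined.

Lemma order_ominsys : o_minimal R -> exists D : ominsys M, osys D = order_defsys.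
Proof.
case=> -[m0] dense noend itv.
have lt_def : order_defsys bool (fun e => (e true < e false)%O).
  pose C := @definable_class (order_structure R) (dom (order_structure R)) (fun _ (a : M) => a).
  pose x (s : unit) (k : 'I_2) : bool := (k == 0 :> nat).
  exact: (@dc_rel _ C (fun _ => bool) None x).
by exists (@OminSys _ M order_defsys lt_def m0 dense noend itv).
Qed.

End OrderStructure.

(** * Definable groups and their topology *)

Section CoordinatizedTypes.
Variables (M : Type) (D : defsys M).

(** A type with definable coordinates in a power of M. Predicates ([D1]) and maps ([cmap]) on such
    types are then handled without coordinates; an arbitrary finite index type [cind] lets products
    and powers be formed without renumbering. *)
Record cty := Cty {
  ct :> Type;
  cind : finType;
  cc : ct -> cind -> M;
  cc_inj : forall x y, (forall i, cc x i = cc y i) -> x = y;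
  cc_univ : D cind (fun y => exists x, forall i, y i = cc x i) }.

Implicit Types S T U : cty.

Definition D1 T (P : T -> Prop) := D (cind T) (fun y => exists2 x, P x & forall i, y i = cc x i).

Lemma D1_ext T (P Q : T -> Prop) : (forall x, P x <-> Q x) -> D1 P -> D1 Q.
Proof. by move=> PQ; rewrite (_ : P = Q) //; apply: funext => x; apply: propext. Qed.

Lemma D1_const T (p : Prop) : D1 (fun _ : T => p).
Proof.
apply: (@Df_ext _ _ _ (fun y => p /\ exists x : T, forall i, y i = cc x i)).
  by move=> y; split=> [[? [x ?]]|[x ? ?]]; [exists x|split=> //; exists x].
by apply: Df_and; [apply: Df_const|apply: cc_univ].
Qed.

Lemma D1_imp T (P Q : T -> Prop) : D1 P -> D1 Q -> D1 (fun x => P x -> Q x).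
Proof.
move=> DP DQ.
apply: (@Df_ext _ _ _ (fun y => (exists x : T, forall i, y i = cc x i) /\
   ((exists2 x, P x & forall i, y i = cc x i) -> exists2 x, Q x & forall i, y i = cc x i))).
  move=> y; split=> [[[x yx] PQ]|[x PQ yx]].
    exists x => // Px; have [|x' Qx' yx'] := PQ; first by exists x.
    by rewrite (@cc_inj T x x') // => i; rewrite -yx -yx'.
  split=> [|[x' Px' yx']]; first by exists x.
  exists x => //; apply: PQ.
  by rewrite (@cc_inj T x x') // => i; rewrite -yx -yx'.
by apply: Df_and; [apply: cc_univ|apply: Df_imp].
Qed.

Lemma D1_not T (P : T -> Prop) : D1 P -> D1 (fun x => ~ P x).
Proof. by move=> DP; apply: D1_imp => //; apply: D1_const. Qed.

Lemma D1_and T (P Q : T -> Prop) : D1 P -> D1 Q -> D1 (fun x => P x /\ Q x).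
Proof.
move=> DP DQ; apply: (@D1_ext _ (fun x => ~ (P x -> ~ Q x))).
  by move=> e; split=> [/not_implyP[p /contrapT q]|[p q] h] //; exact: h.
by apply: D1_not; apply: D1_imp => //; apply: D1_not.
Qed.

Lemma D1_or T (P Q : T -> Prop) : D1 P -> D1 Q -> D1 (fun x => P x \/ Q x).
Proof.
move=> DP DQ; apply: (@D1_ext _ (fun e => ~ P e -> Q e)).
  by move=> e; split=> [h|[|]//]; have [?|?] := pselect (P e); [left|right; apply: h].
by apply: D1_imp => //; apply: D1_not.
Qed.

Lemma D1_allfin T (J : finType) (P : J -> T -> Prop) :
  (forall j, D1 (P j)) -> D1 (fun x => forall j, P j x).
Proof.
move=> DP; apply: (@Df_ext _ _ _ (fun y => (exists x : T, forall i, y i = cc x i) /\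
   forall j, exists2 x, P j x & forall i, y i = cc x i)).
  move=> y; split=> [[[x yx] PQ]|[x PQ yx]].
    exists x => // j; have [x' Px' yx'] := PQ j.
    by rewrite (@cc_inj T x x') // => i; rewrite -yx -yx'.
  by split=> [|j]; exists x.
by apply: Df_and; [apply: cc_univ|apply: Df_allfin].
Qed.

Definition csum S T (z : S * T) (i : cind S + cind T) : M :=
  match i with inl i => cc z.1 i | inr j => cc z.2 j end.

Program Definition prodC S T : cty := @Cty (S * T)%type (cind S + cind T)%type (@csum S T) _ _.
Next Obligation.
by move=> S T [x y] [x' y'] h; congr pair; apply: cc_inj => i;
  [exact: (h (inl i))|exact: (h (inr i))].
Qed.
Next Obligation.
move=> S T; apply: (@Df_ext _ _ _ (fun y => (exists x : S, forall i, y (inl i) = cc x i) /\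
  (exists x : T, forall i, y (inr i) = cc x i))).
  move=> y; split=> [[[x yx] [x' yx']]|[[x x'] yx]]; first by exists (x, x'); case.
  by split; [exists x => i; apply: (yx (inl i))|exists x' => i; apply: (yx (inr i))].
by apply: Df_and; [apply: (Df_ren inl (cc_univ S))|apply: (Df_ren inr (cc_univ T))].
Qed.

Definition cpow (J : finType) T (x : J -> T) (i : J * cind T) : M := cc (x i.1) i.2.

Program Definition powC (J : finType) T : cty := @Cty (J -> T) (J * cind T)%type (@cpow J T) _ _.
Next Obligation.
by move=> J T x y h; apply: funext => j; apply: cc_inj => i; apply: (h (j, i)).
Qed.
Next Obligation.
move=> J T; apply: (@Df_ext _ _ _ (fun y => forall j, exists x : T, forall i, y (j, i) = cc x i)).
  move=> y; split=> [/choice[x hx]|[x hx] j]; first by exists x => -[j i]; apply: hx.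
  by exists (x j) => i; apply: (hx (j, i)).
by apply: Df_allfin => j; apply: (Df_ren (fun i => (j, i)) (cc_univ T)).
Qed.

Program Definition vecC (J : finType) : cty := @Cty (J -> M) J (fun x => x) _ _.
Next Obligation. by move=> J x y; apply: funext. Qed.
Next Obligation. by move=> J; apply: Df_ext (Df_true _ _) => y; split=> // _; exists y. Qed.

Lemma D1_vec (J : finType) (P : (J -> M) -> Prop) : D1 (T := vecC J) P <-> D J P.
Proof.
split; apply: Df_ext => y; last by split=> [Py|[x Px yx]]; [exists y|rewrite (funext yx)].
by split=> [[x Px yx]|Py]; [rewrite (funext yx)|exists y].
Qed.

Definition cmap S T (g : S -> T) := D1 (T := prodC S T) (fun z => g z.1 = z.2).

Lemma D1_snd S T (P : T -> Prop) : D1 P -> D1 (T := prodC S T) (fun z => P z.2).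
Proof.
move=> DP; apply: (@Df_ext _ _ _ (fun y => (exists x : S, forall i, y (inl i) = cc x i) /\
  (exists2 x, P x & forall i, y (inr i) = cc x i))).
  move=> y; split=> [[[x yx] [x' Px' yx']]|[[x x'] Px yx]]; first by exists (x, x') => //; case.
  by split; [exists x => i; apply: (yx (inl i))|exists x' => // i; apply: (yx (inr i))].
by apply: Df_and; [apply: (Df_ren inl (cc_univ S))|apply: (Df_ren inr DP)].
Qed.

Lemma D1_ex S T (P : S -> T -> Prop) :
  D1 (T := prodC S T) (fun z => P z.1 z.2) -> D1 (fun x => exists y, P x y).
Proof.
move=> DP; apply: (@Df_ext _ _ _ (fun u => exists v : cind T -> M,
  exists2 z : S * T, P z.1 z.2 & forall i, (match i with inl i => u i | inr j => v j end) = csum z i)).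
  move=> u; split=> [[v [[x y] Pxy h]]|[x [y Pxy] h]].
    by exists x; [exists y|move=> i; apply: (h (inl i))].
  by exists (cc y), (x, y) => //; case.
apply: (@Df_exv _ _ _ (cind T) (fun u v => exists2 z : S * T, P z.1 z.2 &
   forall i, (match i with inl i => u i | inr j => v j end) = csum z i)).
apply: Df_ext DP => u.
by split=> -[z Pz h]; exists z => //; case=> i; rewrite -?h //; [have := h (inl i)|have := h (inr i)].
Qed.

Lemma D1_comp S T (g : S -> T) (P : T -> Prop) : cmap g -> D1 P -> D1 (fun x => P (g x)).
Proof.
move=> Dg DP; apply: (@D1_ext _ (fun x => exists y, g x = y /\ P y)).
  by move=> x; split=> [[y [<-]]|Px] //; exists (g x).
by apply: D1_ex; apply: D1_and => //; apply: D1_snd.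
Qed.

Lemma cmap_fst S T : cmap (S := prodC S T) (T := S) fst.
Proof.
apply: (@Df_ext _ _ _ (fun y => (exists z : S * T, forall i, y (inl i) = csum z i) /\
   forall i : cind S, y (inl (inl i)) = y (inr i))).
  move=> y; split=> [[[z yz] h]|[[z x] /= <- h]].
    by exists (z, z.1) => // -[i|i]; [apply: yz|rewrite -h; apply: (yz (inl i))].
  by split=> [|i]; [exists z => i; apply: (h (inl i))|rewrite (h (inl (inl i))) (h (inr i))].
apply: Df_and; first exact: (Df_ren inl (cc_univ (prodC S T))).
by apply: Df_allfin => i; apply: Df_eqv.
Qed.

Lemma cmap_snd S T : cmap (S := prodC S T) (T := T) snd.
Proof.
apply: (@Df_ext _ _ _ (fun y => (exists z : S * T, forall i, y (inl i) = csum z i) /\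
   forall i : cind T, y (inl (inr i)) = y (inr i))).
  move=> y; split=> [[[z yz] h]|[[z x] /= <- h]].
    by exists (z, z.2) => // -[i|i]; [apply: yz|rewrite -h; apply: (yz (inr i))].
  by split=> [|i]; [exists z => i; apply: (h (inl i))|rewrite (h (inl (inr i))) (h (inr i))].
apply: Df_and; first exact: (Df_ren inl (cc_univ (prodC S T))).
by apply: Df_allfin => i; apply: Df_eqv.
Qed.

Lemma cmap_comp S T U (g : S -> T) (h : T -> U) : cmap g -> cmap h -> cmap (fun x => h (g x)).
Proof.
move=> Dg Dh.
apply: (@D1_ext (prodC S U) (fun z => exists y, g z.1 = y /\ h y = z.2)).
  by move=> z; split=> [[y [<-]]|] //; exists (g z.1).
apply: D1_ex.
pose sh (b : bool) : cind S + cind T -> cind S + cind U + cind T := fun i =>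
  match i with inl i => inl (inl i) | inr i => inr i end.
pose sh' : cind T + cind U -> cind S + cind U + cind T := fun i =>
  match i with inl i => inr i | inr i => inl (inr i) end.
apply: Df_ext (Df_and (Df_ren (sh true) Dg) (Df_ren sh' Dh)) => u.
split=> [[[[x y] /= gxy h1] [[y' w] /= hyw h2]]|[[[x w] y] /= [gxy hyw] h1]].
  have yy' : y = y'.
    by apply: cc_inj => i; apply: etrans (esym (h1 (inr i))) (h2 (inl i)).
  exists ((x, w), y) => /=; first by split=> //; rewrite yy'.
  by case=> [[i|i]|i]; [apply: (h1 (inl i))|apply: (h2 (inr i))|apply: (h1 (inr i))].
split; first by exists (x, y) => // -[i|i]; [apply: (h1 (inl (inl i)))|apply: (h1 (inr i))].
by exists (y, w) => // -[i|i]; [apply: (h1 (inr i))|apply: (h1 (inl (inr i)))].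
Qed.

Lemma cmap_id S : cmap (fun x : S => x).
Proof.
apply: (@Df_ext _ _ _ (fun y => (exists z : S, forall i, y (inl i) = cc z i) /\
   forall i : cind S, y (inl i) = y (inr i))).
  move=> y; split=> [[[z yz] h]|[[z x] /= <- h]].
    by exists (z, z) => // -[i|i]; rewrite -?h; apply: yz.
  by split=> [|i]; [exists z => i; apply: (h (inl i))|rewrite (h (inl i)) (h (inr i))].
apply: Df_and; first exact: (Df_ren inl (cc_univ S)).
by apply: Df_allfin => i; apply: Df_eqv.
Qed.

Lemma D1_point T (a : T) : D1 (fun x => x = a).
Proof.
apply: (@Df_ext _ _ _ (fun y => forall i, y i = cc a i)).
  by move=> y; split=> [h|[x -> //]]; exists a.
by apply: Df_allfin => i; apply: Df_eq; [apply: Dt_var|apply: Dt_const].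
Qed.

Lemma cmap_const S T (a : T) : cmap (fun _ : S => a).
Proof.
apply: (@D1_ext (prodC S T) (fun z => z.2 = a)); first by move=> z; split=> ->.
exact: D1_snd (D1_point a).
Qed.

Lemma cmap_eq S T (g h : S -> T) : cmap g -> cmap h -> D1 (fun x => g x = h x).
Proof.
move=> Dg Dh; apply: (@D1_ext _ (fun x => exists y, g x = y /\ h x = y)).
  by move=> x; split=> [[y [-> ->]]|gh] //; exists (h x).
by apply: D1_ex; apply: D1_and.
Qed.

Lemma cmap_pair S T U (g : S -> T) (h : S -> U) :
  cmap g -> cmap h -> cmap (T := prodC T U) (fun x => (g x, h x)).
Proof.
move=> Dg Dh.
apply: (@D1_ext (prodC S (prodC T U)) (fun z => g z.1 = z.2.1 /\ h z.1 = z.2.2)).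
  by move=> [x [y w]] /=; split=> [[-> ->]|[-> ->]].
have c1 := @cmap_fst S (prodC T U); have c2 := @cmap_snd S (prodC T U).
apply: D1_and; apply: cmap_eq.
- exact: cmap_comp c1 Dg.
- exact: cmap_comp c2 (@cmap_fst _ _).
- exact: cmap_comp c1 Dh.
- exact: cmap_comp c2 (@cmap_snd _ _).
Qed.

Lemma cmap_proj (J : finType) T j : cmap (S := powC J T) (fun x => x j).
Proof.
apply: (@Df_ext _ _ _ (fun y => (exists x : powC J T, forall i, y (inl i) = cc x i) /\
   forall i : cind T, y (inl (j, i)) = y (inr i))).
  move=> y; split=> [[[z yz] h]|[[z x] /= <- h]].
    by exists (z, z j) => // -[i|i]; [apply: yz|rewrite -h; apply: yz].
  by split=> [|i]; [exists z => i; apply: (h (inl i))|rewrite (h (inl (j, i))) (h (inr i))].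
apply: Df_and; first exact: (Df_ren inl (cc_univ (powC J T))).
by apply: Df_allfin => i; apply: Df_eqv.
Qed.

Lemma cmap_pow (J : finType) S T (g : S -> J -> T) :
  (forall j, cmap (fun x => g x j)) -> cmap (T := powC J T) g.
Proof.
move=> Dg; apply: (@D1_ext (prodC S (powC J T)) (fun z => forall j, g z.1 j = z.2 j)).
  by move=> z; split=> [h|<- //]; apply: funext.
apply: D1_allfin => j; apply: cmap_eq; first exact: cmap_comp (@cmap_fst _ _) (Dg j).
exact: (@cmap_comp _ (powC J T) T _ (fun x => x j) (@cmap_snd _ _) (@cmap_proj J T j)).
Qed.

Lemma cmap_vec (J : finType) S (g : S -> J -> M) (I : finType) (u : S -> I -> M) :
  cmap (T := vecC J) g -> (forall i, exists j, forall x, u x i = g x j) -> cmap (T := vecC I) u.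
Proof.
move=> Dg /choice[r hr].
apply: (@D1_ext (prodC S (vecC I)) (fun z => exists v : vecC J, g z.1 = v /\ forall i, v (r i) = z.2 i)).
  move=> z; split=> [[v [<- h]]|h]; first by apply: funext => i; rewrite hr h.
  by exists (g z.1); split=> // i; rewrite -hr h.
apply: D1_ex; apply: D1_and.
  apply: (cmap_eq (S := prodC (prodC S (vecC I)) (vecC J)) (T := vecC J)).
    exact: cmap_comp (cmap_comp (@cmap_fst _ _) (@cmap_fst _ _)) Dg.
  exact: cmap_snd.
apply: (@Df_ext _ _ _ (fun y => (exists x : S, forall i, y (inl (inl i)) = cc x i) /\
   forall i : I, y (inr (r i)) = y (inl (inr i)))).
  move=> y; split=> [[[x yx] h]|[[[x w] v] /= hv h]].
    exists ((x, fun i => y (inl (inr i))), fun j => y (inr j)) => //.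
    by case=> [[i|i]|i] //=; apply: yx.
  split=> [|i]; first by exists x => i; apply: (h (inl (inl i))).
  by rewrite (h (inr (r i))) (h (inl (inr i))) /=.
apply: Df_and; first exact: (Df_ren (fun i => inl (inl i)) (cc_univ S)).
by apply: Df_allfin => i; apply: Df_eqv.
Qed.

End CoordinatizedTypes.
Arguments D1 {M D} T P.
Arguments cmap {M D} S T g.

(** * Neighbourhoods in finite powers and in the order topology *)

Section PointwiseTopology.
Variables (J : finType) (T : topologicalType).

(** The topology is the supremum of those pulled back by the projections. The product neighbourhoods
    of [x] form a filter converging to [x] for each of them, hence for the supremum; conversely
    finitely many coordinate conditions define a neighbourhood. *)
Lemma nbhs_ptwsP (x : {ptws J -> T}) (P : set {ptws J -> T}) : nbhs x P <->
  exists W : J -> set T, (forall a, nbhs (x a) (W a)) /\ forall y, (forall a, W a (y a)) -> P y.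
Proof.
split; last first.
  case=> W [Wx WP]; have FF : Filter (nbhs x) := @nbhs_filter _ x.
  apply: (@filterS _ _ FF (fun y => forall a, W a (y a))) => //.
  apply: (@filter_forall _ J (fun a y => W a (y a)) _ FF) => a.
  exact: (@proj_continuous J (fun _ => T) a x (W a) (Wx a)).
pose F : set_system {ptws J -> T} := [set P | exists W : J -> set T,
  (forall a, nbhs (x a) (W a)) /\ forall y : {ptws J -> T}, (forall a, W a (y a)) -> P y].
have FF : Filter F.
  split.
  - by exists (fun _ => setT); split=> // a; apply: filterT.
  - move=> A B [V [Vx VA]] [W [Wx WB]]; exists (fun a => V a `&` W a); split.
      by move=> a; apply: filterI.
    by move=> y hy; split; [apply: VA|apply: WB] => a; have [] := hy a.
  - by move=> A B AB [V [Vx VA]]; exists V; split=> // y /VA /AB.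
suff : F --> x by apply.
apply/cvg_sup => i Q [B [[O oO <-] Ox BQ]].
exists (fun a => if a == i then O else setT); split.
  move=> a; case: eqP => [->|_]; last exact: filterT.
  exact: open_nbhs_nbhs.
by move=> y hy; apply: BQ; have := hy i; rewrite eqxx.
Qed.

Lemma open_nbhsP (X : topologicalType) (A : set X) : open A <-> forall x, A x -> nbhs x A.
Proof. by rewrite openE. Qed.

End PointwiseTopology.

Section OrderTopology.
Context {d : Order.disp_t} {M : orderType d} (D : ominsys M).

(** Intervals that are neighbourhoods in the order topology may be rays; since M has no endpoints
    they contain bounded intervals around the point, as boxes require. *)
Lemma nbhs_ptws_near (J : finType) (x : J -> M) (P : (J -> M) -> Prop) :
  nbhs (x : {ptws J -> order_topology M}) P <-> near x P.
Proof.
split.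
  move=> /nbhs_ptwsP[W [Wx WP]].
  suff Wn a : near x (fun y => W a (y a)).
    have : near x (fun y => forall a, a \in enum J -> W a (y a)).
      elim: (enum J) => [|a s IHs]; first exact: (near_all D).
      apply: near_imp (near_and (Wn a) IHs) => y [h1 h2] b; rewrite inE => /orP[/eqP->//|].
      exact: h2.
    by apply: near_imp => y hy; apply: WP => a; apply: hy; rewrite mem_enum.
  have := Wx a; rewrite order_nbhs_itv => -[[l r] /= [op xlr] sub].
  have [y0 [z0 [y0x xz0]]] := os_noend D (x a).
  have [u [ux hu]] : exists u, (u < x a)%O /\ forall t, (u < t)%O -> (l <= BLeft t)%O.
    move: op xlr; rewrite itv_boundlr => + /andP[lx _].
    case: l lx sub => [[] u|[]] lx sub //= _; last by exists y0.
    by exists u; move: lx; rewrite bnd_simp => lx; split=> // t ut; rewrite bnd_simp.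
  have [v [xv hv]] : exists v, (x a < v)%O /\ forall t, (t < v)%O -> (BRight t <= r)%O.
    move: op xlr; rewrite itv_boundlr => + /andP[_ xr].
    case: r xr sub => [[] v|[]] xr sub //= op; try by exists z0.
      by exists v; move: xr; rewrite bnd_simp => xr; split=> // t ut; rewrite bnd_simp.
    by move: op; case: (l) => [[]|[]].
  have [b [e [bex _]]] := near_true D x.
  exists (fun c => if c == a then u else b c), (fun c => if c == a then v else e c); split.
    by move=> c; case: eqP => [->|_]; [|apply: bex].
  move=> y /(_ a); rewrite eqxx => -[uy yv]; apply: sub => /=.
  by rewrite itv_boundlr hu ?hv.
case=> a [b [abx sub]]; apply/nbhs_ptwsP.
exists (fun c => [set t : order_topology M | (a c < t)%O /\ (t < b c)%O]); split; last first.
  by move=> y hy; apply: sub => c; apply: hy.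
move=> c; rewrite order_nbhs_itv; have [ax xb] := abx c.
exists (Interval (BRight (a c : order_topology M)) (BLeft (b c : order_topology M))).
  by rewrite /= in_itv /= ax xb.
by move=> t /=; rewrite in_itv /= => /andP[].
Qed.

Lemma open_near (J : finType) (A : set {ptws J -> order_topology M}) :
  open A <-> forall x, A x -> near x A.
Proof.
by split=> [/open_nbhsP h x /h/nbhs_ptws_near|h]; [|apply/open_nbhsP => x /h/nbhs_ptws_near].
Qed.

End OrderTopology.

Section ReindexedTheorems.
Context {d : Order.disp_t} {M : orderType d} (D : ominsys M).
Variable I : finType.
Let n := #|I|.
Let to (x : 'I_n -> M) : I -> M := fun i => x (enum_rank i).
Let from (x : I -> M) : 'I_n -> M := fun i => x (enum_val i).
Let fromK x : to (from x) = x.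
Proof. by apply: funext => i; rewrite /to /from enum_rankK. Qed.
Let toK x : from (to x) = x.
Proof. by apply: funext => i; rewrite /to /from enum_valK. Qed.

Let near_from x P : near (from x) (fun y => P (to y)) <-> near x P.
Proof.
split=> [[a [b [abx h]]]|[a [b [abx h]]]].
  exists (to a), (to b); split=> [i|y hy].
    by have := abx (enum_rank i); rewrite /from enum_rankK.
  rewrite -(fromK y); apply: h => i.
  by have := hy (enum_val i); rewrite /to enum_valK.
exists (from a), (from b); split=> [i|y hy]; first exact: abx.
by apply: h => i; have := hy (enum_rank i); rewrite /from /to enum_rankK.
Qed.

Lemma fu_conn (X : (I -> M) -> Prop) : D I X -> fu (fun C => D I C /\ conn D C) X.
Proof.
move=> DX.
have DX' : Df1 D (fun x => X (to x)).
  by apply/Df1P; apply: (Df_ren (fun i => enum_rank i) DX).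
have := fu_preim (g := from) (B := fun _ => True)
  (Qc := fun C => D I C /\ conn D C) (cell_decomposition DX').
move=> h; apply: (fu_ext _ (h _)) => [x|C [DC cC _]]; first by rewrite fromK; split=> [[]|].
split.
  apply: Df_and; first exact: Df_true.
  by apply: (Df_app (x := from)) => [|i]; [apply/Df1P|apply: Dt_var].
move=> P DP loc x y [_ Cx] [_ Cy]; rewrite -(fromK x) -(fromK y).
apply: (cC (fun x => P (to x))) => //.
  by move=> J z Dz; apply: DP => i; apply: Dz.
move=> z Cz; have : near (to z) (fun y => True /\ C (from y) -> (P y <-> P (to z))).
  by apply: loc; rewrite toK.
rewrite -near_from toK; apply: near_imp => w hw Cw.
by apply: hw; rewrite toK.
Qed.

(** In use, [f l] is a value read in a chart and is meaningful on [V l]. If no [V l] contained a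
    subbox, shrinking once for each [l] would leave a box missing all of them. On the subbox found,
    one shrinks once more per coordinate. *)
Lemma generic_continuity (q k : nat) (V : 'I_q -> (I -> M) -> Prop) (f : 'I_q -> 'I_k -> (I -> M) -> M) a b :
  (forall i, (a i < b i)%O) -> (forall l, Df1 D (V l)) -> (forall l c, Dfun D (f l c)) ->
  (forall x, exists l, V l x) ->
  exists l x, [/\ box a b x, near x (V l) & forall c, contn (f l c) x].
Proof.
move=> ab DV Df_f cov.
have ab' j : (from a j < from b j)%O by apply: ab.
have bg := baire_gencont D n.
have [l [a1 [b1 [sab hV]]]] : exists l a1 b1, subbox a1 b1 (from a) (from b) /\
    forall x, box a1 b1 x -> V l (to x).
  apply: contrapT => no.
  have : exists a1 b1, subbox a1 b1 (from a) (from b) /\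
      forall x, box a1 b1 x -> forall l, l \in enum 'I_q -> ~ V l (to x).
    elim: (enum 'I_q) => [|l s [a1 [b1 [sab hs]]]].
      by exists (from a), (from b); split=> //; apply: subbox_refl.
    have [||a2 [b2 [sab2 [h|h]]]] := bg.1 a1 b1 (fun x => V l (to x)).
    - by move=> j; have [] := sab j.
    - by move=> J z Dz; apply: DV => i; apply: Dz.
    - by case: no; exists l, a2, b2; split=> //; apply: subbox_trans sab.
    exists a2, b2; split; first exact: subbox_trans sab.
    move=> x bx l'; rewrite inE => /orP[/eqP->|]; first exact: h.
    exact: hs (subbox_box sab2 bx) l'.
  case=> a1 [b1 [sab h]]; have [|x bx] := @box_ex _ _ D n a1 b1.
    by move=> j; have [] := sab j.
  by have [l Vl] := cov (to x); apply: (h x bx l _ Vl); rewrite mem_enum.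
have : exists a2 b2, subbox a2 b2 a1 b1 /\
    forall x, box a2 b2 x -> forall c, c \in enum 'I_k -> contn (fun y => f l c (to y)) x.
  elim: (enum 'I_k) => [|c s [a2 [b2 [sab2 hs]]]].
    exists a1, b1; split=> //; apply: subbox_refl => j.
    by have [] := sab j.
  have [||a3 [b3 [sab3 h]]] := bg.2 a2 b2 (fun y => f l c (to y)).
  - by move=> j; have [] := sab2 j.
  - by move=> J z Dz; apply: Df_f => i; apply: Dz.
  exists a3, b3; split; first exact: subbox_trans sab2.
  move=> x bx c'; rewrite inE => /orP[/eqP->|]; first exact: h.
  exact: hs (subbox_box sab3 bx) c'.
case=> a2 [b2 [sab2 hc]]; have [|x bx] := @box_ex _ _ D n a2 b2.
  by move=> j; have [] := sab2 j.
exists l, (to x); split.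
- move=> i; have := subbox_box sab (subbox_box sab2 bx) (enum_rank i).
  by rewrite /from enum_rankK.
- rewrite -near_from toK; have bx1 := subbox_box sab2 bx.
  by apply: near_imp (near_box bx1) => y; apply: hV.
- move=> c u v uf fv; rewrite -near_from toK.
  by have := hc x bx c; rewrite mem_enum => /(_ isT u v uf fv).
Qed.

End ReindexedTheorems.

Lemma fu_exfin (T : Type) (Pc : (T -> Prop) -> Prop) (J : finType) (X : J -> T -> Prop) :
  (forall j, fu Pc (X j)) -> fu Pc (fun x => exists j, X j x).
Proof.
move=> fX; apply: (@fu_ext _ _ (fun x => exists j, j \in enum J /\ X j x)).
  by move=> x; split=> [[j []]|[j ?]]; exists j; rewrite ?mem_enum.
elim: (enum J) => [|j s IHs].
  by apply: (fu_ext _ (fu0 _)) => x; split=> // -[? []].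
apply: (fu_ext _ (fuU (fX j) IHs)) => x; split.
  by case=> [?|[l [ls ?]]]; [exists j|exists l]; rewrite inE ?eqxx ?ls ?orbT.
by case=> l [+ Xl]; rewrite inE => /orP[/eqP <-|ls]; [left|right; exists l].
Qed.

Lemma fu_mem (T : Type) (Pc : (T -> Prop) -> Prop) X x : fu Pc X -> X x -> exists2 C, Pc C & C x.
Proof.
by elim=> [//|C PC Cx|{}X Y _ IX _ IY [/IX|/IY]]; first by exists C.
Qed.

Lemma fu_family (T : Type) (Pc : (T -> Prop) -> Prop) X : fu Pc X ->
  exists n (C : 'I_n -> T -> Prop), (forall i, Pc (C i)) /\ forall x, X x <-> exists i, C i x.
Proof.
elim=> [|C PC|{}X Y _ [n [C [PC XE]]] _ [m [C' [PC' YE]]]].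
- have C : 'I_0 -> T -> Prop by case.
  by exists 0, C; split=> [[]|x] //; split=> // -[[]].
- by exists 1%N, (fun _ => C); split=> // x; split=> [|[]//]; exists ord0.
exists (n + m)%N, (fun i : 'I_(n + m) => match fintype.split i with inl i => C i | inr i => C' i end); split.
  by move=> i; case: (fintype.split i).
move=> x; rewrite XE YE; split=> [[[i Ci]|[i Ci]]|[i]].
- by exists (lshift m i); rewrite -[lshift m i]/(unsplit (inl i)) unsplitK.
- by exists (rshift n i); rewrite -[rshift n i]/(unsplit (inr i)) unsplitK.
by case: (fintype.split i) => k Ck; [left|right]; exists k.
Qed.

Lemma near_prod d (M : orderType d) (D : ominsys M) (J I : finType) (u : J * I -> M) P :
  (forall a, near (fun b => u (a, b)) (P a)) ->
  near u (fun v => forall a, P a (fun b => v (a, b))).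
Proof.
move=> h.
have : near u (fun v => forall a, a \in enum J -> P a (fun b => v (a, b))).
  elim: (enum J) => [|a s IHs]; first exact: (near_all D).
  have na : near u (fun v => P a (fun b => v (a, b))).
    have [c [e [cue hP]]] := h a; have [c' [e' [cue' _]]] := near_true D u.
    exists (fun k => if k.1 == a then c k.2 else c' k), (fun k => if k.1 == a then e k.2 else e' k).
    split; first by move=> [a' b] /=; case: eqP => [->|_]; [apply: cue|apply: cue'].
    by move=> v hv; apply: hP => b; have := hv (a, b); rewrite /= eqxx.
  apply: near_imp (near_and na IHs) => y [h1 h2] b; rewrite inE => /orP[/eqP->//|].
  exact: h2.
by apply: near_imp => y hy a; apply: hy; rewrite mem_enum.
Qed.

(** * Group operations and charts *)

Section DefinableGroups.
Context {d : Order.disp_t} {M : orderType d} {R : relations M} (D : ominsys M).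
Hypothesis DE : forall I (X : set (I -> M)), definable_in_M R X <-> D I X.

Program Definition grpC (G : definable_group R) : cty D := @Cty _ D G 'I_(ncoord G) (@Defs.coord _ _ _ G) _ _.
Next Obligation. by move=> G x y h; apply: coord_inj; apply: funext. Qed.
Next Obligation.
move=> G; have /DE/(Df_ren (fun a : 'I_1 * 'I_(ncoord G) => a.2)) := definable_universe G.
apply: Df_ext => y; split=> [[x _ h]|[x h]]; first by exists (x ord0) => i; apply: (h (ord0, i)).
by exists (fun _ => x).
Qed.

Lemma definable_powerE (G : definable_group R) k (X : set ('I_k -> G)) :
  definable_power R (@Defs.coord _ _ _ G) X <-> D1 (powC 'I_k (grpC G)) X.
Proof. exact: DE. Qed.

Lemma definable_graphE (S T : cty D) (P : S -> Prop) (f : S -> T) :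
  definable_in_M R [set y : cind S + cind T -> M | exists2 h, P h &
    (forall a, y (inl a) = cc h a) /\ (forall a, y (inr a) = cc (f h) a)] <->
  D1 (prodC S T) (fun z => P z.1 /\ f z.1 = z.2).
Proof.
apply: (iff_trans (DE _)); split; apply: Df_ext => y /=.
  split=> [[x Px [h1 h2]]|[[x x'] /= [Px <-] h]].
    by exists (x, f x) => // -[i|i]; [apply: h1|apply: h2].
  by exists x; [|split=> i; [apply: (h (inl i))|apply: (h (inr i))]].
split=> [[[x x'] /= [Px <-] h]|[x Px [h1 h2]]].
  by exists x; [|split=> i; [apply: (h (inl i))|apply: (h (inr i))]].
by exists (x, f x) => // -[i|i]; [apply: h1|apply: h2].
Qed.

Lemma cmap_definable_map (G H : definable_group R) (f : G -> H) :
  definable_map f -> cmap (grpC G) (grpC H) f.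
Proof.
move=> /(@definable_graphE (grpC G) (grpC H) setT f); apply: D1_ext => z.
by split=> [[]|].
Qed.

Lemma cmap_mul (T : cty D) (G : definable_group R) (f g : T -> G) :
  cmap T (grpC G) f -> cmap T (grpC G) g -> cmap T (grpC G) (fun x => f x * g x).
Proof.
move=> Df_f Dg; have /definable_powerE Dm := definable_mul G.
pose h (z : prodC T (grpC G)) (k : 'I_3) : G :=
  if k == 0 :> nat then f z.1 else if k == 1%N :> nat then g z.1 else z.2.
apply: (@D1_ext _ _ (prodC T (grpC G)) (fun z => is_mul (h z))) => //.
apply: (D1_comp (T := powC 'I_3 (grpC G))) Dm; apply: cmap_pow => j; rewrite /h.
have c1 := @cmap_fst _ D T (grpC G).
case: (j == 0 :> nat); first exact: cmap_comp c1 Df_f.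
case: (j == 1%N :> nat); first exact: cmap_comp c1 Dg.
exact: cmap_snd.
Qed.

Lemma cmap_inv (T : cty D) (G : definable_group R) (f : T -> G) :
  cmap T (grpC G) f -> cmap T (grpC G) (fun x => (f x)^-1).
Proof.
move=> Df_f; have c1 := @cmap_fst _ D T (grpC G); have c2 := @cmap_snd _ D T (grpC G).
apply: (@D1_ext _ _ (prodC T (grpC G)) (fun z => f z.1 * z.2 = 1)).
  by move=> z; split=> [h|<-]; [apply: (mulgI (f z.1)); rewrite h|]; rewrite mulgV.
apply: (cmap_eq (T := grpC G)); last exact: cmap_const.
by apply: cmap_mul => //; apply: cmap_comp c1 Df_f.
Qed.

Lemma cmap_prod (T : cty D) (G : definable_group R) n (f : 'I_n -> T -> G) :
  (forall j, cmap T (grpC G) (f j)) -> cmap T (grpC G) (fun x => \prod_(j < n) f j x).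
Proof.
move=> Df_f; have big s : cmap T (grpC G) (fun x => \prod_(j <- s) f j x).
  elim: s => [|j s IHs].
    rewrite (_ : (fun _ => _) = (fun _ => 1)); last by apply: funext => x; rewrite big_nil.
    exact: cmap_const.
  rewrite (_ : (fun _ => _) = (fun x => f j x * \prod_(l <- s) f l x)); last first.
    by apply: funext => x; rewrite big_cons.
  exact: cmap_mul.
exact: big.
Qed.

(** The pointwise form of [definable_atlas]: charts and their inverses are continuous, in terms of
    [nbhs] on the group and [near] on coordinates. *)
Record atlas (G : definable_group R) k m (U : 'I_m -> set G) (f : 'I_m -> G -> 'I_k -> M) := Atlas {
  at_cover : forall g, exists j, U j g;
  at_inj : forall j g h, U j g -> U j h -> f j g = f j h -> g = h;
  at_def : forall j, D1 (prodC (grpC G) (vecC D 'I_k)) (fun z => U j z.1 /\ f j z.1 = z.2);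
  at_nbhs : forall j g, U j g -> nbhs g (U j);
  at_image : forall j g W, U j g -> nbhs g W ->
    near (f j g) (fun u => exists h, [/\ U j h, f j h = u & W h]);
  at_preim : forall j g P, U j g -> near (f j g) P -> nbhs g (fun h => U j h /\ P (f j h)) }.

Lemma has_atlas (G : definable_group R) : exists k m (U : 'I_m -> set G) (f : 'I_m -> G -> 'I_k -> M),
  atlas U f.
Proof.
have [k [m [U [f [cov opU gr inj homeo]]]]] := coord_atlas G.
exists k, m, U, f; split=> //.
- by move=> j g h Ug Uh fgh; apply: (inj j); rewrite ?inE.
- by move=> j; apply/(@definable_graphE (grpC G) (vecC D 'I_k)); apply: gr.
- by move=> j g Ug; apply: open_nbhs_nbhs; split.
- move=> j g W Ug nW.
  have oW : open (U j `&` W^°) by apply: openI => //; apply: open_interior.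
  have sub : U j `&` W^° `<=` U j by move=> x [].
  have /(open_near D) h := (homeo j _ sub).1 oW.
  have /h : (f j @` (U j `&` W^°)) (f j g) by exists g.
  apply: near_imp => u [x [Ux Wx] <-]; exists x; split=> //.
  exact: interior_subset.
- move=> j g P Ug [a [b [abg hP]]].
  pose W := U j `&` (fun h => box a b (f j h)).
  have oW : open W.
    apply/(homeo j W); first by move=> x [].
    apply/(open_near D) => u [x [Ux bx] <-].
    have /(open_near D) h := (homeo j _ (@subset_refl _ (U j))).1 (opU j).
    have /h : (f j @` U j) (f j x) by exists x.
    move=> hU; apply: near_imp (near_and hU (near_box bx)) => v [[y Uy <-] by_].
    by exists y.
  have : nbhs g W by apply: open_nbhs_nbhs; split.
  by apply: filterS => x [Ux bx]; split=> //; apply: hP.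
Qed.

(** The T1 property is not assumed of the group topology; inside a chart it comes from M, and a
    point outside the chart is avoided by the chart itself. *)
Lemma accessible_group (G : definable_group R) (u v : G) : u <> v -> nbhs u [set h | h <> v].
Proof.
move=> uv; have [k [m [U [f at_]]]] := has_atlas G.
have [j Uu] := at_cover at_ u.
have [Uv|nUv] := pselect (U j v); last first.
  by apply: filterS (at_nbhs at_ Uu) => x Ux xv; apply: nUv; rewrite -xv.
have nfe : f j u <> f j v by move=> /(at_inj at_ Uu Uv).
have [c nc] : exists c, f j u c <> f j v c.
  by apply/existsNP => h; apply: nfe; apply: funext.
have nn : near (f j u) (fun w => w <> f j v).
  have [a [b [abu _]]] := near_true D (f j u).
  case: (ltgtP (f j u c) (f j v c)) => // lc.
    exists a, (fun i => if i == c then f j v c else b i); split.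
      by move=> i; have [? ?] := abu i; split=> //; case: eqP => [->|].
    by move=> y hy yE; have [_] := hy c; rewrite eqxx yE ltxx.
  exists (fun i => if i == c then f j v c else a i), b; split.
    by move=> i; have [? ?] := abu i; split=> //; case: eqP => [->|].
  by move=> y hy yE; have [+ _] := hy c; rewrite eqxx yE ltxx.
by apply: filterS (at_preim at_ Uu nn) => x [_ h] xv; apply: h; rewrite xv.
Qed.

End DefinableGroups.

Section Continuity.
Context {d : Order.disp_t} {M : orderType d} {R : relations M} (D : ominsys M).
Hypothesis DE : forall I (X : set (I -> M)), definable_in_M R X <-> D I X.
Local Notation grpC := (grpC DE).

(** The inverse of a chart parametrizes part of [G^J] by a box, and charts of [H] cover the values;
    generic continuity between powers of M is then read back in the groups. Any chart with a point
    would do, and the one at 1 is taken. *)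
Lemma continuity_point (G H : definable_group R) (J : finType) (F : (J -> G) -> H) :
  cmap (powC J (grpC G)) (grpC H) F ->
  exists x0 : {ptws J -> G}, forall O, nbhs (F x0) O -> nbhs x0 (fun x => O (F x)).
Proof.
move=> DF.
have [k [m [U [f aG]]]] := has_atlas DE G; have [k' [m' [V [g aH]]]] := has_atlas DE H.
have [j U1] := at_cover aG 1.
have [|a [b [ab1 hU]]] := at_image aG (W := setT) U1; first exact: filterT.
(* [psi] inverts the chart, with default value 1 outside its image. *)
have /choice[psi hpsi] : forall u : 'I_k -> M, exists x,
    (U j x /\ f j x = u) \/ ((~ exists y, U j y /\ f j y = u) /\ x = 1).
  move=> u; have [[y Uy]|n] := pselect (exists y, U j y /\ f j y = u).
    by exists y; left.
  by exists 1; right.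
have psiK x : U j x -> psi (f j x) = x.
  move=> Ux; case: (hpsi (f j x)) => [[Uy fy]|[[]]]; first exact: (at_inj aG Uy Ux).
  by exists x.
have Dpsi : cmap (vecC D 'I_k) (grpC G) psi.
  apply: (@D1_ext _ _ (prodC (vecC D 'I_k) (grpC G)) (fun z => (U j z.2 /\ f j z.2 = z.1) \/
    ((~ exists y, U j y /\ f j y = z.1) /\ z.2 = 1))).
    move=> [u x] /=; split.
      case=> [[Ux <-]|[nU ->]]; first exact: psiK.
      by case: (hpsi u) => [[Uy fy]|[]] //; case: nU; exists (psi u).
    by move=> <-; apply: hpsi.
  have Dc (T : cty D) (p : T -> G) (q : T -> ('I_k -> M)) : cmap T (grpC G) p -> cmap T (vecC D 'I_k) q ->
      D1 T (fun z => U j (p z) /\ f j (p z) = q z).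
    by move=> Dp Dq; apply: (D1_comp (cmap_pair Dp Dq) (at_def aG j)).
  have c1 := @cmap_fst _ D (vecC D 'I_k) (grpC G); have c2 := @cmap_snd _ D (vecC D 'I_k) (grpC G).
  apply: D1_or; first exact: Dc.
  apply: D1_and; last exact: (cmap_eq (T := grpC G) c2 (cmap_const _ _)).
  apply: D1_not.
  apply: (@D1_ex _ D (prodC (vecC D 'I_k) (grpC G)) (grpC G) (fun z y => U j y /\ f j y = z.1)).
  apply: Dc; first exact: cmap_snd.
  exact: (cmap_comp (@cmap_fst _ D _ _) c1).
pose Psi (u : J * 'I_k -> M) (c : J) : G := psi (fun i => u (c, i)).
have DPsi : cmap (vecC D (J * 'I_k)%type) (grpC H) (fun u => F (Psi u)).
  apply: (cmap_comp (T := powC J (grpC G))) DF; apply: cmap_pow => c.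
  apply: (cmap_comp (T := vecC D 'I_k)) Dpsi.
  by apply: (cmap_vec (@cmap_id _ D (vecC D (J * 'I_k)%type))) => i; exists (c, i).
pose VV l (u : J * 'I_k -> M) := V l (F (Psi u)).
have DVg (T : cty D) (p : T -> H) (q : T -> ('I_k' -> M)) l : cmap T (grpC H) p -> cmap T (vecC D 'I_k') q ->
    D1 T (fun z => V l (p z) /\ g l (p z) = q z).
  by move=> Dp Dq; apply: (D1_comp (cmap_pair Dp Dq) (at_def aH l)).
have DV l : Df1 D (VV l).
  apply/Df1P/D1_vec; apply: (@D1_ext _ D (vecC D _) (fun u => exists w, V l (F (Psi u)) /\ g l (F (Psi u)) = w)).
    by move=> u; split=> [[w []]|Vu] //; exists (g l (F (Psi u))).
  apply: (@D1_ex _ D (vecC D (J * 'I_k)%type) (vecC D 'I_k') (fun u w => V l (F (Psi u)) /\ g l (F (Psi u)) = w)).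
  by apply: DVg; [apply: cmap_comp (@cmap_fst _ D _ _) DPsi|apply: cmap_snd].
(* The coordinates of the value in each chart of [H], extended to total definable functions. *)
have [gg Dgg hgg] : exists2 gg : 'I_m' -> 'I_k' -> (J * 'I_k -> M) -> M,
    forall l c, Dfun D (gg l c) & forall l c u, VV l u -> gg l c u = g l (F (Psi u)) c.
  have /choice[gg hgg] : forall lc : 'I_m' * 'I_k', exists h : (J * 'I_k -> M) -> M,
      Dfun D h /\ forall u, VV lc.1 u -> h u = g lc.1 (F (Psi u)) lc.2.
    move=> [l c]; have [||h Dh hh] := @definable_choice _ _ D _
      (fun u t => exists w, (V l (F (Psi u)) /\ g l (F (Psi u)) = w) /\ w c = t).
    - apply/Df2P.
      have : D1 (vecC D (option (J * 'I_k))) (fun e => exists w, (V l (F (Psi (fun i => e (Some i)))) /\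
          g l (F (Psi (fun i => e (Some i)))) = w) /\ w c = e None).
        have cS : cmap (vecC D (option (J * 'I_k))) (vecC D (J * 'I_k)%type) (fun e i => e (Some i)).
          by apply: (cmap_vec (@cmap_id _ D _)) => i; exists (Some i).
        apply: (@D1_ex _ D (vecC D (option (J * 'I_k))) (vecC D 'I_k') (fun e w => (V l (F (Psi (fun i => e (Some i)))) /\
          g l (F (Psi (fun i => e (Some i)))) = w) /\ w c = e None)).
        apply: D1_and.
          apply: DVg; last exact: cmap_snd.
          exact: (cmap_comp (cmap_comp (@cmap_fst _ D _ _) cS) DPsi).
        apply: (@Df_ext _ D _ (fun y => y (inr c) = y (inl None))).
          move=> y; split=> [h|[[e w] /= h hy]].
            by exists ((fun i => y (inl i)), (fun i => y (inr i))) => // -[].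
          by rewrite (hy (inr c)) (hy (inl None)) /=.
        exact: Df_eqv.
      by move/D1_vec.
    - by move=> u t t' [w [[_ <-] <-]] [w' [[_ <-] <-]].
    by exists h; split=> // u Vu; apply: hh; exists (g l (F (Psi u))).
  by exists (fun l c => gg (l, c)) => [l c|l c u]; [case: (hgg (l, c))|case: (hgg (l, c)) => _; apply].
have [||l [u [bu Vu cu]]] := @generic_continuity _ _ D (J * 'I_k)%type m' k' VV gg
    (fun z => a z.2) (fun z => b z.2) _ DV Dgg.
- by move=> [c i]; have [ax xb] := ab1 i; apply: lt_trans xb.
- by move=> u; apply: at_cover aH _.
exists (Psi u) => O nO.
have nearO : near u (fun v => O (F (Psi v))).
  have Vlu := near_pt Vu.
  have [p [q [pq hpq]]] := at_image aH Vlu nO.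
  have : near u (fun v => forall c, (p c < gg l c v)%O /\ (gg l c v < q c)%O).
    have : near u (fun v => forall c, c \in enum 'I_k' -> (p c < gg l c v)%O /\ (gg l c v < q c)%O).
      elim: (enum 'I_k') => [|c s IHs]; first exact: (near_all D).
      have [pc cq] := pq c; rewrite -hgg // in pc cq.
      apply: near_imp (near_and (cu c _ _ pc cq) IHs) => v [h1 h2] c'.
      by rewrite inE => /orP[/eqP->//|]; apply: h2.
    by apply: near_imp => v hv c; apply: hv; rewrite mem_enum.
  move=> hn; apply: near_imp (near_and Vu hn) => v [Vv hv].
  have [|h [Vh gh Oh]] := hpq (g l (F (Psi v))).
    by move=> c; rewrite -hgg //.
  by rewrite -(at_inj aH Vh Vv gh).
have [c [e [ceu hO]]] := near_and nearO (near_box bu).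
apply/nbhs_ptwsP.
exists (fun i => fun h => U j h /\ box (fun z => c (i, z)) (fun z => e (i, z)) (f j h)); split.
  move=> i; have [y [Uy fy _]] := hU (fun z => u (i, z)) (fun z => bu (i, z)).
  have PsiE : Psi u i = y by rewrite /Psi -fy psiK.
  rewrite PsiE; apply: (at_preim aG (P := box (fun z => c (i, z)) (fun z => e (i, z))) Uy); rewrite fy.
  by apply: near_box => z; apply: ceu.
move=> x hx; have bx : box c e (fun z => f j (x z.1) z.2).
  by move=> [i z]; apply: (hx i).2.
have [Ox _] := hO _ bx.
rewrite (_ : x = Psi (fun z => f j (x z.1) z.2)) //.
by apply: funext => i; rewrite /Psi /= (psiK (x i) (hx i).1).
Qed.

(** * Definably connected components *)

Section Components.
Variables (G : definable_group R) (K : nat).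
Implicit Types X C : set {ptws 'I_K -> G}.

(** For each choice of one chart per coordinate, the part of [X] inside these charts has a definable
    image in a power of M, and the connected pieces of this image are pulled back. *)
Lemma fu_definably_connected X : definable_power R (@Defs.coord _ _ _ G) X ->
  fu (@definably_connected _ _ _ G K) X.
Proof.
move=> /(definable_powerE DE) DX.
have [k [m [U [f aG]]]] := has_atlas DE G.
pose V (j : {ffun 'I_K -> 'I_m}) (x : 'I_K -> G) := forall c, U (j c) (x c).
apply: (@fu_ext _ _ (fun x => exists j, X x /\ V j x)).
  move=> x; split=> [[j []]|Xx] //.
  have /choice[j hj] : forall c, exists l, U l (x c) by move=> c; apply: at_cover aG _.
  by exists (finfun j); split=> // c; rewrite ffunE.
apply: fu_exfin => j.
pose Phi (x : 'I_K -> G) (z : 'I_K * 'I_k) : M := f (j z.1) (x z.1) z.2.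
have Phi_inj x y : V j x -> V j y -> Phi x = Phi y -> x = y.
  move=> Vx Vy E; apply: funext => c; apply: (at_inj aG (Vx c) (Vy c)).
  by apply: funext => i; have := congr1 (fun h => h (c, i)) E.
have Dgr : D1 (prodC (powC 'I_K (grpC G)) (vecC D ('I_K * 'I_k)%type)) (fun z => V j z.1 /\ Phi z.1 = z.2).
  apply: (@D1_ext _ D (prodC (powC 'I_K (grpC G)) (vecC D ('I_K * 'I_k)%type)) (fun z => forall c, U (j c) (z.1 c) /\ f (j c) (z.1 c) = (fun i => z.2 (c, i)))).
    move=> z; split=> [h|[Vz <-] c]; last by split.
    split=> [c|]; first by case: (h c).
    by apply: funext => -[c i]; rewrite /Phi /= (h c).2.
  apply: D1_allfin => c.
  have c1 := cmap_comp (@cmap_fst _ D (powC 'I_K (grpC G)) (vecC D ('I_K * 'I_k)%type))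
    (@cmap_proj _ D _ (grpC G) c).
  have c2 : cmap (prodC (powC 'I_K (grpC G)) (vecC D ('I_K * 'I_k)%type)) (vecC D 'I_k) (fun z i => z.2 (c, i)).
    by apply: (cmap_vec (@cmap_snd _ D _ _)) => i; exists (c, i).
  exact: (D1_comp (cmap_pair c1 c2) (at_def aG (j c))).
have Dimg (Y : ('I_K -> G) -> Prop) : D1 (powC 'I_K (grpC G)) Y ->
    D ('I_K * 'I_k)%type (fun u => exists x, Y x /\ V j x /\ Phi x = u).
  move=> DY; apply/D1_vec.
  apply: (@D1_ex _ D (vecC D _) (powC 'I_K (grpC G)) (fun u x => Y x /\ V j x /\ Phi x = u)).
  have c1 := @cmap_fst _ D (vecC D ('I_K * 'I_k)%type) (powC 'I_K (grpC G)).
  have c2 := @cmap_snd _ D (vecC D ('I_K * 'I_k)%type) (powC 'I_K (grpC G)).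
  by apply: D1_and; [apply: D1_comp c2 DY|apply: (D1_comp (cmap_pair c2 c1) Dgr)].
have Dpre (C : ('I_K * 'I_k -> M) -> Prop) : D _ C -> D1 (powC 'I_K (grpC G)) (fun x => V j x /\ C (Phi x)).
  move=> /D1_vec DC; apply: (@D1_ext _ D (powC 'I_K (grpC G)) (fun x => exists u, (V j x /\ Phi x = u) /\ C u)).
    by move=> x; split=> [[u [[Vx <-]]]|[Vx Cx]] //; exists (Phi x).
  apply: (@D1_ex _ D (powC 'I_K (grpC G)) (vecC D _) (fun x u => (V j x /\ Phi x = u) /\ C u)).
  by apply: D1_and => //; apply: D1_snd.
have := fu_preim (g := Phi) (B := fun x => X x /\ V j x) (Qc := @definably_connected _ _ _ G K)
   (fu_sub (fu_conn (Dimg X DX))).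
move=> h; apply: (fu_ext _ (h _)) => [x|C [[DC cC] CX] {h}].
  by split=> [[]//|[Xx Vx]]; split=> //; exists x.
have BE x : V j x -> C (Phi x) -> (X x /\ V j x) /\ C (Phi x).
  move=> Vx Cx; split=> //; have [y [Xy [Vy PE]]] := CX _ Cx.
  by rewrite -(Phi_inj y x Vy Vx PE).
split.
  apply/(definable_powerE DE); apply: D1_ext (Dpre C DC) => x.
  by split=> [[Vx /(BE x Vx)]|[[_ Vx]]].
move=> Y /(definable_powerE DE) DY sub [O1 oO1 YE1] [O2 oO2 YE2].
(* [P] is the image of [Y]. As [Y] and its complement in the pulled back piece are relatively open,
   [P] is locally constant on [C]. *)
pose P u := exists x, Y x /\ V j x /\ Phi x = u.
have PE x : V j x -> P (Phi x) <-> Y x.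
  move=> Vx; split=> [[y [Yy [Vy]]] /(Phi_inj y x Vy Vx) <- //|Yx]; by exists x.
have PEE x : V j x -> P (Phi x) = Y x by move=> Vx; apply/propext/PE.
have nearO (O : set {ptws 'I_K -> G}) x : open O -> O x -> V j x ->
    near (Phi x) (fun u => forall y, V j y -> Phi y = u -> O y).
  move=> /open_nbhsP oO /oO/nbhs_ptwsP[W [Wx WO]] Vx.
  have nc c : near (fun i => Phi x (c, i)) (fun u => forall y, U (j c) y -> f (j c) y = u -> W c y).
    apply: near_imp (at_image aG (Vx c) (Wx c)) => u [y [Uy fy Wy]] y' Uy' fy'.
    by rewrite (at_inj aG Uy' Uy) // fy fy'.
  apply: near_imp (near_prod D nc) => u hu y Vy yu; apply: WO => c.
  by apply: (hu c) (Vy c) _; rewrite -yu.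
have loc u : C u -> near u (fun v => C v -> (P v <-> P u)).
  move=> Cu; have [x [Xx [Vx xu]]] := CX u Cu; rewrite -xu PEE //.
  have Cx : ((fun x => X x /\ V j x) x) /\ C (Phi x) by split=> //; rewrite xu.
  have [Yx|nYx] := pselect (Y x).
    have O1x : O1 x by move: (Yx); rewrite {1}YE1 => -[].
    apply: near_imp (nearO O1 x oO1 O1x Vx) => v hv Cv.
    have [y [Xy [Vy yv]]] := CX v Cv; rewrite -yv PEE // {1}YE1.
    by split=> // _; split; [split=> //; rewrite yv|apply: hv].
  have O2x : O2 x.
    have : ((fun x => (X x /\ V j x) /\ C (Phi x)) `\` Y) x by split.
    by rewrite YE2 => -[].
  apply: near_imp (nearO O2 x oO2 O2x Vx) => v hv Cv.
  have [y [Xy [Vy yv]]] := CX v Cv; rewrite -yv PEE //; split=> // Yy; exfalso.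
  suff : ((fun x => (X x /\ V j x) /\ C (Phi x)) `\` Y) y by case.
  by rewrite YE2; split; [split=> //; rewrite yv|apply: hv].
have DP : Df1 D P by apply/Df1P; apply: Dimg.
have [[x Yx]|nY] := pselect (exists x, Y x); [right|left].
  apply/seteqP; split=> // y [[Xy Vy] Cy].
  have [[Xx Vx] Cx] := sub x Yx.
  by apply/(PE y Vy)/(cC P DP loc _ _ Cx Cy)/PE.
by apply/seteqP; split=> // x Yx; case: nY; exists x.
Qed.

(** A relatively clopen part contains or misses each of the two sets, and the common point [x]
    forces the same answer for both. *)
Lemma definably_connectedU C C' x : definably_connected C -> definably_connected C' ->
  C x -> C' x -> definably_connected (C `|` C').
Proof.
move=> [/(definable_powerE DE) DC cC] [/(definable_powerE DE) DC' cC'] Cx C'x; split.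
  by apply/(definable_powerE DE); apply: D1_or.
move=> Y /(definable_powerE DE) DY sub [O1 oO1 YE1] [O2 oO2 YE2].
have half (B : set {ptws 'I_K -> G}) : D1 (powC 'I_K (grpC G)) B -> B `<=` C `|` C' ->
    (forall D0, definable_power R (@Defs.coord _ _ _ G) D0 -> D0 `<=` B ->
    (exists2 O, open O & D0 = B `&` O) -> (exists2 O, open O & B `\` D0 = B `&` O) ->
    D0 = set0 \/ D0 = B) -> Y `&` B = set0 \/ B `<=` Y.
  move=> DB sB cB; have [| | | |->|YB] := cB (Y `&` B); [| | | |by left|].
  - by apply/(definable_powerE DE); apply: D1_and.
  - by move=> y [].
  - exists O1 => //; rewrite YE1; apply/seteqP; split=> y; first by case=> -[].
    by case=> By Oy; split=> //; split=> //; apply: sB.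
  - exists O2 => //; apply/seteqP; split=> y.
      case=> By nY; have : ((C `|` C') `\` Y) y by split; [apply: sB|move=> Yy; apply: nY].
      by rewrite YE2 => -[].
    move=> [By Oy]; split=> // -[Yy _].
    have : ((C `|` C') `\` Y) y by rewrite YE2; split=> //; apply: sB.
    by case.
  - by right=> y By; have [] : (Y `&` B) y by rewrite YB.
have h1 := half C DC (@subsetUl _ _ _) cC; have h2 := half C' DC' (@subsetUr _ _ _) cC'.
case: h1 h2 => [E|CY] [E'|C'Y].
- left; apply/seteqP; split=> // y Yy; case: (sub y Yy) => ?.
    by rewrite -E; split.
  by rewrite -E'; split.
- suff : (@set0 {ptws 'I_K -> G}) x by [].
  by rewrite -E; split=> //; apply: C'Y.
- suff : (@set0 {ptws 'I_K -> G}) x by [].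
  by rewrite -E'; split=> //; apply: CY.
- right; apply/seteqP; split=> // y [/CY|/C'Y] //.
Qed.

(** Among the connected unions of sets [C l] that include a given one, take one with the most
    indices. If a connected [Y] inside [X] contains it, adjoining to it every [C l] that meets [Y]
    gives a connected union covering [Y]; by maximality no index is new. *)
Lemma fu_components X : definable_power R (@Defs.coord _ _ _ G) X -> fu (definable_component X) X.
Proof.
move=> /fu_definably_connected/fu_family[n [C [dC XE]]].
pose un (S : {set 'I_n}) : set {ptws 'I_K -> G} := fun x => exists2 i, i \in S & C i x.
apply: (@fu_ext _ _ (fun x => exists i, C i x)); first by move=> x; rewrite XE.
have comp i x : C i x -> exists2 S, definable_component X (un S) & un S x.
  move=> Cix.
  pose p (S : {set 'I_n}) := `[< definably_connected (un S) >] && (i \in S).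
  have un1 : un [set i]%SET = C i.
    by apply/seteqP; split=> y; [case=> l /set1P ->|exists i; rewrite ?set11].
  have p1 : p [set i]%SET by rewrite /p set11 un1 andbT; apply/asboolP.
  case: (arg_maxnP (fun S : {set 'I_n} => #|S|) p1) => S /andP[/asboolP cS iS] maxS.
  exists S; last by exists i.
  split=> //; first by move=> y [l _ Cl]; apply/XE; exists l.
    by exists x, i.
  move=> Y cY SY YX; apply/seteqP; split=> //.
  pose J := [set l | `[< exists y, C l y /\ Y y >]]%SET.
  have unJ : un (S :|: J)%SET = Y `|` un J.
    apply/seteqP; split=> y.
      by case=> l /setUP[lS|lJ] Cl; [left; apply: SY|right]; exists l.
    case=> [Yy|[l lJ Cl]]; last by exists l => //; apply/setUP; right.
    have /XE[l Cl] := YX y Yy; exists l => //; apply/setUP; right.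
    by rewrite inE; apply/asboolP; exists y.
  have cJ : definably_connected (un (S :|: J)%SET).
    rewrite unJ (_ : un J = fun x => exists2 l, l \in enum J & C l x); last first.
      by apply/seteqP; split=> y [l ? ?]; exists l; rewrite ?mem_enum // -mem_enum.
    have : forall l, l \in enum J -> exists y, C l y /\ Y y.
      by move=> l; rewrite mem_enum inE => /asboolP.
    elim: (enum J) => [_|l s IHs hs].
      rewrite (_ : _ `|` _ = Y) //; apply/seteqP; split=> y; last by left.
      by case=> // -[].
    have [y [Cl Yy]] : exists y, C l y /\ Y y by apply: hs; rewrite inE eqxx.
    rewrite (_ : _ `|` _ = C l `|` (Y `|` (fun x => exists2 l0, l0 \in s & C l0 x))).
      apply: (@definably_connectedU _ _ y) => //; last by left.
      by apply: IHs => l' ls; apply: hs; rewrite inE ls orbT.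
    apply/seteqP; split=> z.
      case=> [Yz|[l']]; first by right; left.
      by rewrite inE => /orP[/eqP->|ls] Cz; [left|right; right; exists l'].
    case=> [Cz|[Yz|[l' ls Cz]]]; [right|by left|right].
      by exists l => //; rewrite inE eqxx.
    by exists l' => //; rewrite inE ls orbT.
  have pJ : p (S :|: J)%SET.
    by rewrite /p; apply/andP; split; [apply/asboolP|apply/setUP; left].
  have SE : S = (S :|: J)%SET.
    by apply/eqP; rewrite eqEcard finset.subsetUl; apply: maxS.
  move=> y Yy; rewrite SE unJ; by left.
apply: (@fu_ext _ _ (fun x => exists S, (definable_component X (un S) /\ un S x))).
  move=> x; split=> [[S [_ [i _ Ci]]]|[i /comp[S ? ?]]]; first by exists i.
  by exists S.
apply: fu_exfin => S.
have [cS|ncS] := pselect (definable_component X (un S)).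
  by apply: (fu_ext _ (fu1 cS)) => x; split=> [|[]].
by apply: (fu_ext _ (fu0 _)) => x; split=> // -[].
Qed.

End Components.
End Continuity.

(** * Central extensions and commutator words *)

Section TopologicalGroups.
Variables (H : topologicalGroupType) (T : Type) (F : set_system T).
Context {FF : Filter F}.

Lemma cvg_mulg (f g : T -> H) (a b : H) : f @ F --> a -> g @ F --> b ->
  (fun t => f t * g t) @ F --> a * b.
Proof.
by move=> fa gb; apply: (cvg_comp _ _ (cvg_pair fa gb) (@mulg_continuous H (a, b))).
Qed.

Lemma cvg_invg (f : T -> H) (a : H) : f @ F --> a -> (fun t => (f t)^-1) @ F --> a^-1.
Proof. by move=> fa; apply: (cvg_comp _ _ fa (@invg_continuous H a)). Qed.

Lemma cvg_prodg (I : Type) (l : seq I) (f : I -> T -> H) (a : I -> H) :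
  (forall j, f j @ F --> a j) -> (fun t => \prod_(j <- l) f j t) @ F --> \prod_(j <- l) a j.
Proof.
move=> fa; elim: l => [|j l IHl].
  have -> : (fun t => \prod_(j <- [::]) f j t) = (fun _ => 1).
    by apply: funext => t; rewrite big_nil.
  by rewrite big_nil; apply: cvg_cst.
have -> : (fun t => \prod_(i <- j :: l) f i t) = (fun t => f j t * \prod_(i <- l) f i t).
  by apply: funext => t; rewrite big_cons.
by rewrite big_cons; apply: cvg_mulg.
Qed.

End TopologicalGroups.

Section GroupMorphisms.
Variables (G H : groupType) (f : {multiplicative G -> H}).

Lemma morph1 : f 1 = 1.
Proof. by apply: (mulgI (f 1)); rewrite -gmulfM !mulg1. Qed.

Lemma morphV x : f x^-1 = (f x)^-1.
Proof. by apply: (mulgI (f x)); rewrite -gmulfM !mulgV morph1. Qed.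

Lemma morph_prod n (x : 'I_n -> G) : f (\prod_(j < n) x j) = \prod_(j < n) f (x j).
Proof. exact: (big_morph f (@gmulfM _ _ f) morph1). Qed.

End GroupMorphisms.

Section CommutatorProducts.
Variable H : groupType.

Lemma commutator_productsM m n (a b : H) : commutator_products H m a ->
  commutator_products H n b -> commutator_products H (m + n) (a * b).
Proof.
move=> [x [y ->]] [x' [y' ->]].
exists (fun k => match fintype.split k with inl k => x k | inr k => x' k end),
       (fun k => match fintype.split k with inl k => y k | inr k => y' k end).
rewrite big_split_ord /=; congr (_ * _); apply: eq_bigr => k _.
  by rewrite -[lshift _ k]/(unsplit (inl k)) unsplitK.
by rewrite -[rshift _ k]/(unsplit (inr k)) unsplitK.
Qed.

(** The inverse of a commutator is the commutator of the swapped pair, and the order of the factors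
    is reversed. *)
Lemma commutator_productsV n (a : H) :
  commutator_products H n a -> commutator_products H n a^-1.
Proof.
move=> [x [y ->]]; exists (fun k => y (rev_ord k)), (fun k => x (rev_ord k)).
elim: n x y => [|n IHn] x y; first by rewrite !big_ord0 invg1.
rewrite big_ord_recl invgM IHn big_ord_recr /=; congr (_ * _).
  apply: eq_bigr => k _; rewrite (_ : rev_ord (widen_ord _ k) = lift ord0 (rev_ord k)) //.
  by apply: val_inj; rewrite /= /bump /= subSn.
rewrite (_ : rev_ord ord_max = ord0); last by apply: val_inj; rewrite /= subnn.
by rewrite !invgM !invgK !mulgA.
Qed.

End CommutatorProducts.

Section CommutatorWords.
Variables (r : nat) (G H : groupType).

(** Three words, each of [r] commutators with two letters. The index is numbered when used, because
    tuples of variables in the theorem are indexed by ordinals. *)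
Definition word_index := ('I_3 * ('I_r * bool))%type.
Definition letter (x : 'I_#|{: word_index}| -> G) s j b : G := x (enum_rank ((s, (j, b)) : word_index)).

Definition comm_word (c : G -> G -> H) (y : 'I_r * bool -> G) : H :=
  \prod_(j < r) c (y (j, true)) (y (j, false)).

(** This is [w] when [c] is the lifted commutator; with the commutator of G it is the image of [w]
    under [p]. *)
Definition triple_word (c : G -> G -> H) (x : 'I_#|{: word_index}| -> G) : H :=
  comm_word c (fun z => letter x (@Ordinal 3 0 isT) z.1 z.2) *
  comm_word c (fun z => letter x (@Ordinal 3 1 isT) z.1 z.2) *
  (comm_word c (fun z => letter x (@Ordinal 3 2 isT) z.1 z.2))^-1.

End CommutatorWords.

Definition commutator (G : groupType) (x y : G) := x * y * x^-1 * y^-1.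

Section Commutators.
Variable H : groupType.
Implicit Types x y z : H.

Lemma commutator_centralL x y z : (forall w, z * w = w * z) -> commutator (x * z) y = commutator x y.
Proof.
by move=> zC; rewrite /commutator invgM -(mulgA x) zC !mulgA mulgK.
Qed.

Lemma commutator_centralR x y z : (forall w, z * w = w * z) -> commutator x (y * z) = commutator x y.
Proof.
move=> zC; rewrite /commutator -(zC y) invgM (mulgA x) -(zC x) -!mulgA zC -!mulgA mulVg mulg1.
by rewrite !mulgA.
Qed.

Lemma commutatorMl x y z : commutator (x * y) z = x * commutator y z * x^-1 * commutator x z.
Proof. by rewrite /commutator invgM !mulgA !mulgVK. Qed.

Lemma commutatorMr x y z : commutator x (y * z) = commutator x y * (y * commutator x z * y^-1).
Proof. by rewrite /commutator invgM !mulgA !mulgVK. Qed.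

Lemma commutatorC x y : commutator x y = (commutator y x)^-1.
Proof. by rewrite /commutator !invgM !invgK !mulgA. Qed.

End Commutators.

(** * Lifted commutators in a definable central extension *)

Section Extension.
Context {d : Order.disp_t} {M : orderType d} {R : relations M} (D : ominsys M).
Hypothesis DE : forall I (X : set (I -> M)), definable_in_M R X <-> D I X.
Variables (A Gt G : definable_group R).
Variables (i : {multiplicative A -> Gt}) (p : {multiplicative Gt -> G}).
Hypotheses (hp : definable_map p) (hE : central_extension i p).
Local Notation grpC := (grpC DE).

Let i_inj : injective i. Proof. by case: hE => -[]. Qed.
Let i_ker x : p x = 1 -> exists a, i a = x.
Proof.
case: hE => -[_ E _] _ px; have [a _ <-] : range i x by rewrite E.
by exists a.
Qed.
Let p_i a : p (i a) = 1.
Proof.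
case: hE => -[_ E _] _; have : range i (i a) by exists a.
by rewrite E.
Qed.
Let p_surj x : exists y, p y = x.
Proof.
case: hE => -[_ _ E] _; have [y _ <-] : range p x by rewrite E.
by exists y.
Qed.
Let i_central a x : i a * x = x * i a. Proof. by case: hE. Qed.

Lemma lift_of_section : exists s : G -> Gt, forall x, p (s x) = x.
Proof. by have /choice[s hs] := p_surj; exists s. Qed.

Variables (lift : G -> Gt).
Hypothesis liftK : forall x, p (lift x) = x.

(** The commutator of lifts to the central extension depends only on the elements lifted. *)
Definition c2 (x y : G) : Gt := commutator (lift x) (lift y).

(** Two preimages of the same element differ by an element of [i A], which is central and drops out
    of a commutator. So [c2] does not depend on [lift], an arbitrary section that need be neither
    definable nor continuous. *)
Lemma c2E u v : commutator u v = c2 (p u) (p v).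
Proof.
have lE w : exists a, w = lift (p w) * i a.
  have [|a ia] := @i_ker ((lift (p w))^-1 * w); first by rewrite gmulfM morphV liftK mulVg.
  by exists a; rewrite ia mulVKg.
have [a ->] := lE u; have [b ->] := lE v.
rewrite !gmulfM !p_i !mulg1 !liftK.
by rewrite commutator_centralL ?commutator_centralR.
Qed.

Lemma c2Ml x y z : c2 (x * y) z = lift x * c2 y z * (lift x)^-1 * c2 x z.
Proof.
rewrite -[in LHS](liftK x) -[in LHS](liftK y) -[in LHS](liftK z) -gmulfM -c2E.
exact: commutatorMl.
Qed.

Lemma c2Mr x y z : c2 x (y * z) = c2 x y * (lift y * c2 x z * (lift y)^-1).
Proof.
rewrite -[in LHS](liftK x) -[in LHS](liftK y) -[in LHS](liftK z) -gmulfM -c2E.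
exact: commutatorMr.
Qed.

(** By [c2E] any preimages may replace the values of [lift], so one quantifies over preimages and
    [lift] disappears from the definition. *)
Lemma cmap_c2 : cmap (prodC (grpC G) (grpC G)) (grpC Gt) (fun z => c2 z.1 z.2).
Proof.
apply: (@D1_ext _ D (prodC (prodC (grpC G) (grpC G)) (grpC Gt))
  (fun z => exists w : prodC (grpC Gt) (grpC Gt),
     (p w.1 = z.1.1 /\ p w.2 = z.1.2) /\ commutator w.1 w.2 = z.2)).
  move=> [[x y] z] /=; split=> [[[u v] /= [[<- <-] <-]]|<-]; first by rewrite c2E.
  by exists (lift x, lift y); rewrite /= !liftK.
set S := prodC (prodC _ _) _; set W := prodC _ _.
apply: (@D1_ex _ D S W (fun z w => (p w.1 = z.1.1 /\ p w.2 = z.1.2) /\ commutator w.1 w.2 = z.2)).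
have c1 := @cmap_fst _ D S W; have c2' := @cmap_snd _ D S W.
have w1 := cmap_comp c2' (@cmap_fst _ D (grpC Gt) (grpC Gt)).
have w2 := cmap_comp c2' (@cmap_snd _ D (grpC Gt) (grpC Gt)).
have z1 := cmap_comp c1 (@cmap_fst _ D (prodC (grpC G) (grpC G)) (grpC Gt)).
have Dp := cmap_definable_map DE hp.
apply: D1_and; first apply: D1_and.
- exact: (cmap_eq (T := grpC G) (cmap_comp w1 Dp) (cmap_comp z1 (@cmap_fst _ D _ _))).
- exact: (cmap_eq (T := grpC G) (cmap_comp w2 Dp) (cmap_comp z1 (@cmap_snd _ D _ _))).
- apply: (cmap_eq (T := grpC Gt)); last exact: (cmap_comp c1 (@cmap_snd _ D _ _)).
  by apply: cmap_mul; [apply: cmap_mul; [apply: cmap_mul|]|]; try apply: cmap_inv.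
Qed.

(** A definable map is continuous somewhere; the identities [c2Ml] and [c2Mr]
    propagate continuity of the commutator map to every point. *)
Lemma c2_contr x y : c2 x v @[v --> y] --> c2 x y.
Proof.
have [w0 hw] : exists w0 : G, c2 x v @[v --> w0] --> c2 x w0.
  have [|w0 hw0] := @continuity_point _ _ _ D DE G Gt unit (fun w => c2 x (w tt)).
    apply: (@cmap_comp _ D (powC unit (grpC G)) (prodC (grpC G) (grpC G)) (grpC Gt) (fun w => (x, w tt)) _ _ cmap_c2).
    by apply: cmap_pair; [apply: cmap_const|apply: cmap_proj].
  exists (w0 tt) => O /hw0/nbhs_ptwsP[W [Ww hW]].
  by apply: filterS (Ww tt) => v Wv; apply: (hW (fun _ => v)) => -[].
(* As [v] tends to [y], [z^-1 * v] tends to [w0]. The factors containing [z] are constants, so no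
   continuity of [lift] is involved. *)
pose z := y * w0^-1.
have E : c2 x = fun v => c2 x z * (lift z * c2 x (z^-1 * v) * (lift z)^-1).
  by apply: funext => v; rewrite -c2Mr mulVKg.
rewrite E; apply: cvg_mulg; first exact: cvg_cst.
apply: cvg_mulg; last exact: cvg_cst.
apply: cvg_mulg; first exact: cvg_cst.
have zy : z^-1 * y = w0 by rewrite /z invgM invgK mulgVK.
rewrite zy; apply: (cvg_comp _ _ _ hw); rewrite -zy.
by apply: cvg_mulg; [apply: cvg_cst|apply: cvg_id].
Qed.

Lemma c2_contl x y : c2 v y @[v --> x] --> c2 x y.
Proof.
rewrite (_ : c2^~ y = fun v => (c2 y v)^-1); last first.
  by apply: funext => v; apply: commutatorC.
rewrite [c2 x y]commutatorC; exact: cvg_invg (@c2_contr y x).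
Qed.

(** Joint continuity holds at one pair by [continuity_point]. It is moved in the first variable,
    then in the second; each correction factor depends on one variable and is covered by [c2_contr]
    or [c2_contl]. *)
Lemma c2_continuous x y : c2 z.1 z.2 @[z --> (x, y)] --> c2 x y.
Proof.
have [x0 [y0 h0]] : exists x0 y0 : G, c2 z.1 z.2 @[z --> (x0, y0)] --> c2 x0 y0.
  have [|w0 hw0] := @continuity_point _ _ _ D DE G Gt bool (fun w => c2 (w true) (w false)).
    apply: (@cmap_comp _ D (powC bool (grpC G)) (prodC (grpC G) (grpC G)) (grpC Gt) (fun w => (w true, w false)) _ _ cmap_c2).
    by apply: cmap_pair; apply: cmap_proj.
  exists (w0 true), (w0 false) => O /hw0/nbhs_ptwsP[W [Ww hW]].
  exists (W true, W false); first by split; apply: Ww.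
  by move=> [u v] /= [Wu Wv]; apply: (hW (fun b => if b then u else v)); case.
have h1 : c2 z.1 z.2 @[z --> (x, y0)] --> c2 x y0.
  pose g := x * x0^-1; have gx : g^-1 * x = x0 by rewrite /g invgM invgK mulgVK.
  have E : (fun z : G * G => c2 z.1 z.2) =
      (fun z => lift g * c2 (g^-1 * z.1) z.2 * (lift g)^-1 * c2 g z.2).
    by apply: funext => z; rewrite -c2Ml mulVKg.
  have -> : c2 x y0 = lift g * c2 (g^-1 * x) y0 * (lift g)^-1 * c2 g y0.
    by rewrite -c2Ml mulVKg.
  rewrite E; apply: cvg_mulg; last by apply: (cvg_comp _ _ _ (@c2_contr g y0)); apply: cvg_snd.
  apply: cvg_mulg; last exact: cvg_cst.
  apply: cvg_mulg; first exact: cvg_cst.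
  rewrite gx; apply: (cvg_comp (fun z : G * G => (g^-1 * z.1, z.2)) _ _ h0).
  apply: cvg_pair; last exact: cvg_snd.
  by rewrite -gx; apply: cvg_mulg; [apply: cvg_cst|apply: cvg_fst].
pose g := y * y0^-1; have gy : g^-1 * y = y0 by rewrite /g invgM invgK mulgVK.
have E : (fun z : G * G => c2 z.1 z.2) =
    (fun z => c2 z.1 g * (lift g * c2 z.1 (g^-1 * z.2) * (lift g)^-1)).
  by apply: funext => z; rewrite -c2Mr mulVKg.
have -> : c2 x y = c2 x g * (lift g * c2 x (g^-1 * y) * (lift g)^-1).
  by rewrite -c2Mr mulVKg.
rewrite E; apply: cvg_mulg; first by apply: (cvg_comp _ _ _ (@c2_contl x g)); apply: cvg_fst.
apply: cvg_mulg; last exact: cvg_cst.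
apply: cvg_mulg; first exact: cvg_cst.
rewrite gy; apply: (cvg_comp (fun z : G * G => (z.1, g^-1 * z.2)) _ _ h1).
apply: cvg_pair; first exact: cvg_fst.
by rewrite -gy; apply: cvg_mulg; [apply: cvg_cst|apply: cvg_snd].
Qed.

Variable r : nat.
Local Notation k := #|{: word_index r}|.
Definition phi (x : {ptws 'I_k -> G}) : Gt := triple_word c2 x.
Definition relator (x : {ptws 'I_k -> G}) : G := triple_word (@commutator G) x.

Lemma p_comm_word y : p (comm_word (r := r) c2 y) = comm_word (@commutator G) y.
Proof.
rewrite /comm_word morph_prod; apply: eq_bigr => j _.
by rewrite /c2 /commutator !gmulfM !morphV !liftK.
Qed.

Lemma p_phi x : p (phi x) = relator x.
Proof. by rewrite /phi /relator /triple_word !gmulfM morphV !p_comm_word. Qed.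

Lemma phi_continuous : continuous phi.
Proof.
move=> x; have FF : Filter (nbhs x) := @nbhs_filter {ptws 'I_k -> G} x.
have cw s : comm_word c2 (fun z => letter y s z.1 z.2) @[y --> x] -->
    comm_word c2 (fun z => letter x s z.1 z.2).
  apply: (@cvg_prodg _ _ _ FF) => j.
  apply: (cvg_comp (fun y : {ptws 'I_k -> G} => (letter y s j true, letter y s j false)) _ _ (@c2_continuous _ _)).
  by apply: (@cvg_pair _ _ _ _ _ _ FF); [exact: (@proj_continuous _ (fun _ => G) _ x)|exact: (@proj_continuous _ (fun _ => G) _ x)].
by apply: (@cvg_mulg _ _ _ FF); [apply: (@cvg_mulg _ _ _ FF)|apply: cvg_invg]; apply: cw.
Qed.

Lemma cmap_triple_word (H : definable_group R) (c : G -> G -> H) :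
  cmap (prodC (grpC G) (grpC G)) (grpC H) (fun z => c z.1 z.2) ->
  cmap (powC 'I_k (grpC G)) (grpC H) (triple_word c).
Proof.
move=> Dc; have cw s : cmap (powC 'I_k (grpC G)) (grpC H) (fun x => comm_word c (fun z => letter x s z.1 z.2)).
  apply: cmap_prod => j.
  apply: (@cmap_comp _ D (powC 'I_k (grpC G)) (prodC (grpC G) (grpC G)) (grpC H) (fun x => (letter x s j true, letter x s j false)) _ _ Dc).
  by apply: cmap_pair; apply: cmap_proj.
by apply: cmap_mul; [apply: cmap_mul|apply: cmap_inv].
Qed.

Definition relation_set : set {ptws 'I_k -> G} := [set x | relator x = 1].

Lemma definable_relation_set : definable_power R (@Defs.coord _ _ _ G) relation_set.
Proof.
apply/(definable_powerE DE); apply: (cmap_eq (T := grpC G)); last exact: cmap_const.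
apply: cmap_triple_word.
have c1 := @cmap_fst _ D (grpC G) (grpC G); have c2' := @cmap_snd _ D (grpC G) (grpC G).
by apply: cmap_mul; [apply: cmap_mul; [apply: cmap_mul|]|]; try apply: cmap_inv.
Qed.

Hypothesis h2 : forall n : nat, finite_set (range i `&` commutator_products Gt n).

Lemma phi_relation x : relation_set x -> exists a, i a = phi x.
Proof. by move=> Xx; apply: i_ker; rewrite p_phi. Qed.

(** On [relation_set] the values lie in [i A] and are products of [r + r + r] commutators, the
    inverse of a product of [r] commutators being another one. *)
Lemma finite_phi : finite_set (phi @` relation_set).
Proof.
apply: sub_finite_set (h2 (r + r + r)) => _ [x Xx <-]; split.
  by have [a <-] := phi_relation Xx; exists a.
have cw (y : 'I_r * bool -> G) : commutator_products Gt r (comm_word c2 y).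
  by exists (fun j => lift (y (j, true))), (fun j => lift (y (j, false))).
by apply: commutator_productsM; [apply: commutator_productsM|apply: commutator_productsV]; apply: cw.
Qed.

(** Finitely many values in a T1 space: by continuity each level set of [phi] in [C] is relatively
    clopen. It is also definable, so definable connectedness applies. *)
Lemma phi_component C x y : definable_component relation_set C -> C x -> C y -> phi x = phi y.
Proof.
move=> [CX _ [DC cC] _] Cx Cy; have /(definable_powerE DE) DC' := DC.
have [s sE] : exists s : seq Gt, forall z, C z -> phi z \in s.
  have /finite_seqP[s sE] := finite_phi; exists s => z Cz.
  have : (phi @` relation_set) (phi z) by exists z => //; apply: CX.
  by rewrite sE.
have nbv v : nbhs v [set h | forall u, u \in s -> u <> v -> h <> u].
  elim: (s) => [|u l IHl]; first by apply: filterS (@filterT _ (nbhs v) _) => h _ u.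
  have nu : nbhs v [set h | u <> v -> h <> u].
    have [->|uv] := pselect (u = v); first by apply: filterS (@filterT _ (nbhs v) _) => h _ /(_ erefl).
    by apply: filterS (accessible_group DE (not_eq_sym uv)) => h hu _.
  apply: filterS (filterI nu IHl) => h [h1 h3] w; rewrite inE => /orP[/eqP->//|]; exact: h3.
pose O v := phi @^-1` [set h | forall u, u \in s -> u <> v -> h <> u]^°.
have oO v : open (O v).
  by apply: open_comp (open_interior _) => z _; apply: phi_continuous.
have OE v z : C z -> (phi z = v) <-> O v z.
  move=> Cz; split=> [<-|/interior_subset h]; first exact: nbv.
  by apply: contrapT => nz; apply: (h (phi z)) => //; apply: sE.
have [||||E|E] := cC (C `&` [set z | phi z = phi x]).
- apply/(definable_powerE DE); apply: D1_and => //.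
  by apply: (cmap_eq (T := grpC Gt)); [apply: cmap_triple_word cmap_c2|apply: cmap_const].
- by move=> z [].
- exists (O (phi x)) => //; apply/seteqP.
  by split=> z [Cz] /OE h; split=> //; apply: h.
- exists (\bigcup_(v in [set v | v <> phi x]) O v).
    by apply: bigcup_open => v _; apply: oO.
  apply/seteqP; split=> z.
    by move=> [Cz nz]; split=> //; exists (phi z); [move=> E; apply: nz|apply/OE].
  by move=> [Cz [v vx /(OE _ _ Cz) zv]]; split=> // -[_ zx]; apply: vx; rewrite -zv.
- by have : set0 x by rewrite -E.
- by have [] : (C `&` [set z | phi z = phi x]) y by rewrite E.
Qed.

(** [f] takes the constant value of [phi] on each component and the value 1 on sets that are not
    components. Each point of [relation_set] lies in some component because there is a finite cover
    by components. *)
Lemma component_map : exists f : set {ptws 'I_k -> G} -> A, forall x a,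
  component_map_graph relation_set f x a <-> relation_set x /\ phi x = i a.
Proof.
have /choice[f hf] : forall C : set {ptws 'I_k -> G}, exists a,
    definable_component relation_set C -> forall x, C x -> phi x = i a.
  move=> C; have [cC|nC] := pselect (definable_component relation_set C); last by exists 1.
  have [CX [x Cx] _ _] := cC; have [a ia] := phi_relation (CX x Cx).
  by exists a => _ y Cy; rewrite ia; apply: phi_component cC Cy Cx.
exists f => x a; split=> [[C [cC Cx <-]]|[Xx pa]].
  by split; [case: cC => CX _ _ _; apply: CX|apply: hf].
have [C cC Cx] := fu_mem (fu_components DE definable_relation_set) Xx.
by exists C; split=> //; apply: i_inj; rewrite -(hf C cC x Cx).
Qed.

End Extension.

(** * Interpretations and canonical parameters *)

Section LogicTools.
Variable N : structure.
Implicit Types V W : sorts N -> Type.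

Definition no_params : env (fun _ : sorts N => void) := fun s x => match x with end.

Definition zero_class := definable_class no_params.

Lemma zeroE V (P : env V -> Prop) : zero_class V P <-> definable0 P.
Proof.
split=> -[phi hphi].
  pose q s (x : V s + void) : V s := match x with inl v => v | inr u => match u with end end.
  exists (frename phi q) => e; rewrite hphi sat_frename.
  by rewrite (_ : join_env e no_params = fun s x => e s (q s x)) //; apply: env_ext => s [v|[]].
pose q s (x : V s) : V s + void := inl x.
by exists (frename phi q) => e; rewrite hphi sat_frename.
Qed.

Definition vec_vars V s n : sorts N -> Type := fun t => (V t + ('I_n * (s = t)))%type.

Lemma dc_exv (C : defclass N) V s n (P : env V -> ('I_n -> dom N s) -> Prop) :
  C (vec_vars V s n) (fun e => P (fun t x => e t (inl x)) (fun j => e s (inr (j, erefl)))) ->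
  C V (fun e => exists v, P e v).
Proof.
elim: n V P => [|n IHn] V P CP.
  have v0 : 'I_0 -> dom N s by case.
  have E (v : 'I_0 -> dom N s) : v = v0 by apply: funext; case.
  apply: (@dc_ext _ C _ (fun e => P e v0)).
    by move=> e; split=> [h|[v]]; [exists v0|rewrite (E v)].
  pose q t (x : vec_vars V s 0 t) : V t :=
    match x with inl v => v | inr (j, _) => match j with Ordinal _ h => False_rect _ (notF h) end end.
  apply: (dc_ext _ (dc_ren q CP)) => e; by rewrite (E (fun j => _)).
apply: (@dc_ext _ C _ (fun e => exists a v, P e (cons a v))).
  move=> e; split=> [[a [v Pv]]|[v Pv]]; first by exists (cons a v).
  by exists (v ord0), (tl v); rewrite cons_tl.
apply: (@dc_ex _ C _ _ (fun e a => exists v, P e (cons a v))); apply: IHn.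
pose q t (x : vec_vars V s n.+1 t) : vec_vars (ext_vars V s) s n t :=
  match x with
  | inl v => inl (inl v)
  | inr (k, h) => if unlift ord0 k is Some j then inr (j, h) else inl (inr h)
  end.
apply: (dc_ext _ (dc_ren q CP)) => e.
rewrite (_ : (fun j => e s (q s (inr (j, erefl)))) =
   cons (e s (inl (inr erefl))) (fun j => e s (inr (j, erefl)))) //.
by apply: funext => k; rewrite /q /cons; case: unliftP.
Qed.

Lemma interpretation (N' : structure) (C : defclass N') (sg : sorts N -> sorts N')
    (tau : forall s, dom N' (sg s) -> dom N s) (tau' : forall s, dom N s -> dom N' (sg s)) :
  (forall s a, tau s (tau' s a) = a) -> (forall s a, tau' s (tau s a) = a) ->
  (forall r (V' : sorts N' -> Type) (x : forall s, arity N r s -> V' (sg s)),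
    C V' (fun e => interp r (fun s z => tau s (e (sg s) (x s z))))) ->
  forall V (phi : formula V) (V' : sorts N' -> Type) (q : forall s, V s -> V' (sg s)),
    C V' (fun e => sat phi (fun s v => tau s (e (sg s) (q s v)))).
Proof.
move=> tK t'K hr V phi; elim: phi => {V} [V|V s x y|V r x|V phi IH1 psi IH2|V s phi IH] V' q /=.
- exact: dc_bot.
- apply: (dc_ext _ (dc_eqv C (q s x) (q s y))) => e.
  by split=> [->//|h]; rewrite -(t'K s (e _ (q s x))) h t'K.
- exact: hr.
- exact: dc_imp.
apply: (@dc_ext _ C _ (fun e => exists a' : dom N' (sg s),
    sat phi (ext_env (fun s v => tau s (e (sg s) (q s v))) (tau s a')))).
  move=> e; split=> [[a' h]|[a h]]; first by exists (tau s a').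
  by exists (tau' s a); rewrite tK.
apply: dc_ex.
pose q' t (x : ext_vars V s t) : ext_vars V' (sg s) (sg t) :=
  match x with inl v => inl (q t v) | inr h => inr (congr1 sg h) end.
apply: (dc_ext _ (IH _ q')) => e.
rewrite (_ : (fun t v => _) = ext_env (fun t v => tau t (e (sg t) (inl (q t v)))) (tau s (e (sg s) (inr erefl)))) //.
by apply: env_ext => t [v|h] //=; case: t / h.
Qed.

End LogicTools.

Section GroupWords.
Variables (N : structure) (C : defclass N) (s : sorts N) (H : groupType).
Variables (tau : dom N s -> H) (tau' : H -> dom N s).
Hypotheses (tK : cancel tau' tau) (t'K : cancel tau tau').
Hypothesis C_mul : forall V (x y z : V s), C V (fun e => tau (e s x) * tau (e s y) = tau (e s z)).
Implicit Types V : sorts N -> Type.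

(** A group-valued term is in the class when its graph is. [tau] lets the elements of a sort be
    typed as elements of the group; it is the identity in all uses. *)
Definition Cfun V (t : env V -> H) :=
  C (ext_vars V s) (fun e => t (fun u x => e u (inl x)) = tau (e s (inr erefl))).

Lemma dc_exH V (P : env V -> H -> Prop) :
  C (ext_vars V s) (fun e => P (fun t x => e t (inl x)) (tau (e s (inr erefl)))) ->
  C V (fun e => exists a, P e a).
Proof.
move=> CP; apply: (@dc_ext _ C _ (fun e => exists a, P e (tau a))).
  by move=> e; split=> [[a]|[a]]; [exists (tau a)|exists (tau' a); rewrite tK].
exact: (@dc_ex _ C _ _ (fun e a => P e (tau a))).
Qed.

Lemma Cfun_rel V (t : env V -> H) : Cfun t -> forall V' (q : forall u, V u -> V' u) z,
  C V' (fun e => t (fun u x => e u (q u x)) = tau (e s z)).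
Proof.
move=> Ct V' q z.
pose q' u (x : ext_vars V s u) : V' u :=
  match x with inl v => q u v | inr h => match h in _ = u return V' u with erefl => z end end.
exact: (dc_ren q' Ct).
Qed.

Lemma Cfun_var V (x : V s) : Cfun (fun e => tau (e s x)).
Proof.
apply: (dc_ext _ (@dc_eqv _ C (ext_vars V s) s (inl x) (inr erefl))) => e.
by split=> [->|/(can_inj t'K)].
Qed.

Lemma Cfun_eq V (t u : env V -> H) : Cfun t -> Cfun u -> C V (fun e => t e = u e).
Proof.
move=> Ct Cu; apply: (@dc_ext _ C _ (fun e => exists a, t e = a /\ u e = a)).
  by move=> e; split=> [[a [-> ->]]|E] //; exists (t e).
by apply: dc_exH; apply: dc_and.
Qed.

Lemma Cfun_mul V (t u : env V -> H) : Cfun t -> Cfun u -> Cfun (fun e => t e * u e).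
Proof.
move=> Ct Cu; rewrite /Cfun.
apply: (@dc_ext _ C _ (fun e : env (ext_vars V s) => exists a b,
  t (fun u x => e u (inl x)) = a /\ u (fun u x => e u (inl x)) = b /\ a * b = tau (e s (inr erefl)))).
  by move=> e; split=> [[a [b [<- [<-]]]]|E] //; do 2!eexists.
apply: dc_exH; apply: dc_exH.
apply: dc_and; first exact: (@Cfun_rel _ _ Ct _ (fun u x => inl (inl (inl x))) (inl (inr erefl))).
apply: dc_and; first exact: (@Cfun_rel _ _ Cu _ (fun u x => inl (inl (inl x))) (inr erefl)).
exact: (@C_mul (ext_vars (ext_vars (ext_vars V s) s) s) (inl (inr erefl)) (inr erefl) (inl (inl (inr erefl)))).
Qed.

(** The unit is the only idempotent. *)
Lemma Cfun_one V : Cfun (fun _ : env V => 1).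
Proof.
apply: (dc_ext _ (@C_mul (ext_vars V s) (inr erefl) (inr erefl) (inr erefl))) => e.
by split=> [E|<-]; rewrite ?mulg1 //; apply/esym/(mulgI (tau (e s (inr erefl)))); rewrite E mulg1.
Qed.

Lemma Cfun_inv V (t : env V -> H) : Cfun t -> Cfun (fun e => (t e)^-1).
Proof.
move=> Ct; rewrite /Cfun.
apply: (@dc_ext _ C _ (fun e : env (ext_vars V s) =>
   t (fun u x => e u (inl x)) * tau (e s (inr erefl)) = 1)).
  by move=> e; split=> [E|<-]; rewrite ?mulgV //; apply: (mulgI (t (fun u x => e u (inl x)))); rewrite E mulgV.
apply: Cfun_eq; last exact: Cfun_one.
apply: Cfun_mul; last exact: Cfun_var.
exact: (@Cfun_rel _ _ Ct _ (fun u x => inl (inl x)) (inr erefl)).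
Qed.

Lemma Cfun_prod V n (t : 'I_n -> env V -> H) : (forall j, Cfun (t j)) ->
  Cfun (fun e => \prod_(j < n) t j e).
Proof.
move=> Ct; suff h l : Cfun (fun e => \prod_(j <- l) t j e) by exact: h.
elim: l => [|j l IHl].
  have -> : (fun e => \prod_(j <- [::]) t j e) = (fun _ => 1).
    by apply: funext => e; rewrite big_nil.
  exact: Cfun_one.
have -> : (fun e => \prod_(i <- j :: l) t i e) = (fun e => t j e * \prod_(i <- l) t i e).
  by apply: funext => e; rewrite big_cons.
exact: Cfun_mul.
Qed.

Lemma Cfun_commutator V (t u : env V -> H) : Cfun t -> Cfun u ->
  Cfun (fun e => commutator (t e) (u e)).
Proof.
by move=> Ct Cu; apply: Cfun_mul; [apply: Cfun_mul; [apply: Cfun_mul|]|]; try apply: Cfun_inv.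
Qed.

Lemma Cfun_triple_word V (G : groupType) r (c : G -> G -> H) (x : env V -> 'I_#|{: word_index r}| -> G) :
  (forall i j, Cfun (fun e => c (x e i) (x e j))) -> Cfun (fun e => triple_word c (x e)).
Proof.
move=> Cc; have cw k : Cfun (fun e => comm_word c (fun z => letter (x e) k z.1 z.2)).
  by apply: Cfun_prod => j; apply: Cc.
by apply: Cfun_mul; [apply: Cfun_mul|apply: Cfun_inv].
Qed.

End GroupWords.

Section ParameterExtraction.
Variable N : structure.
Hypothesis dflt : forall s, dom N s.
Hypothesis fin_arity : forall r s, exists n (h : arity N r s -> 'I_n) h', cancel h h'.

(** Definability with parameters offers all elements as constants, but an imaginary absorbs a finite
    tuple; a formula mentions finitely many constants because arities are finite. [sub] tells which
    variables are constants. *)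
Lemma finitely_many_parameters W (phi : formula W) V (sub : forall s, W s -> V s + dom N s) :
  exists (g : sorts N -> nat) (z : env (fun s => 'I_(g s))) (psi : formula (fun s => (V s + 'I_(g s))%type)),
  forall e : env V, sat phi (fun s w => match sub s w with inl v => e s v | inr a => a end) <->
    sat psi (join_env e z).
Proof.
elim: phi V sub => {W} [W|W s x y|W r x|W phi IH1 psi IH2|W s phi IH] V sub.
- have z0 : env (fun _ : sorts N => 'I_0) by move=> s [].
  by exists (fun _ => 0), z0, (FBot _).
- have one (a : dom N s) : exists z : env (fun _ : sorts N => 'I_1), z s ord0 = a.
    exists (fun t _ => match pselect (s = t) with
      | left h => match h in _ = t return dom N t with erefl => a end | right _ => dflt t end).
    by case: pselect => // h; rewrite (Prop_irrelevance h erefl).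
  pose F (V' : sorts N -> Type) (p q : V' s) := FEq p q.
  case E1: (sub s x) => [v|a]; case E2: (sub s y) => [w|b].
  + have z0 : env (fun _ : sorts N => 'I_0) by move=> t [].
    exists (fun _ => 0), z0, (F (fun t => (V t + 'I_0)%type) (inl v) (inl w)) => e /=.
    by rewrite E1 E2.
  + have [z zE] := one b.
    exists (fun _ => 1%N), z, (F (fun t => (V t + 'I_1)%type) (inl v) (inr ord0)) => e /=.
    by rewrite E1 E2 zE.
  + have [z zE] := one a.
    exists (fun _ => 1%N), z, (F (fun t => (V t + 'I_1)%type) (inr ord0) (inl w)) => e /=.
    by rewrite E1 E2 zE.
  (* An equation between two constants is replaced by its truth value. *)
  have z0 : env (fun _ : sorts N => 'I_0) by move=> t [].
  have [ab|ab] := pselect (a = b).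
    exists (fun _ => 0), z0, (FImp (FBot _) (FBot _)) => e /=.
    by rewrite E1 E2.
  by exists (fun _ => 0), z0, (FBot _) => e /=; rewrite E1 E2.
- have /choice[n hn] : forall s, exists n, exists (h : arity N r s -> 'I_n) h', cancel h h'.
    by move=> s; have [n ?] := fin_arity r s; exists n.
  have hh s : {h : (arity N r s -> 'I_(n s)) * ('I_(n s) -> arity N r s) | cancel h.1 h.2}.
    by apply: cid; have [h [h' hK]] := hn s; exists (h, h').
  (* Every argument position has its own slot in the tuple; slots that hold no constant are filled
     with [dflt]. *)
  pose z : env (fun s => 'I_(n s)) := fun s j =>
    match sub s (x s ((sval (hh s)).2 j)) with inl _ => dflt s | inr a => a end.
  exists n, z, (@FRel N (fun s => (V s + 'I_(n s))%type) r (fun s u =>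
    match sub s (x s u) with inl v => inl v | inr _ => inr ((sval (hh s)).1 u) end)) => e /=.
  rewrite (_ : (fun s z0 => _) = (fun s u => join_env e z (match sub s (x s u) with
    | inl v => inl v | inr _ => inr ((sval (hh s)).1 u) end))) //.
  apply: functional_extensionality_dep => s; apply: funext => u.
  by case E: (sub s (x s u)) => [v|a] //=; rewrite /z (svalP (hh s)) E.
- have [g1 [z1 [psi1 h1]]] := IH1 V sub; have [g2 [z2 [psi2 h2]]] := IH2 V sub.
  pose z : env (fun s => 'I_(g1 s + g2 s)) := fun s j =>
    match fintype.split j with inl k => z1 s k | inr k => z2 s k end.
  pose r1 s (u : V s + 'I_(g1 s)) : V s + 'I_(g1 s + g2 s) :=
    match u with inl v => inl v | inr k => inr (lshift (g2 s) k) end.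
  pose r2 s (u : V s + 'I_(g2 s)) : V s + 'I_(g1 s + g2 s) :=
    match u with inl v => inl v | inr k => inr (rshift (g1 s) k) end.
  exists (fun s => (g1 s + g2 s)%N), z, (FImp (frename psi1 r1) (frename psi2 r2)) => e /=.
  have E1 : (fun s u => join_env e z (r1 s u)) = join_env e z1.
    apply: env_ext => s [v|k] //=.
    by rewrite /z -[lshift _ k]/(unsplit (inl k)) unsplitK.
  have E2 : (fun s u => join_env e z (r2 s u)) = join_env e z2.
    apply: env_ext => s [v|k] //=.
    by rewrite /z -[rshift _ k]/(unsplit (inr k)) unsplitK.
  by rewrite !sat_frename E1 E2 h1 h2.
pose sub' t (w : ext_vars W s t) : ext_vars V s t + dom N t :=
  match w with
  | inl w => match sub t w with inl v => inl (inl v) | inr a => inr a end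
  | inr h => inl (inr h)
  end.
have [g [z [psi hpsi]]] := IH _ sub'.
pose q t (u : ext_vars V s t + 'I_(g t)) : ext_vars (fun t => (V t + 'I_(g t))%type) s t :=
  match u with inl (inl v) => inl (inl v) | inl (inr h) => inr h | inr k => inl (inr k) end.
exists g, z, (FEx (frename psi q)) => e /=.
have E a : (fun t u => ext_env (join_env e z) a (q t u)) = join_env (ext_env e a) z.
  by apply: env_ext => t [[]|].
have E' a : (fun t w => match sub' t w with inl v => ext_env e a v | inr b => b end) =
    ext_env (fun t w => match sub t w with inl v => e t v | inr b => b end) a.
  by apply: env_ext => t [w|h] //=; case: (sub t w).
by split=> -[a]; [rewrite -E' hpsi => h|rewrite sat_frename E -hpsi E' => h]; exists a => //;
  rewrite sat_frename E.
Qed.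

End ParameterExtraction.

(** * Definability in the structure of the extension *)

Section ExtensionStructure.
Variables (A Gt G : groupType) (i : {multiplicative A -> Gt}) (p : {multiplicative Gt -> G}).
Variables (S : relations G) (C : defclass (extension_structure i p S)).
Local Notation N := (extension_structure i p S).
Variable lift : G -> Gt.
Hypothesis liftP : forall u v, commutator u v = commutator (lift (p u)) (lift (p v)).
Hypothesis liftK : forall x, p (lift x) = x.

Lemma extension_mul V (x y z : V Gt3) :
  C V (fun e : env (N := N) V => (e Gt3 x : Gt) * e Gt3 y = e Gt3 z).
Proof.
exact: (@dc_rel _ C V MulGt3 (fun s => match s return arity N MulGt3 s -> V s with
  | Gt3 => fun j : 'I_3 => if j == 0 :> nat then x else if j == 1%N :> nat then y else z
  | A3 => fun h : void => match h with end | G3 => fun h : void => match h with end end)).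
Qed.

Let Cfun V := @Cfun N C Gt3 Gt (fun x => x) V.

Lemma extension_i V (a : V A3) : Cfun (fun e : env (N := N) V => i (e A3 a)).
Proof.
exact: (@dc_rel _ C _ GraphI (fun s => match s return arity N GraphI s -> ext_vars (N := N) V Gt3 s with
  | A3 => fun _ => inl a | Gt3 => fun _ => inr erefl | G3 => fun h : void => match h with end end)).
Qed.

Lemma extension_p V (u : V Gt3) (x : V G3) : C V (fun e : env (N := N) V => p (e Gt3 u) = e G3 x).
Proof.
exact: (@dc_rel _ C _ GraphP (fun s => match s return arity N GraphP s -> V s with
  | A3 => fun h : void => match h with end | Gt3 => fun _ => u | G3 => fun _ => x end)).
Qed.

(** [lift] is not in the language and is again replaced by a quantifier over preimages. *)
Lemma extension_c2 V (x y : V G3) :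
  Cfun (fun e : env (N := N) V => commutator (lift (e G3 x)) (lift (e G3 y))).
Proof.
apply: (@dc_ext _ C (ext_vars (N := N) V Gt3) (fun e => exists u v : Gt,
  p u = e G3 (inl x) /\ p v = e G3 (inl y) /\ commutator u v = e Gt3 (inr erefl))).
  move=> e; split=> [[u [v [pu [pv]]]]|E]; first by rewrite liftP pu pv.
  by exists (lift (e G3 (inl x))), (lift (e G3 (inl y))); rewrite !liftK.
apply: (@dc_ex _ C _ Gt3); apply: (@dc_ex _ C _ Gt3).
apply: dc_and; first exact: extension_p (inl (inr erefl)) (inl (inl (inl x))).
apply: dc_and; first exact: extension_p (inr erefl) (inl (inl (inl y))).
have cv := fun V x => @Cfun_var N C Gt3 Gt (fun x => x) (fun x => x) (fun _ => erefl) V x.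
apply: (@Cfun_eq N C Gt3 Gt (fun x => x) (fun x => x) (fun _ => erefl)); last exact: cv.
apply: (@Cfun_commutator N C Gt3 Gt (fun x => x) (fun x => x)) => //; by [apply: extension_mul|apply: cv].
Qed.

End ExtensionStructure.

(** * Canonical parameters in the pair structure *)

Section PairStructure.
Variables (G A : groupType) (S : relations G).
Local Notation N := (pair_structure A S).

Lemma group_formula_in_pair (C : defclass N) V (phi : formula V) V'
    (q : forall s : sorts (group_structure S), V s -> V' G2) :
  C V' (fun e => sat phi (fun (s : sorts (group_structure S)) v => e G2 (q s v))).
Proof.
apply: (@interpretation (group_structure S) N C (fun _ => G2) (fun _ x => x) (fun _ x => x)) => //.
move=> [r'|] W x.
  exact: (@dc_rel _ C W (Extra2 r') (fun s => match s return arity N (Extra2 r') s -> W s with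
    | G2 => x tt | A2 => fun h : void => match h with end end)).
exact: (@dc_rel _ C W MulG2 (fun s => match s return arity N MulG2 s -> W s with
    | G2 => x tt | A2 => fun h : void => match h with end end)).
Qed.

Lemma pair_finitely_many_parameters V (X : env (N := N) V -> Prop) :
  definable_by (N := N) (fun s (a : dom N s) => a) X ->
  exists (g : sorts N -> nat) (z : env (N := N) (fun s => 'I_(g s)))
    (psi : formula (fun s => (V s + 'I_(g s))%type)),
  forall e, X e <-> sat psi (join_env e z).
Proof.
case=> phi hphi.
have [||g [z [psi hpsi]]] := @finitely_many_parameters N _ _ _ phi V (fun s x => x).
- by case; [exact: (1 : G)|exact: (1 : A)].
- have h0 : exists n (h : void -> 'I_n) h', cancel h h'.
    by exists 0, (fun x : void => match x with end),
      (fun x : 'I_0 => match x with Ordinal _ h => False_rect _ (notF h) end); case.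
  have hn n : exists m (h : 'I_n -> 'I_m) h', cancel h h' by exists n, id, id.
  by case=> [||r] [] //=.
exists g, z, psi => e; rewrite hphi -hpsi.
by rewrite (_ : join_env e _ = fun s w => match w with inl v => e s v | inr a => a end).
Qed.

Lemma eq_formula (N' : structure) (C : defclass (eq_structure N')) V (phi : formula V) V'
    (q : forall s : sorts N', V s -> V' (inl s)) :
  C V' (fun e => sat phi (fun (s : sorts N') v => e (inl s) (q s v))).
Proof.
apply: (@interpretation N' (eq_structure N') C inl (fun _ x => x) (fun _ x => x)) => // r W x.
exact: (@dc_rel _ C W (inl r) (fun t => match t return arity (eq_structure N') (inl r) t -> W t with
    | inl s => x s | inr _ => fun h : void => match h with end end)).
Qed.

(** The imaginary is the class of the parameters [z] of [psi], two tuples being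
    equivalent when they define the same set. *)
Lemma canonical_parameter k (X : ('I_k -> G) -> (unit -> A) -> Prop) :
  definable_by (N := N) (fun s (a : dom N s) => a) (pair_set (S := S) X) ->
  exists (Q : imaginary_sort N) (c : imaginary Q), pair_names c X /\ pair_definable_over c X.
Proof.
move=> /pair_finitely_many_parameters[g [z [psi hpsi]]].
pose V := pair_vars (A := A) (S := S) 'I_k unit.
pose same (x y : env (N := N) (fun s => 'I_(g s))) := forall e : env (N := N) V,
  sat psi (join_env e x) <-> sat psi (join_env e y).
(* Defining the same set is a first-order condition on two parameter tuples, without parameters. *)
have [phi hphi] : exists phi : formula (N := N) (fun s => ('I_(g s) + 'I_(g s))%type),
    forall x y, sat phi (join_env x y) <-> same x y.
  pose C := zero_class N.
  pose W := fun s : sorts N => ('I_(g s) + 'I_(g s))%type.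
  have Cpsi V' (q : forall s, V s + 'I_(g s) -> V' s) :
      C V' (fun e => sat psi (fun s v => e s (q s v))).
    exact: (@interpretation N N C (fun s => s) (fun _ x => x) (fun _ x => x) (fun _ _ => erefl) (fun _ _ => erefl) (fun r V' x => dc_rel C x)).
  have : C W (fun e => ~ exists (x : 'I_k -> dom N G2) (a : dom N A2),
      ~ (sat psi (join_env (fun s => match s return V s -> dom N s with G2 => x | A2 => fun _ => a end) (fun s j => e s (inl j))) <->
       sat psi (join_env (fun s => match s return V s -> dom N s with G2 => x | A2 => fun _ => a end) (fun s j => e s (inr j))))).
    apply: dc_not; apply: (@dc_exv N C W G2 k).
    apply: (@dc_ex _ C _ A2); apply: dc_not.
    pose q (b : bool) s (v : V s + 'I_(g s)) : ext_vars (N := N) (vec_vars (N := N) W G2 k) A2 s :=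
      match v with
      | inl v => match s return V s -> ext_vars (N := N) (vec_vars (N := N) W G2 k) A2 s with
          | G2 => fun j => inl (inr (j, erefl)) | A2 => fun _ => inr erefl end v
      | inr j => inl (inl (if b then inl j else inr j))
      end.
    have E b e : (fun s v => e s (q b s v)) = join_env
        (fun s => match s return V s -> dom N s with G2 => fun j => e G2 (inl (inr (j, erefl))) | A2 => fun _ => e A2 (inr erefl) end)
        (fun s j => e s (inl (inl (if b then inl j else inr j)))) :> env (N := N) (fun s => (V s + 'I_(g s))%type).
      by apply: env_ext => -[] [].
    have h1 := Cpsi _ (q true); have h2 := Cpsi _ (q false).
    apply: (@dc_ext _ C _ (fun e => sat psi (fun s v => e s (q true s v)) <-> sat psi (fun s v => e s (q false s v)))).
      by move=> e; rewrite !E.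
    by apply: dc_and; apply: dc_imp.
  move=> /zeroE[phi hphi]; exists phi => x y; rewrite -hphi /same; split=> [n e|h [u [a]]]; last exact.
  apply: contrapT => ne; apply: n; exists (e G2), (e A2 tt).
  rewrite (_ : (fun s => _) = e) //.
  by apply: functional_extensionality_dep => -[] //; apply: funext => -[].
have Qrefl x : sat phi (join_env x x) by apply/hphi => e.
have Qsym x y : sat phi (join_env x y) -> sat phi (join_env y x).
  by move=> /hphi h; apply/hphi => e; apply: iff_sym.
have Qtrans x y w : sat phi (join_env x y) -> sat phi (join_env y w) -> sat phi (join_env x w).
  by move=> /hphi h /hphi h'; apply/hphi => e; apply: iff_trans (h e) (h' e).
pose Q := @ImaginarySort N g phi Qrefl Qsym Qtrans.
pose cls (x : env (N := N) (fun s => 'I_(iarity Q s))) : imaginary Q :=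
  exist _ [set y | irel x y] (ex_intro _ x erefl).
have clsP c : exists x, c = cls x.
  case: c => c [x cE]; exists x; rewrite /cls.
  by subst c; congr exist; apply: Prop_irrelevance.
have cls_eq x y : same x y <-> cls x = cls y.
  split=> [xy|/(congr1 sval) /= E]; last first.
    by apply/hphi; have : [set y' | sat phi (join_env x y')] y by rewrite E; apply: Qrefl.
  have E : [set y' | sat phi (join_env x y')] = [set y' | sat phi (join_env y y')].
    apply/seteqP; split=> w /= /hphi h; apply/hphi => e; [apply: iff_trans (h e)|apply: iff_trans (h e)] => //.
    exact: iff_sym.
  rewrite /cls; move: (ex_intro _ x _) (ex_intro _ y _); rewrite /irel /= E => h h'.
  by congr exist; apply: Prop_irrelevance.
pose C := zero_class (eq_structure N).
pose V' := ext_vars (N := eq_structure N) (home_vars (N := N) V) (inr Q).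
(* [chi] says that some tuple of the class given by the imaginary satisfies [psi]; equivalent tuples
   define the same set, so it does not matter which one. *)
have [chi hchi] : exists chi : formula (N := eq_structure N) V', forall (e : env (N := eq_structure N) V'),
    sat chi e <-> exists (x : 'I_(g G2) -> dom N G2) (y : 'I_(g A2) -> dom N A2),
      let z' := (fun s => match s return 'I_(g s) -> dom N s with G2 => x | A2 => y end) in
      sval (e (inr Q) (inr erefl) : imaginary Q) z' /\
      sat psi (join_env (fun s v => e (inl s) (inl v)) z').
  have : C V' (fun e => exists (x : 'I_(g G2) -> dom N G2) (y : 'I_(g A2) -> dom N A2),
      let z' := (fun s => match s return 'I_(g s) -> dom N s with G2 => x | A2 => y end) in
      sval (e (inr Q) (inr erefl) : imaginary Q) z' /\
      sat psi (join_env (fun s v => e (inl s) (inl v)) z')).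
    apply: (@dc_exv (eq_structure N) C V' (inl G2) (g G2)).
    apply: (@dc_exv (eq_structure N) C _ (inl A2) (g A2)).
    set V2 := vec_vars _ _ _.
    pose q s (j : 'I_(g s)) : V2 (inl s) :=
      match s return 'I_(g s) -> V2 (inl s) with
      | G2 => fun j => inl (inr (j, erefl)) | A2 => fun j => inr (j, erefl) end j.
    have qE (e : env (N := eq_structure N) V2) : (fun s => match s return 'I_(g s) -> dom N s with
        | G2 => fun j => e (inl G2) (inl (inr (j, erefl)))
        | A2 => fun j => e (inl A2) (inr (j, erefl)) end) = (fun s j => e (inl s) (q s j)).
      by apply: functional_extensionality_dep => -[].
    apply: dc_and.
      pose x t : arity (eq_structure N) (inr Q) t -> V2 t :=
        match t return arity (eq_structure N) (inr Q) t -> V2 t with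
        | inl s => q s
        | inr Q' => fun h : Q = Q' => inl (inl (inr (congr1 inr h)))
        end.
      apply: (dc_ext _ (@dc_rel _ C V2 (inr Q) x)) => e /=.
      by rewrite qE.
    pose q' s (v : V s + 'I_(g s)) : V2 (inl s) :=
      match v with inl v => inl (inl (inl v)) | inr j => q s j end.
    apply: (dc_ext _ (@eq_formula N C _ psi _ q')) => e.
    rewrite qE; apply: iff_sym; set e1 := join_env _ _.
    rewrite (_ : e1 = fun s v => e (inl s) (q' s v)) //.
    by apply: env_ext => s [].
  by move=> /zeroE[chi hchi]; exists chi => e; rewrite hchi.
have chiE z' (e : env (N := eq_structure N) (home_vars (N := N) V)) :
    sat chi (@ext_env (eq_structure N) _ e (inr Q) (cls z')) <-> sat psi (join_env (fun s v => e (inl s) v : dom N s) z').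
  rewrite hchi; split=> [[x [y [h1 h2]]]|h].
    exact: (((hphi z' _).1 h1 _).2 h2).
  exists (z' G2), (z' A2).
  have E : (fun s => match s return 'I_(g s) -> dom N s with G2 => z' G2 | A2 => z' A2 end) = z'.
    by apply: functional_extensionality_dep => -[].
  by rewrite /= E; split=> //; apply: Qrefl.
exists Q, (cls z); split.
  exists chi => c'; have [z' ->] := clsP c'; rewrite -cls_eq; split=> h e.
    pose e' : env (N := eq_structure N) (home_vars (N := N) V) :=
      fun t => match t return home_vars (N := N) V t -> dom (eq_structure N) t with
        | inl s => e s | inr _ => fun h : void => match h with end end.
    have := h e'; rewrite chiE /= => <-; exact: (hpsi e).
  by rewrite chiE (h _); apply: (hpsi (fun s => e (inl s))).
exists chi => e; rewrite chiE; exact: (hpsi (fun s => e (inl s))).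
Qed.

End PairStructure.

(** * The group law on words and elements of A *)

Section Words.
Variables (A Gt G : groupType) (i : {multiplicative A -> Gt}).
Hypothesis i_central : forall a x, i a * x = x * i a.
Variables (r : nat) (c : G -> G -> Gt).
Hypothesis c11 : c 1 1 = 1.

Definition pair_letters T (x : 'I_#|{: 'I_r * bool}| -> T) (z : 'I_r * bool) : T := x (enum_rank z).

Definition assemble T (x0 x1 x2 : 'I_#|{: 'I_r * bool}| -> T) (j : 'I_#|{: word_index r}|) : T :=
  let z := enum_val j : word_index r in
  (if z.1 == 0 :> nat then x0 else if z.1 == 1%N :> nat then x1 else x2) (enum_rank z.2).

Lemma triple_word_assemble x0 x1 x2 : triple_word c (assemble x0 x1 x2) =
  comm_word c (pair_letters x0) * comm_word c (pair_letters x1) * (comm_word c (pair_letters x2))^-1.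
Proof.
have E k : (fun z => letter (assemble x0 x1 x2) k z.1 z.2) =
    pair_letters (if k == 0 :> nat then x0 else if k == 1%N :> nat then x1 else x2).
  by apply: funext => -[l b]; rewrite /letter /assemble enum_rankK.
by rewrite /triple_word !E.
Qed.

Lemma comm_word1 : comm_word c (pair_letters (fun _ => 1)) = 1.
Proof. by rewrite /comm_word big1. Qed.

Definition class_map x a := comm_word c (pair_letters x) * i a.

(** The lifted words multiply up to an element [b] of A, read off from [triple_word], and centrality
    of [i A] collects the components in A. The law on pairs is thus expressed by the graph of
    [triple_word] and the multiplication of A. *)
Lemma class_map_mul x0 x1 x2 a0 a1 a2 :
  class_map x0 a0 * class_map x1 a1 = class_map x2 a2 <->
  exists b, triple_word c (assemble x0 x1 x2) = i b /\ b * (a0 * a1) = a2.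
Proof.
rewrite triple_word_assemble /class_map.
set w0 := comm_word _ _; set w1 := comm_word _ _; set w2 := comm_word _ _.
have -> : w0 * i a0 * (w1 * i a1) = w0 * w1 * i (a0 * a1).
  by rewrite gmulfM -!mulgA (mulgA (i a0)) (i_central a0 w1) !mulgA.
split=> [E|[b [E <-]]].
  exists (a2 * (a0 * a1)^-1); split; last by rewrite mulgVK.
  have -> : w0 * w1 = w2 * i (a2 * (a0 * a1)^-1) by rewrite gmulfM morphV mulgA -E mulgK.
  by rewrite -i_central mulgK.
by rewrite (gmulfM b) mulgA -(i_central b w2) -E mulgVK.
Qed.

End Words.

Section DefinableSequence.
Variables (A Gt G : groupType) (i : {multiplicative A -> Gt}) (p : {multiplicative Gt -> G}).
Variables (S : relations G) (r : nat) (c2 : G -> G -> Gt).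
Hypothesis i_central : forall a x, i a * x = x * i a.
Hypotheses (p_i : forall a, p (i a) = 1) (i_ker : forall x, p x = 1 -> exists a, i a = x).
Hypotheses (c11 : c2 1 1 = 1) (p_c2 : forall x y, p (c2 x y) = commutator x y).
Hypothesis hr : [set: G] = commutator_products G r.
Local Notation N := (pair_structure A S).
Variables (Q : imaginary_sort N) (c : imaginary Q).
Hypothesis word_definable : pair_definable_over c
  (fun (x : 'I_#|{: word_index r}| -> G) (a : unit -> A) => triple_word c2 x = i (a tt)).

Let NE := eq_structure N.
Let C : defclass NE := @definable_class NE (fun t => inr Q = t)
  (fun t h => match h in _ = t return dom NE t with erefl => c end).
Let G' : sorts NE := inl G2.
Let A' : sorts NE := inl A2.

Let mulG (V : sorts NE -> Type) (x y z : V G') : C V (fun e => (e G' x : G) * e G' y = e G' z).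
Proof.
exact: (@dc_rel _ C V (inl MulG2) (fun t => match t return arity NE (inl MulG2) t -> V t with
  | inl G2 => fun j : 'I_3 => if j == 0 :> nat then x else if j == 1%N :> nat then y else z
  | inl A2 => fun h : void => match h with end | inr _ => fun h : void => match h with end end)).
Qed.

Let mulA (V : sorts NE -> Type) (x y z : V A') : C V (fun e => (e A' x : A) * e A' y = e A' z).
Proof.
exact: (@dc_rel _ C V (inl MulA2) (fun t => match t return arity NE (inl MulA2) t -> V t with
  | inl A2 => fun j : 'I_3 => if j == 0 :> nat then x else if j == 1%N :> nat then y else z
  | inl G2 => fun h : void => match h with end | inr _ => fun h : void => match h with end end)).
Qed.

Let idK (T : Type) : cancel (fun x : T => x) (fun x => x). Proof. by []. Qed.
Let varG := fun V x => @Cfun_var NE C G' G (fun x => x) (fun x => x) (@idK _) V x.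
Let varA := fun V x => @Cfun_var NE C A' A (fun x => x) (fun x => x) (@idK _) V x.

Let word_rel V (x : 'I_#|{: word_index r}| -> V G') (a : V A') :
  C V (fun e => triple_word c2 (fun j => e G' (x j) : G) = i (e A' a)).
Proof.
pose q t : home_vars (N := N) (pair_vars (A := A) (S := S) 'I_#|{: word_index r}| unit) t -> V t :=
  match t with
  | inl G2 => x | inl A2 => fun _ => a | inr _ => fun h : void => match h with end
  end.
exact: (dc_ren q (word_definable : C _ _)).
Qed.

Let mul_rel V (x0 x1 x2 : 'I_#|{: 'I_r * bool}| -> V G') (a0 a1 a2 : V A') :
  C V (fun e => class_map i c2 (fun j => e G' (x0 j) : G) (e A' a0) *
    class_map i c2 (fun j => e G' (x1 j) : G) (e A' a1) =
    class_map i c2 (fun j => e G' (x2 j) : G) (e A' a2)).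
Proof.
apply: (@dc_ext _ C V (fun e => exists b : A,
  triple_word c2 (fun j => e G' (assemble x0 x1 x2 j) : G) = i b /\ b * (e A' a0 * e A' a1) = e A' a2)).
  move=> e; rewrite (class_map_mul i_central).
  rewrite (_ : (fun j => e G' (assemble x0 x1 x2 j)) =
    assemble (fun j => e G' (x0 j)) (fun j => e G' (x1 j)) (fun j => e G' (x2 j))) //.
  by apply: funext => j; rewrite /assemble; case: ifP => // _; case: ifP.
apply: (@dc_ex _ C V A'); apply: dc_and.
  exact: (word_rel (fun j => inl (assemble x0 x1 x2 j)) (inr erefl)).
apply: (@Cfun_eq NE C A' A (fun x => x) (fun x => x) (@idK _)); last exact: varA.
apply: (@Cfun_mul NE C A' A (fun x => x) (fun x => x) (@idK _) mulA); first exact: varA.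
by apply: (@Cfun_mul NE C A' A (fun x => x) (fun x => x) (@idK _) mulA); exact: varA.
Qed.

(** The units are not symbols of the language; they are introduced as idempotents. *)
Let with_one V (P : env V -> G -> A -> Prop) :
  C (ext_vars (ext_vars V G') A') (fun e => P (fun t x => e t (inl (inl x))) (e G' (inl (inr erefl))) (e A' (inr erefl))) ->
  C V (fun e => P e 1 1).
Proof.
move=> CP; apply: (@dc_ext _ C V (fun e => exists (o : G) (u : A), (o * o = o /\ u * u = u) /\ P e o u)).
  move=> e; split=> [[o [u [[oo uu]]]]|h]; last by exists 1, 1; rewrite !mulg1.
  by rewrite (mulgI o o 1) ?mulg1 // (mulgI u u 1) ?mulg1.
apply: (@dc_ex _ C V G'); apply: (@dc_ex _ C _ A'); apply: dc_and => //; apply: dc_and.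
  exact: mulG.
exact: mulA.
Qed.

(** By condition (3), [p h] is a product of [r] commutators of G, and their entries are the letters
    of the word. *)
Lemma comm_word_lift h : exists x, p h = p (comm_word c2 (pair_letters (r := r) x)).
Proof.
have [x [y ph]] : commutator_products G r (p h) by rewrite -hr.
exists (fun k => let z := enum_val k in if z.2 then x z.1 else y z.1).
rewrite ph /comm_word morph_prod; apply: eq_bigr => j _.
by rewrite p_c2 /pair_letters !enum_rankK.
Qed.

Lemma class_map_surj h : exists x a, class_map i c2 (r := r) x a = h.
Proof.
have [x phx] := comm_word_lift h.
have [|a ia] := i_ker (x := (comm_word c2 (pair_letters x))^-1 * h).
  by rewrite gmulfM morphV phx mulVg.
by exists x, a; rewrite /class_map ia mulVKg.
Qed.

Lemma p_class_map x a :
  p (class_map i c2 (r := r) x a) = comm_word (@commutator G) (pair_letters x).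
Proof.
by rewrite /class_map gmulfM p_i mulg1 /comm_word morph_prod; apply: eq_bigr => j _; rewrite p_c2.
Qed.

Lemma sequence_definable : sequence_definable_over c i p (fun _ _ => True)
  (fun x (a : 'I_1 -> A) => class_map i c2 (r := r) x (a ord0)).
Proof.
split.
  by move=> h; have [x [a E]] := class_map_surj h; exists x, (fun _ => a).
split.
- exact: (dc_true C).
- pose V := home_vars (N := N) (pair_vars (A := A) (S := S) ('I_2 * 'I_#|{: 'I_r * bool}|)%type ('I_2 * 'I_1)%type).
  pose j0 := @Ordinal 2 0 isT; pose j1 := @Ordinal 2 1 isT.
  suff : C V (fun e =>
      class_map i c2 (fun j => e G' (j0, j) : G) (e A' (j0, ord0)) * class_map i c2 (r := r) (fun _ => 1) 1 =
      class_map i c2 (fun j => e G' (j1, j) : G) (e A' (j1, ord0))).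
    apply: dc_ext => e.
    by rewrite {2}/class_map (comm_word1 r c11) morph1 !mulg1; split=> [|[_]].
  apply: (with_one (P := fun e o u =>
      class_map i c2 (fun j => e G' (j0, j) : G) (e A' (j0, ord0)) * class_map i c2 (r := r) (fun _ => o) u =
      class_map i c2 (fun j => e G' (j1, j) : G) (e A' (j1, ord0)))).
  exact: (mul_rel (fun j => inl (inl (j0, j))) (fun _ => inl (inr erefl)) (fun j => inl (inl (j1, j)))
    (inl (inl (j0, ord0))) (inr erefl) (inl (inl (j1, ord0)))).
- pose V := home_vars (N := N) (pair_vars (A := A) (S := S) ('I_3 * 'I_#|{: 'I_r * bool}|)%type ('I_3 * 'I_1)%type).
  pose j0 := @Ordinal 3 0 isT; pose j1 := @Ordinal 3 1 isT; pose j2 := @Ordinal 3 2 isT.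
  have := @mul_rel V (fun j => (j0, j)) (fun j => (j1, j)) (fun j => (j2, j)) (j0, ord0) (j1, ord0) (j2, ord0).
  by apply: dc_ext => e; split=> [|[_]].
- pose V := home_vars (N := N) (pair_vars (A := A) (S := S) 'I_#|{: 'I_r * bool}| ('I_1 + unit)%type).
  suff : C V (fun e => class_map i c2 (r := r) (fun _ => 1) (e A' (inr tt)) * class_map i c2 (r := r) (fun _ => 1) 1 =
      class_map i c2 (fun j => e G' j : G) (e A' (inl ord0))).
    apply: dc_ext => e.
    by rewrite {1 2}/class_map !(comm_word1 r c11) morph1 !mul1g mulg1; split=> [|[_]].
  apply: (with_one (P := fun e o u =>
      class_map i c2 (r := r) (fun _ => o) (e A' (inr tt)) * class_map i c2 (r := r) (fun _ => o) u =
      class_map i c2 (fun j => e G' j : G) (e A' (inl ord0)))).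
  exact: (mul_rel (fun _ => inl (inr erefl)) (fun _ => inl (inr erefl)) (fun j => inl (inl j))
    (inl (inl (inr tt))) (inr erefl) (inl (inl (inl ord0)))).
- pose V := home_vars (N := N) (pair_vars (A := A) (S := S) ('I_#|{: 'I_r * bool}| + unit)%type 'I_1).
  have : C V (fun e => comm_word (@commutator G) (pair_letters (fun j => e G' (inl j) : G)) = e G' (inr tt)).
    apply: (@Cfun_eq NE C G' G (fun x => x) (fun x => x) (@idK _)); last exact: varG.
    apply: (@Cfun_prod NE C G' G (fun x => x) (fun x => x) (@idK _) mulG) => j.
    by apply: (@Cfun_commutator NE C G' G (fun x => x) (fun x => x) (@idK _) (@idK _) mulG); exact: varG.
  by apply: dc_ext => e; split=> [E|[_ <-]]; [split=> //|]; rewrite /= p_class_map.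
Qed.

End DefinableSequence.

(** * Definability of the words without parameters *)

Section RelationDefinability.
Variables (A Gt G : groupType) (i : {multiplicative A -> Gt}) (p : {multiplicative Gt -> G}).
Variables (S : relations G) (r : nat).

Lemma definable0_relation : @definable0 (group_structure (no_relations G))
  (fun _ => 'I_#|{: word_index r}|) [set e | triple_word (@commutator G) (e tt) = 1].
Proof.
pose N := group_structure (no_relations G); pose C := zero_class N.
have mulC (V : unit -> Type) (x y z : V tt) : C V (fun e => (e tt x : G) * e tt y = e tt z).
  pose t (s : unit) (j : 'I_3) : V s :=
    match s with tt => if j == 0 :> nat then x else if j == 1%N :> nat then y else z end.
  exact: (@dc_rel _ C V None t).
have idK : cancel (fun x : G => x) (fun x => x) by [].
apply/zeroE; apply: (@Cfun_eq N C tt G (fun x => x) (fun x => x) idK); last exact: Cfun_one.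
apply: (@Cfun_triple_word N C tt G (fun x => x) (fun x => x) idK idK mulC) => j j'.
by apply: (@Cfun_commutator N C tt G (fun x => x) (fun x => x) idK idK mulC); apply: Cfun_var.
Qed.

Variable lift : G -> Gt.
Hypothesis liftP : forall u v, commutator u v = commutator (lift (p u)) (lift (p v)).
Hypothesis liftK : forall x, p (lift x) = x.
Local Notation c2 := (fun x y => commutator (lift x) (lift y)).
Variable C : defclass (extension_structure i p S).
Local Notation N := (extension_structure i p S).

Let idK : cancel (fun x : Gt => x) (fun x => x). Proof. by []. Qed.
Let mulC := @extension_mul A Gt G i p S C.

Lemma definable_word_value : C (extension_vars unit void 'I_#|{: word_index r}|)
  (extension_set (fun (a : unit -> A) (_ : void -> Gt) x => triple_word c2 x = i (a tt))).
Proof.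
apply: (@Cfun_eq N C Gt3 Gt (fun x => x) (fun x => x) idK); last exact: extension_i.
by apply: (@Cfun_triple_word N C Gt3 Gt (fun x => x) (fun x => x) idK idK mulC) => j j'; apply: extension_c2.
Qed.

Lemma definable_class_map : C (extension_vars 'I_1 unit 'I_#|{: 'I_r * bool}|)
  (extension_set (fun (a : 'I_1 -> A) (y : unit -> Gt) x => class_map i c2 (r := r) x (a ord0) = y tt)).
Proof.
apply: (@Cfun_eq N C Gt3 Gt (fun x => x) (fun x => x) idK); last exact: Cfun_var.
apply: (@Cfun_mul N C Gt3 Gt (fun x => x) (fun x => x) idK mulC); last exact: extension_i.
by apply: (@Cfun_prod N C Gt3 Gt (fun x => x) (fun x => x) idK mulC) => j; apply: extension_c2.
Qed.

End RelationDefinability.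

Section ComponentGraph.
Context {d : Order.disp_t} {M : orderType d} {R : relations M} (D : ominsys M).
Hypothesis DE : forall I (X : set (I -> M)), definable_in_M R X <-> D I X.
Variables (G : definable_group R) (A : groupType) (S : relations G) (k : nat).
Variables (X : set {ptws 'I_k -> G}) (Y : {ptws 'I_k -> G} -> A -> Prop).
Hypotheses (rho : property_rho S) (X0 : definable_in_group (no_relations G) X).
Hypothesis DX : definable_power R (@Defs.coord _ _ _ G) X.
Hypothesis YX : forall x a, Y x a -> X x.
Hypothesis constY : forall C, definable_component X C ->
  exists b, forall x a, C x -> Y x a <-> a = b.

(** The graph is a finite union of products of a component with a point. Property rho defines the
    component, and the point is a parameter from A. *)
Lemma component_graph_definable :
  definable_by (N := pair_structure A S) (fun s (a : dom (pair_structure A S) s) => a)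
    (pair_set (S := S) (fun (x : 'I_k -> G) (a : unit -> A) => Y x (a tt))).
Proof.
pose N := pair_structure A S.
pose C := @definable_class N _ (fun s (a : dom N s) => a).
pose V := pair_vars (A := A) (S := S) 'I_k unit.
have piece Z : definable_in_group S Z -> C V (fun e => Z (e G2)).
  case=> phi hphi.
  pose W := fun s : sorts N => (V s + dom N s)%type.
  pose q (s : unit) (v : 'I_k + G) : W G2 := v.
  have /zeroE[psi hpsi] := @group_formula_in_pair G A S (zero_class N) _ phi W q.
  exists psi => e; rewrite -hpsi -[Z _]/([set e0 : env (N := group_structure S) (fun _ => 'I_k) | Z (e0 tt)] (fun _ => e G2)).
  rewrite hphi; set e1 := join_env _ _.
  by rewrite (_ : e1 = fun s v => join_env e (fun s (a : dom N s) => a) (q s v)) //.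
have const b : C V (fun e => e A2 tt = b :> A).
  by exists (@FEq N (fun s => (V s + dom N s)%type) A2 (inl tt) (inr b)).
have h Z : fu (definable_component X) Z -> C V (fun e => Z (e G2) /\ Y (e G2) (e A2 tt)).
  elim=> [|Z' cZ|Z1 Z2 _ IH1 _ IH2].
  - by apply: (dc_ext _ (dc_bot C V)) => e; split=> [|[]].
  - have [b hb] := constY cZ.
    apply: (dc_ext _ (dc_and (piece _ (rho X0 cZ)) (const b))) => e.
    by split=> -[Zx /(hb _ _ Zx)].
  apply: (dc_ext _ (dc_or IH1 IH2)) => e.
  by split=> [[[z y]|[z y]]|[[z|z] y]]; [split=> //; left|split=> //; right|left|right].
apply: (dc_ext _ (h _ (fu_components DE DX))) => e.
by split=> [[]//|Yx]; split=> //; apply: YX Yx.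
Qed.

End ComponentGraph.
Theorem theorem2p1 (d : Order.disp_t) (M : orderType d) (R : relations M)
  (A Gt G : definable_group R)
  (i : {multiplicative A -> Gt}) (p : {multiplicative Gt -> G})
  (S : relations G)
  (hM : o_minimal R)
  (hi : definable_map i) (hp : definable_map p)
  (hE : central_extension i p)
  (h1 : property_rho S)
  (h2 : forall n : nat, finite_set (range i `&` commutator_products Gt n))
  (h3 : exists r : nat, [set: G] = commutator_products G r) :
  exists (k : nat) (X : set {ptws 'I_k -> G}) (f : set {ptws 'I_k -> G} -> A)
    (Q : imaginary_sort (pair_structure A S)) (c : imaginary Q),
    [/\ @definable0 (group_structure (no_relations G)) (fun _ => 'I_k)
          [set e | X (e tt)],
        finite_set (f @` [set C | definable_component X C]),
        definable0 (extension_set (i := i) (p := p) (S := no_relations G)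
          (fun (a : unit -> A) (_ : void -> Gt) (x : 'I_k -> G) =>
             component_map_graph X f x (a tt))),
        pair_names c
          (fun (x : 'I_k -> G) (a : unit -> A) =>
             component_map_graph X f x (a tt))
      & exists (Gt' : groupType)
          (i' : {multiplicative A -> Gt'}) (p' : {multiplicative Gt' -> G})
          (m n : nat) (U : ('I_m -> G) -> ('I_n -> A) -> Prop)
          (cl : ('I_m -> G) -> ('I_n -> A) -> Gt')
          (h : {multiplicative Gt' -> Gt}),
          [/\ exact_sequence i' p',
              sequence_definable_over c i' p' U cl,
              bijective h,
              (forall a, h (i' a) = i a) /\ (forall x, p (h x) = p' x)
            & definable (extension_set (i := i) (p := p) (S := S)
                (fun (a : 'I_n -> A) (y : unit -> Gt) (x : 'I_m -> G) =>
                   U x a /\ h (cl x a) = y tt))]].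
Proof.
have [D DE0] := order_ominsys hM.
have DE I (X : set (I -> M)) : definable_in_M R X <-> D I X by rewrite DE0.
have [[i_inj iE _] i_central] := hE.
have p_i a : p (i a) = 1.
  by have : range i (i a) by [exists a]; rewrite iE.
have i_ker x : p x = 1 -> exists a, i a = x.
  by move=> px; have [a _ <-] : range i x by [rewrite iE]; exists a.
have [r hr] := h3; have [lift liftK] := lift_of_section hE.
have liftP u v : commutator u v = commutator (lift (p u)) (lift (p v)) by exact: (c2E hE liftK).
have p_c2 x y : p (commutator (lift x) (lift y)) = commutator x y.
  by rewrite /commutator !gmulfM !morphV !liftK.
have c11 : commutator (lift 1) (lift 1) = 1.
  by have := liftP 1 1; rewrite morph1 => <-; rewrite /commutator invg1 !mulg1.
have [f hf] := component_map DE hp hE liftK r h2.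
pose X : set {ptws 'I_#|{: word_index r}| -> G} := relation_set (G := G) (r := r).
(* If [phi] takes a value in [i A] at [x], then applying [p] shows that the relator is trivial, so
   membership in [X] follows from the equation. *)
have graphE x a : component_map_graph X f x a <-> phi lift x = i a.
  rewrite hf; split=> [[]//|E]; split=> //.
  by rewrite /relation_set /= -(p_phi liftK) E p_i.
have X0 : definable_in_group (no_relations G) X.
  have [phi0 hphi] := definable0_relation G r.
  exists (frename phi0 (fun s v => inl v)) => e.
  by rewrite sat_frename -hphi.
have [|Q [c [named over]]] := @canonical_parameter G A S _
    (fun x a => component_map_graph X f x (a tt)).
  apply: (component_graph_definable (Y := component_map_graph X f) DE h1 X0 (definable_relation_set DE _ _)) => [x a /hf[]//|C cC].
  have [CX [x Cx] _ _] := cC; exists (f C) => y a Cy.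
  split=> [/graphE E|->]; last by exists C.
  have : component_map_graph X f y (f C) by exists C.
  by rewrite graphE E => /i_inj.
exists #|{: word_index r}|, X, f, Q, c; split=> //.
- exact: definable0_relation.
(* Since [i] is injective, finiteness passes from the values of [phi] to those of [f]. *)
- have fin : finite_set [set a : A | (phi lift (r := r) @` X) (i a)].
    by apply: finite_preimage (finite_phi hE liftK r h2) => ? ? _ _; apply: i_inj.
  apply: sub_finite_set fin => _ [C cC <-] /=; have [CX [x Cx] _ _] := cC.
  by exists x; [apply: CX|apply/graphE; exists C].
- apply/zeroE; pose C := zero_class (extension_structure i p (no_relations G)).
  apply: (@dc_ext _ C _ _ _ _ (definable_word_value r liftP liftK C)) => e.
  by apply: iff_sym; apply: graphE.
(* As an abstract group the middle term of the new sequence is [Gt] itself, and [h] is the identity.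
   The content lies in its presentation by words and elements of A, which is definable over [c]. *)
exists Gt, i, p, #|{: 'I_r * bool}|, 1%N, (fun _ _ => True).
exists (fun x (a : 'I_1 -> A) => class_map i (fun x y => commutator (lift x) (lift y)) (r := r) x (a ord0)).
exists (idfun : {multiplicative Gt -> Gt}); split=> //.
- by case: hE.
- apply: (sequence_definable i_central p_i i_ker c11 p_c2 hr).
  rewrite (_ : (fun x a => _) = fun x a => component_map_graph X f x (a tt)) //.
  by apply: funext => x; apply: funext => a; apply: propext; apply: iff_sym; apply: graphE.
- apply: (@dc_ext (extension_structure i p S) (definable_class (fun s a => a)) _ _ _ _
    (definable_class_map r liftP liftK _)) => e.
  by split=> [|[]].
Qed.
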